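(* Let $M$ be a stationary positive weighted point measure on $\mathbb R$ of intensity $K\in(0,\infty)$, and let $h$ be a finite nonnegative measurable function on $[1,\infty)$ such that \[ \mathbb E|N_M(x)-Kx|\le h(|x|)\quad(|x|\ge1),\qquad\int_1^\infty\frac{h(r)}{r^2}\,dr<\infty. \] For every deterministic $s\in\mathbb R$ and $A\ge1$, \[ \mathbb E|F_M(s)-F^{\mathrm{sym}}_{M,A}(s)|\le T_h(A):=\frac{2h(A)}A+2\int_A^\infty\frac{h(x)}{x^2}\,dx. \] Consequently, \[ d_{\mathrm{BL}}\left(\mathrm{Law}\left(\frac{F^{\mathrm{sym}}_{M,A}(s)}{\pi K}\right),\mathrm{Cauchy}(0,1)\right)\le\frac{T_h(A)}{\pi K}. \] Both bounds hold with $h$ replaced by $g(r):=\mathbb E|N_M(r)-Kr|$, for which $T_g(A)\to0$ as $A\to\infty$ (no sublinearity of the chosen envelope $h$ is required). If $\mathbb E|N_M(x)-Kx|\le C(1+|x|^\alpha)$ for all $x\in\mathbb R$, with some $C<\infty$ and $\alpha\in[0,1)$, then with $h(x)=C(1+x^\alpha)$ one has $T_h(A)=O_{C,\alpha}(A^{\alpha-1})$. The logarithmic choice $h(x)=C\sqrt{\log(2+x)}$ gives \[ T_h(A)=O_C\left(\frac{\sqrt{\log(2+A)}}A\right). \]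
   Context: A positive weighted point measure is a measure $M=\sum_{x\in X}w_x\delta_x$ on $\mathbb R$ with $X=\operatorname{supp}M$ locally finite and $w_x>0$. Random measures are random elements of the space of such measures with its vague Borel sigma-algebra. $\theta_tM(B)=M(B+t)$; $M$ is stationary if $\theta_tM$ has the law of $M$ for every $t\in\mathbb R$; the intensity is $K=\mathbb E M((0,1])$. $N_M(x)=M((0,x])$ for $x\ge0$ and $N_M(x)=-M((x,0])$ for $x<0$. Under the hypotheses, almost surely \[ F_M(s)=\lim_{A\to\infty}\int_{[-A,A]}\frac{dM(x)}{s-x} \] exists for every $s\notin\operatorname{supp}M$, and a deterministic $s$ is almost surely not in the support. The centered truncation is \[ F^{\mathrm{sym}}_{M,A}(s)=\int_{[s-A,s+A]}\frac{dM(x)}{s-x}. \] $\mathrm{Cauchy}(0,1)$ has density $[\pi(1+x^2)]^{-1}$. $d_{\mathrm{BL}}$ is the supremum of the difference of integrals over real test functions on $\mathbb R$ bounded in absolute value by one and with Lipschitz constant at most one. *)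

(* Defs.v *)
From HB Require Import structures.
From mathcomp Require Import all_boot all_order all_algebra.
From mathcomp Require Import all_classical all_reals all_analysis.
From mathcomp Require Import measurable_realfun.

Set Implicit Arguments.
Unset Strict Implicit.
Unset Printing Implicit Defensive.

Import Order.TTheory GRing.Theory Num.Theory.
Import numFieldNormedType.Exports.

Local Open Scope classical_set_scope.
Local Open Scope ring_scope.

Section weighted_point_measures.
Context {R : realType}.
Implicit Type mu : {measure set R -> \bar R}.

(* the topological support *)
Definition supp mu : set R :=
  [set x | forall U : set R, open U -> U x -> (0 < mu U)%E].

Definition weighted_point_measure mu : Prop :=
  exists w : R -> R,
    [/\ forall a b, finite_set (supp mu `&` `[a, b]),
        forall x, supp mu x -> 0 < w x
      & forall B, measurable B ->
          mu B = (\esum_(x in supp mu `&` B) (w x)%:E)%E].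

(* shift mu t B = mu (B + t) *)
Definition shift mu (t : R) : set R -> \bar R :=
  pushforward mu (fun x : R => x - t).

Section shift_measure.
Variables (mu : {measure set R -> \bar R}) (t : R).

Let measurable_subr : measurable_fun [set: R] (fun x : R => x - t).
Proof. exact: (@measurable_funB _ _ R _ id (cst t)). Qed.

Let shift0 : shift mu t set0 = 0%E.
Proof. by rewrite /shift /pushforward preimage_set0 measure0. Qed.

Let shift_ge0 A : (0 <= shift mu t A)%E.
Proof. exact: measure_ge0. Qed.

Let shift_sigma_additive : semi_sigma_additive (shift mu t).
Proof. have mf := measurable_subr; exact: measure_semi_sigma_additive. Qed.

HB.instance Definition _ := isMeasure.Build _ _ _ (shift mu t)
  shift0 shift_ge0 shift_sigma_additive.
End shift_measure.

Lemma supp_shift mu t x : supp (shift mu t) x <-> supp mu (x + t).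
Proof.
have opre (a : R) (U : set R) : open U -> open ((fun y : R => y + a) @^-1` U).
  move=> oU; apply: open_comp => // y _.
  by apply: cvgD; [exact: cvg_id|exact: cvg_cst].
split=> /= [sx U oU Ux|sx U oU Ux].
- have := sx _ (opre t _ oU) Ux; rewrite /shift /pushforward.
  by congr (0 < mu _)%E; apply/seteqP; split => y /=; rewrite subrK.
- by apply: sx; [exact: opre|rewrite /= addrK].
Qed.

Lemma weighted_point_measure_shift mu t :
  weighted_point_measure mu -> weighted_point_measure (shift mu t).
Proof.
move=> [w [fin pos muE]]; exists (fun x => w (x + t)); split.
- move=> a b.
  have -> : supp (shift mu t) `&` `[a, b] =
      (fun y => y - t) @` (supp mu `&` `[a + t, b + t]).
    apply/seteqP; split=> [x [/supp_shift sx /=]|_ [y [sy /=] + <-]].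
      rewrite in_itv/= => xab; exists (x + t); last by rewrite addrK.
      by split => //=; rewrite in_itv/= !lerD2r.
    rewrite in_itv/= => yab; split; first by apply/supp_shift; rewrite subrK.
    by rewrite /= in_itv/= lerBrDr lerBlDr.
  exact/finite_image/fin.
- by move=> x /supp_shift; exact: pos.
- move=> B mB; rewrite -[LHS]/(mu ((fun x => x - t) @^-1` B)) muE; last first.
    rewrite -[X in measurable X]setTI.
    by apply: (@measurable_funB _ _ R _ id (cst t)).
  rewrite (@reindex_esum _ _ _ (supp (shift mu t) `&` B) _ (fun x => x + t))//.
  + split.
    * by move=> x [/supp_shift sx Bx]; split => //=; rewrite addrK.
    * by move=> x y _ _ /addIr.
    * move=> y [sy By]; exists (y - t); last by rewrite subrK.
      by split => //; apply/supp_shift; rewrite subrK.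
Qed.

Lemma weighted_point_measure_mzero : weighted_point_measure (@mzero _ R R).
Proof.
have s0 : supp (@mzero _ R R) = set0.
  by apply/seteqP; split => // x /(_ setT openT I); rewrite /mzero ltxx.
exists (cst 1); rewrite s0; split => // [a b|B mB]; first by rewrite set0I.
by rewrite set0I esum_set0.
Qed.

End weighted_point_measures.

Record wpm (R : realType) := WPM {
  wpm_measure :> {measure set R -> \bar R};
  wpmP : weighted_point_measure wpm_measure }.

HB.instance Definition _ (R : realType) := gen_eqMixin (wpm R).
HB.instance Definition _ (R : realType) := gen_choiceMixin (wpm R).
HB.instance Definition _ (R : realType) :=
  isPointed.Build (wpm R) (WPM weighted_point_measure_mzero).

Definition wpm_shift {R : realType} (t : R) (mu : wpm R) : wpm R :=
  WPM (weighted_point_measure_shift t (wpmP mu)).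

Section vague_topology.
Variable R : realType.

Definition cc_fun : Type :=
  {f : R -> R | continuous f /\ compact (closure [set x | f x != 0])}.

Definition cc_integral (mu : wpm R) : {ptws cc_fun -> R} :=
  fun f => \int[mu]_x (sval f x).

(* the coarsest topology making mu |-> \int f dmu continuous for all f in C_c *)
Definition vague := initial_topology cc_integral.

Definition vague_borel := g_sigma_algebraType (@open vague).

End vague_topology.

Section random_measures.
Local Open Scope ereal_scope.
Context d (T : measurableType d) (R : realType) (P : probability T R).
Variable M : {RV P >-> vague_borel R}.

Definition stationary : Prop :=
  forall (t : R) (B : set (vague_borel R)), measurable B ->
    pushforward P (wpm_shift t \o M : T -> vague_borel R) B =
    distribution P M B.

Definition intensity : \bar R := \int[P]_w (M w : wpm R) `]0%R, 1%R]%classic.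

End random_measures.

Section functionals.
Context {R : realType}.
Variable mu : {measure set R -> \bar R}.

(* N_mu *)
Definition counting (x : R) : R :=
  if 0 <= x then fine (mu `]0, x]%classic) else - fine (mu `]x, 0]%classic).

(* In F_trunc and F_sym, an atom at x = s contributes 0 since 0^-1 = 0; almost
   surely there is none. *)
Definition F_trunc (A s : R) : R := \int[mu]_(x in `[- A, A]) (s - x)^-1.

(* the symmetric (principal value) limit; a junk value when it does not exist *)
Definition F_pv (s : R) : R := lim (F_trunc A s @[A --> +oo]).

Definition F_sym (A s : R) : R := \int[mu]_(x in `[s - A, s + A]) (s - x)^-1.

End functionals.

Section envelopes.
Local Open Scope ereal_scope.
Context d (T : measurableType d) (R : realType) (P : probability T R).
Variables (M : {RV P >-> vague_borel R}) (K : R).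

Definition discrepancy (x : R) : \bar R :=
  'E_P[fun w => `|counting (M w : wpm R) x - K * x|%R].

Definition envelope (h : R -> R) : Prop :=
  [/\ measurable_fun (`[1%R, +oo[ : set R) h,
      forall r : R, (1 <= r)%R -> (0 <= h r)%R,
      forall x : R, (1 <= `|x|)%R -> discrepancy x <= (h `|x|%R)%:E
    & \int[lebesgue_measure]_(r in `[1%R, +oo[) (h r / r ^+ 2)%:E < +oo].

End envelopes.

(* h is extended-real valued so that it applies both to a finite envelope and to
   the expectation r |-> E|N_M(r) - K r| *)
Definition tail_bound {R : realType} (h : R -> \bar R) (A : R) : \bar R :=
  (2%:E * h A * (A^-1)%:E +
   2%:E * \int[lebesgue_measure]_(x in `[A, +oo[) (h x * (x ^- 2)%:E))%E.

Section bounded_lipschitz.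
Context {R : realType}.

Definition BL1 : set (R -> R) :=
  [set f | (forall x, `|f x| <= 1) /\ (forall x y, `|f x - f y| <= `|x - y|)].

Definition dBL (mu nu : probability R R) : \bar R :=
  ereal_sup [set `|\int[mu]_x f x - \int[nu]_x f x|%:E | f in BL1].

End bounded_lipschitz.

Section cauchy.
Context {R : realType}.
Notation leb := lebesgue_measure.

Definition cauchy_pdf (x : R) : R := (pi * (1 + x ^+ 2))^-1.

Lemma cauchy_pdfE x : cauchy_pdf x = pi^-1 * (oneDsqr x)^-1.
Proof. by rewrite /cauchy_pdf invfM. Qed.

Lemma cauchy_pdf_ge0 x : 0 <= cauchy_pdf x.
Proof.
by rewrite invr_ge0 mulr_ge0 ?pi_ge0// addr_ge0 ?sqr_ge0.
Qed.

Lemma continuous_cauchy_pdf : continuous cauchy_pdf.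
Proof.
have -> : cauchy_pdf = (fun x => pi^-1 * (oneDsqr x)^-1).
  by apply/funext => x; rewrite cauchy_pdfE.
by move=> x; apply: cvgM; [exact: cvg_cst|exact: continuous_oneDsqrV].
Qed.

Definition cauchy_prob (V : set R) : \bar R :=
  (\int[leb]_(x in V) (cauchy_pdf x)%:E)%E.

Let mpdf (D : set R) : measurable_fun D (EFin \o cauchy_pdf).
Proof.
apply: measurable_funTS; apply/measurable_EFinP.
by apply: continuous_measurable_fun; exact: continuous_cauchy_pdf.
Qed.

Let cauchy0 : cauchy_prob set0 = 0%E.
Proof. exact: integral_set0. Qed.

Let cauchy_ge0 A : (0 <= cauchy_prob A)%E.
Proof. by apply: integral_ge0 => x _; rewrite lee_fin cauchy_pdf_ge0. Qed.

Let cauchy_sigma_additive : semi_sigma_additive cauchy_prob.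
Proof.
move=> /= G mG tG mUG; rewrite /cauchy_prob; apply: cvg_toP.
  apply: ereal_nondecreasing_is_cvgn => m n mn.
  apply: lee_sum_nneg_natr => // k _ _; apply: integral_ge0 => /= x _.
  by rewrite lee_fin cauchy_pdf_ge0.
rewrite ge0_integral_bigcup//=.
- exact: mpdf.
- by move=> x _; rewrite lee_fin cauchy_pdf_ge0.
Qed.

HB.instance Definition _ := isMeasure.Build _ _ _
  cauchy_prob cauchy0 cauchy_ge0 cauchy_sigma_additive.

Let cauchy_setT : cauchy_prob [set: R] = 1%E.
Proof.
rewrite /cauchy_prob ge0_symfun_integralT//=.
- rewrite (_ : [set x | _] = `[0, +oo[%classic); last first.
    by apply/seteqP; split => x/=; rewrite in_itv/= andbT.
  under eq_integral do rewrite cauchy_pdfE EFinM.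
  have mo : measurable_fun [set: R] (EFin \o (fun x => (oneDsqr x)^-1)).
    by apply/measurable_EFinP; apply: continuous_measurable_fun; exact: continuous_oneDsqrV.
  rewrite ge0_integralZl//=.
  + rewrite integral0y_oneDsqr -!EFinM; congr EFin.
    by rewrite (mulrA pi^-1) mulVf ?mul1r ?mulfV// gt_eqF// pi_gt0.
  + exact: measurable_funTS.
  + by rewrite lee_fin invr_ge0 pi_ge0.
- exact: cauchy_pdf_ge0.
- exact: continuous_cauchy_pdf.
- by move=> x /=; rewrite /cauchy_pdf sqrrN.
Qed.

HB.instance Definition _ := Measure_isProbability.Build _ _ _
  cauchy_prob cauchy_setT.

End cauchy.

(* Main.v *)
Require Import Defs.
From HB Require Import structures.
From mathcomp Require Import all_boot all_order all_algebra.
From mathcomp Require Import all_classical all_reals all_analysis.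
From mathcomp Require Import measurable_realfun.
From mathcomp Require Import ring lra.
From mathcomp.real_closed Require complex.

Set Implicit Arguments.
Unset Strict Implicit.
Unset Printing Implicit Defensive.

Import Order.TTheory GRing.Theory Num.Theory.
Import numFieldNormedType.Exports.

Local Open Scope classical_set_scope.
Local Open Scope ring_scope.

(** Let N be the counting function of M and let g(x) be the mean of
|N(x) - K x|.

The error bound is an integration by parts. On each half-line, the integral
of 1/x over the atoms in ]A, B], minus K times the Lebesgue integral of 1/x,
equals boundary terms D(B)/B and - D(A)/A plus the integral of D(y)/y^2, where
D(y) is the number of atoms up to y, counted with weights, minus K y
([integral_by_parts]). The kernel being odd, the two Lebesgue terms cancel, so
the mean of |F_B(0) - F_A(0)| is at most 2 g(B)/B + T_g(A)
([mean_F_truncB]). Stationarity bounds the mean mass of an interval, so g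
cannot drop quickly, and then the convergence of the integral of g(y)/y^2
forces g(x)/x to tend to 0 ([quasi_sublinear]). The windows [-n, n] and
[s - n, s + n] differ by two intervals of bounded length on which the kernel is
O(1/n) ([mean_window]), so stationarity moves the estimate from 0 to s, and
Fatou's lemma lets n tend to infinity ([mean_F_pv_F_sym]). The same integration
by parts, done for almost every realization, shows that the principal value
exists.

For the law, move the point to complex height: W(p - i eta) is the sum of
w_x / (p - i eta - x) over the atoms of a large window. Its imaginary part is
positive, so for b > 0 the function 1/(W - a + i b) is holomorphic and bounded
on the lower half-plane. Minus its imaginary part is the Poisson kernel of the
point (a, b) evaluated at W, and its real part is the conjugate kernel. By the
Cauchy-Riemann equations the derivative in eta of the mean of the former is, up
to sign, the derivative in p of the mean of the latter, which is 0 by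
stationarity. Hence the mean of the Poisson kernel does not depend on eta
([mean_poisson_asymptotically_constant]). As eta tends to 0, W tends to F_M(0);
as eta tends to infinity, integration by parts shows that W tends to i pi K.
So the mean of the Poisson kernel at F_M(0) is its value at i pi K
([poisson_law]), and letting b tend to 0, where the Poisson kernel is an
approximate identity, identifies F_M(0)/(pi K) as a Cauchy variable
([pv_law]). The bounded Lipschitz distance is then at most the mean of
|F_M - F_sym|, divided by pi K. *)

(** * Atoms of a point measure in a bounded interval *)

Section integrable_EFin.
Context d (T : measurableType d) (R : realType) (m : {measure set T -> \bar R}).
Implicit Types (D : set T) (f g : T -> R).

Lemma integrableZ_EFin D f k : measurable D -> m.-integrable D (EFin \o f) ->
  m.-integrable D (EFin \o (fun x => k * f x)).
Proof. by move=> mD /(integrableZl mD k); apply: eq_integrable. Qed.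

Lemma integrableD_EFin D f g : measurable D -> m.-integrable D (EFin \o f) ->
  m.-integrable D (EFin \o g) -> m.-integrable D (EFin \o (fun x => f x + g x)).
Proof. by move=> mD h1 /(integrableD mD h1); apply: eq_integrable. Qed.

Lemma integrableB_EFin D f g : measurable D -> m.-integrable D (EFin \o f) ->
  m.-integrable D (EFin \o g) -> m.-integrable D (EFin \o (fun x => f x - g x)).
Proof. by move=> mD h1 /(integrableB mD h1); apply: eq_integrable. Qed.

End integrable_EFin.

Section atoms.
Context {R : realType}.
Implicit Types (mu : wpm R) (s : seq R) (w f : R -> R) (D : set R).

(** The weights enter through their absolute values so that the atoms form a nonnegative
combination of Dirac masses for an arbitrary weight function. *)
Lemma ge0_integral_atoms (mu : {measure set R -> \bar R}) s w a b :
  (forall D, measurable D -> D `<=` `[a, b] ->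
     mu D = (\sum_(x <- s | x \in D) `|w x|)%:E) ->
  forall D f, measurable D -> D `<=` `[a, b] -> measurable_fun D f ->
    (forall x, D x -> 0 <= f x) ->
    (\int[mu]_(x in D) (f x)%:E = (\sum_(x <- s | x \in D) `|w x| * f x)%:E)%E.
Proof.
move=> muE D f mD Dab mf f0.
pose m (i : nat) : {measure set R -> \bar R} :=
  mscale (NngNum (normr_ge0 (w (nth 0 s i)))) (@dirac _ R (nth 0 s i) R).
rewrite (eq_measure_integral (msum m (size s))); last first.
  move=> A mA AD; rewrite muE//; last exact: subset_trans Dab.
  transitivity (\sum_(i < size s) m i A)%E; last by [].
  rewrite (big_nth 0) big_mkord -sumEFin big_mkcond/=.
  apply: eq_bigr => i _; rewrite /m /= /mscale/= diracE.
  by case: ifPn => _; rewrite ?mule1 ?mule0.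
rewrite ge0_integral_measure_sum//; last exact/measurable_EFinP.
rewrite (big_nth 0) big_mkord -sumEFin [RHS]big_mkcond/=.
apply: eq_bigr => i _; rewrite /m ge0_integral_mscale//; last exact/measurable_EFinP.
rewrite integral_dirac//; last exact/measurable_EFinP.
rewrite diracE; case: ifPn => _; rewrite ?mul1e ?mul0e ?mule0// EFinM.
Qed.

Lemma integral_atoms (mu : {measure set R -> \bar R}) s w a b :
  (forall D, measurable D -> D `<=` `[a, b] ->
     mu D = (\sum_(x <- s | x \in D) `|w x|)%:E) ->
  forall D f, measurable D -> D `<=` `[a, b] -> measurable_fun D f ->
    mu.-integrable D (EFin \o f) /\
    \int[mu]_(x in D) f x = \sum_(x <- s | x \in D) `|w x| * f x.
Proof.
move=> muE D f mD Dab mf.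
have mp : measurable_fun D (fun x => Num.max (f x) 0).
  by apply: measurable_maxr => //; exact: measurable_cst.
have mn : measurable_fun D (fun x => Num.max (- f x) 0).
  apply: measurable_maxr; last exact: measurable_cst.
  exact: measurableT_comp.
have int_f : mu.-integrable D (EFin \o f).
  apply/integrableP; split; first exact/measurable_EFinP.
  under eq_integral do rewrite /= .
  rewrite (ge0_integral_atoms muE) ?ltry//.
  exact: measurableT_comp.
split => //; rewrite /Rintegral integralE.
under eq_integral do rewrite funeposE /= -EFin_max.
rewrite [X in (_ - X)%E](_ : _ = \int[mu]_(x in D) (Num.max (- f x) 0)%:E)%E; last first.
  by apply: eq_integral => x _; rewrite funenegE /= -EFin_max.
rewrite (ge0_integral_atoms muE)//; last by move=> x _; rewrite le_max lexx orbT.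
rewrite (ge0_integral_atoms muE)//; last by move=> x _; rewrite le_max lexx orbT.
rewrite -EFinB/= -sumrB; apply: eq_bigr => x _; rewrite -mulrBr; congr (_ * _).
by case: (leP (f x) 0) => h; case: (leP (- f x) 0) => h'; lra.
Qed.

(** Local finiteness of the support reduces every statement about a bounded interval to
a finite sum. *)
Lemma finite_atoms mu a b : exists (s : seq R) (w : R -> R),
  [/\ uniq s, (forall x, x \in s -> a <= x <= b /\ supp mu x)
   & forall D, measurable D -> D `<=` `[a, b] ->
     mu D = (\sum_(x <- s | x \in D) `|w x|)%:E ].
Proof.
have [w [fin pos muE]] := wpmP mu.
have finS := fin a b.
exists (finmap.enum_fset (fset_set (supp mu `&` `[a, b]))), w; split.
- exact: finmap.fset_uniq.
- by move=> x; rewrite in_fset_set// => /set_mem[sx /=]; rewrite in_itv/=.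
- move=> D mD Dab; rewrite muE//.
  have finD : finite_set (supp mu `&` D).
    by apply: sub_finite_set finS => x [sx Dx]; split => //; exact: Dab.
  rewrite esum_fset//=; last first.
    by move=> x; rewrite inE => -[sx _]; rewrite lee_fin ltW// pos.
  rewrite fsbig_finite//= sumEFin; congr EFin.
  rewrite -[RHS]big_filter; transitivity (\sum_(i <- finmap.enum_fset (fset_set (supp mu `&` D))) `|w i|).
    rewrite big_seq [RHS]big_seq; apply: eq_bigr => x; rewrite in_fset_set// => /set_mem[sx _].
    by rewrite gtr0_norm// pos.
  apply: perm_big; apply: uniq_perm; rewrite ?filter_uniq ?finmap.fset_uniq// => x.
  rewrite mem_filter !in_fset_set//; apply/idP/idP.
    move=> /set_mem[sx Dx]; rewrite mem_set//=; apply/mem_set; split => //; exact: Dab.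
  by move=> /andP[/set_mem Dx /set_mem[sx _]]; apply/mem_set.
Qed.

Lemma wpm_integrable mu a b D f : measurable D -> D `<=` `[a, b] ->
  measurable_fun D f -> mu.-integrable D (EFin \o f).
Proof.
move=> mD Dab mf; have [s [w [_ _ muE]]] := finite_atoms mu a b.
by have [] := integral_atoms muE mD Dab mf.
Qed.

Lemma wpm_fin mu a b D : measurable D -> D `<=` `[a, b] -> mu D \is a fin_num.
Proof.
move=> mD Dab; have [s [w [_ _ muE]]] := finite_atoms mu a b.
by rewrite muE.
Qed.

End atoms.

(** * Integration by parts against a point measure *)

Section by_parts.
Context {R : realType}.
Notation leb := (@lebesgue_measure R).

(** The two half-lines are treated together: [b = true] is the positive one. *)
Definition flip (b : bool) (x : R) : R := if b then x else - x.
Definition ray (b : bool) (a y : R) : set R := [set x | a < flip b x <= y].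
Definition mass (mu : wpm R) b y : R := fine (mu (ray b 0 y)).

Definition disc (mu : wpm R) b (K y : R) : R := mass mu b y - K * y.

(** What integration by parts leaves of the Lebesgue integral of f over [a, B], written
without integrating f itself. *)
Definition parts_cst (f f' : R -> R) (a B : R) : R :=
  B * f B - a * f a - \int[leb]_(y in `[a, B]) (y * f' y).

Lemma flipK b : involutive (flip b).
Proof. by case: b => x //=; rewrite opprK. Qed.

Lemma measurable_flip b : measurable_fun [set: R] (flip b).
Proof. by case: b; [exact: measurable_id|exact: oppr_measurable]. Qed.

Lemma mem_ray b a y x : (x \in ray b a y) = (a < flip b x <= y).
Proof. by apply/idP/idP => [/set_mem|h]; [|apply/mem_set]. Qed.

Lemma measurable_ray b a y : measurable (ray b a y).
Proof.
have -> : ray b a y = flip b @^-1` `]a, y].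
  by apply/seteqP; split => x /=; rewrite in_itv/=.
rewrite -[X in measurable X]setTI; apply: measurable_flip => //; exact: measurable_itv.
Qed.

Lemma ray_sub b a y : 0 <= a -> ray b a y `<=` `[- y, y].
Proof.
move=> a0 x; rewrite /ray /= in_itv/=; case: b => /= /andP[h1 h2]; apply/andP; split; lra.
Qed.

(** The case of one atom at x in the integration by parts. *)
Lemma FTC_atom (f f' : R -> R) (a B x : R) :
  (forall y, a <= y <= B -> is_derive y 1 f (f' y)) ->
  {within `[a, B], continuous f'} -> a <= x <= B ->
  leb.-integrable `[a, B] (EFin \o (fun y => (x <= y)%R%:R * f' y)) /\
  \int[leb]_(y in `[a, B]) ((x <= y)%R%:R * f' y) = f B - f x.
Proof.
move=> df cf /andP[ax xB].
have intf : leb.-integrable `[a, B] (EFin \o f').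
  by apply: continuous_compact_integrable => //; exact: segment_compact.
have e : (fun y => (x <= y)%R%:R * f' y) = f' \_ `[x, +oo[.
  apply/funext => y; rewrite patchE; case: ifPn => [/set_mem/=|/negP h].
    by rewrite in_itv/= andbT => ->; rewrite mul1r.
  have -> : (x <= y) = false by apply/negbTE/negP => xy; apply: h; apply/mem_set; rewrite /= in_itv/= xy.
  by rewrite mul0r.
have e2 : `[a, B] `&` `[x, +oo[ = `[x, B]%classic.
  by apply/seteqP; split=> y; rewrite /= !in_itv/= ?andbT => h; lra.
rewrite e; split.
  rewrite -restrict_EFin; apply/integrable_restrict => //; rewrite e2.
  by apply: integrableS intf => //; apply: subset_itvr; rewrite bnd_simp.
rewrite -Rintegral_mkcondr e2.
have [xB'|Bx] := ltP x B; last first.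
  have -> : x = B by lra.
  by rewrite set_itv1 Rintegral_set1 subrr.
rewrite /Rintegral (@continuous_FTC2 _ f' f)//.
- apply: continuous_subspaceW cf; apply: subset_itvr; rewrite bnd_simp//.
- split.
  + move=> y; rewrite in_itv/= => /andP[h1 h2]; apply: ex_derive; apply: df; lra.
  + have dx : derivable f x 1 by apply: (@ex_derive _ _ _ _ _ _ _ (df x _)); lra.
    apply: cvg_at_right_filter; apply: differentiable_continuous; exact/derivable1_diffP.
  + have dx : derivable f B 1 by apply: (@ex_derive _ _ _ _ _ _ _ (df B _)); lra.
    apply: cvg_at_left_filter; apply: differentiable_continuous; exact/derivable1_diffP.
- move=> y; rewrite in_itv/= => /andP[h1 h2]; rewrite derive1E; apply: derive_val; apply: df; lra.
Qed.

Lemma sum_by_parts (s : seq R) (w f f' : R -> R) (a B : R) :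
  (forall y, a <= y <= B -> is_derive y 1 f (f' y)) ->
  {within `[a, B], continuous f'} -> (forall x, x \in s -> a <= x <= B) ->
  leb.-integrable `[a, B] (EFin \o (fun y => (\sum_(x <- s) w x * (x <= y)%R%:R) * f' y)) /\
  \sum_(x <- s) w x * f x = (\sum_(x <- s) w x) * f B -
    \int[leb]_(y in `[a, B]) ((\sum_(x <- s) w x * (x <= y)%R%:R) * f' y).
Proof.
move=> df cf; elim: s => [_|x s IH xs].
  split.
    under [X in integrable _ _ X]eq_fun do rewrite /= big_nil mul0r.
    exact: integrable0.
  by under eq_Rintegral do rewrite big_nil mul0r; rewrite !big_nil mul0r Rintegral_cst//= mul0r subr0.
have [i1 e1] := IH (fun y ys => xs y (@mem_behead _ (x :: s) y ys)).
have [i2 e2] := FTC_atom df cf (xs x (mem_head _ _)).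
have i2' : leb.-integrable `[a, B] (EFin \o (fun y => w x * ((x <= y)%R%:R * f' y))).
  exact: integrableZ_EFin.
have E : (fun y => (\sum_(x <- x :: s) w x * (x <= y)%R%:R) * f' y) =
   (fun y => w x * ((x <= y)%R%:R * f' y) + (\sum_(x <- s) w x * (x <= y)%R%:R) * f' y).
  by apply/funext => y; rewrite big_cons mulrDl mulrA.
rewrite E; split.
  exact: integrableD_EFin.
rewrite RintegralD// RintegralZl// e2 !big_cons e1; ring.
Qed.

Lemma ray_atoms (mu : wpm R) b (a B : R) : 0 <= a <= B ->
  exists (t : seq R) (w : R -> R),
  [/\ forall x, x \in t -> a <= x <= B,
      forall y, a <= y <= B ->
        mass mu b y = mass mu b a + \sum_(x <- t) `|w x| * (x <= y)%R%:R
    & forall f, measurable_fun [set: R] f ->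
        \int[mu]_(x in ray b a B) f (flip b x) = \sum_(x <- t) `|w x| * f x].
Proof.
move=> /andP[a0 aB].
have [s [w [us ss muE]]] := finite_atoms mu (- B) B.
have sub (y c : R) : 0 <= c -> y <= B -> ray b c y `<=` `[- B, B].
  move=> c0 yB; apply: (@subset_trans _ `[- y, y]); first exact: ray_sub.
  by move=> x; rewrite /= !in_itv/= => /andP[h1 h2]; lra.
exists [seq flip b x | x <- s & x \in ray b a B], (w \o flip b); split.
- move=> _ /mapP[x + ->]; rewrite mem_filter => /andP[/set_mem/andP[h1 h2] _]; lra.
- move=> y /andP[ay yB].
  rewrite /mass !muE//; try exact: measurable_ray; try exact: sub.
  rewrite /= big_map big_filter [LHS]big_mkcond [X in _ = X + _]big_mkcond [X in _ = _ + X]big_mkcond -big_split/=; apply: eq_bigr => x _.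
  rewrite flipK !mem_ray.
  (* the indicators agree atom by atom *)
  case: (ltP 0 (flip b x)) => h0; case: (ltP a (flip b x)) => h1;
  case: (leP (flip b x) y) => h2; case: (leP (flip b x) a) => h3;
  case: (leP (flip b x) B) => h4; rewrite /= ?mulr1 ?mulr0 ?addr0 ?add0r//; lra.
- move=> f mf.
  have [_ ->] := integral_atoms muE (measurable_ray b a B) (sub B a a0 (lexx B))
     (measurable_funTS (measurableT_comp mf (measurable_flip b))).
  by rewrite big_map big_filter; apply: eq_bigr => x _; rewrite /= flipK.
Qed.

(** The sum over the atoms is summed by parts; subtracting K times the same identity for
Lebesgue measure replaces the mass by the discrepancy everywhere. *)
Lemma integral_by_parts (mu : wpm R) b (a B K : R) (f f' : R -> R) :
  0 <= a < B -> measurable_fun [set: R] f ->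
  (forall y, a <= y <= B -> is_derive y 1 f (f' y)) ->
  {within `[a, B], continuous f'} ->
  (`|\int[mu]_(x in ray b a B) f (flip b x) - K * parts_cst f f' a B|%:E <=
    (`|disc mu b K B| * `|f B|)%:E + (`|disc mu b K a| * `|f a|)%:E +
    \int[leb]_(y in `[a, B]) (`|disc mu b K y| * `|f' y|)%:E)%E.
Proof.
move=> /andP[a0 aB] mf df cf.
set D := disc mu b K; set c := K * _.
have a0B : 0 <= a <= B by rewrite a0 ltW.
have [t [w [tB massE intE]]] := ray_atoms mu b a0B.
rewrite intE//.
have [i1 ->] := sum_by_parts (fun x => `|w x|) df cf tB.
have i2 : leb.-integrable `[a, B] (EFin \o f').
  by apply: continuous_compact_integrable => //; exact: segment_compact.
have i3 : leb.-integrable `[a, B] (EFin \o (fun y => y * f' y)).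
  apply: continuous_compact_integrable => //; first exact: segment_compact.
  have cid : {within `[a, B], continuous (@id R)}.
    by apply: continuous_subspaceT => x; exact: cvg_id.
  by move=> x; apply: continuousM; [exact: cid|exact: cf].
have f'E : \int[leb]_(y in `[a, B]) f' y = f B - f a.
  have aaB : a <= a <= B by rewrite lexx ltW.
  have [_ <-] := FTC_atom df cf aaB; apply: eq_Rintegral => y; rewrite inE/= in_itv/=.
  by move=> /andP[-> _]; rewrite mul1r.
pose Vs y := \sum_(x <- t) `|w x| * (x <= y)%R%:R.
have DE y : a <= y <= B -> D y * f' y = Vs y * f' y + mass mu b a * f' y - K * (y * f' y).
  by move=> yab; rewrite /D /disc massE// /Vs; ring.
have i12 : leb.-integrable `[a, B] (EFin \o (fun y => Vs y * f' y + mass mu b a * f' y)).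
  by apply: integrableD_EFin => //; exact: integrableZ_EFin.
have i3' : leb.-integrable `[a, B] (EFin \o (fun y => K * (y * f' y))).
  exact: integrableZ_EFin.
have iD : leb.-integrable `[a, B] (EFin \o (fun y => D y * f' y)).
  have : leb.-integrable `[a, B] (EFin \o (fun y => Vs y * f' y + mass mu b a * f' y - K * (y * f' y))).
    exact: integrableB_EFin.
  by apply: eq_integrable => // y; rewrite inE/= in_itv/= => yab; rewrite DE.
have IDE : \int[leb]_(y in `[a, B]) (D y * f' y) =
   \int[leb]_(y in `[a, B]) (Vs y * f' y) + mass mu b a * (f B - f a) - K * \int[leb]_(y in `[a, B]) (y * f' y).
  have -> : \int[leb]_(y in `[a, B]) (D y * f' y) =
      \int[leb]_(y in `[a, B]) (Vs y * f' y + mass mu b a * f' y - K * (y * f' y)).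
    by apply: eq_Rintegral => y; rewrite inE/= in_itv/= => yab; rewrite DE.
  by rewrite RintegralB// RintegralD// ?RintegralZl// ?f'E//; exact: integrableZ_EFin.
have VB : \sum_(x <- t) `|w x| = mass mu b B - mass mu b a.
  rewrite [mass mu b B]massE ?lexx ?ltW// addrAC subrr add0r; apply: eq_big_seq => x /tB/andP[_ ->].
  by rewrite mulr1.
have -> : (\sum_(x <- t) `|w x|) * f B - \int[leb]_(y in `[a, B]) (Vs y * f' y) - c =
    D B * f B - D a * f a - \int[leb]_(y in `[a, B]) (D y * f' y).
  by rewrite IDE VB /c /D /disc /parts_cst; ring.
have h : (`|\int[leb]_(y in `[a, B]) (D y * f' y)|%:E <= \int[leb]_(y in `[a, B]) (`|D y| * `|f' y|)%:E)%E.
  rewrite EFin_normr_Rintegral//; apply: le_trans (le_abse_integral _ _ _) _ => //.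
    by case/integrableP: iD.
  by rewrite le_eqVlt; apply/orP; left; apply/eqP; apply: eq_integral => y _; rewrite /= normrM.
apply: le_trans (leeD (lexx _) h); rewrite -!EFinD lee_fin.
rewrite -!normrM; apply: le_trans (ler_normB _ _) _; rewrite lerD2r; exact: ler_normB.
Qed.
End by_parts.

(** * Comparing integrals over windows *)

Section windows.
Context {R : realType}.
Implicit Types (mu : wpm R) (f : R -> R) (A B : R).

Lemma mem_cc (a b x : R) : (x \in `[a, b]%classic) = (a <= x <= b).
Proof. by rewrite mem_setE in_itv. Qed.

Lemma sub_itvNN A B : A <= B -> `[- A, A]%classic `<=` `[- B, B].
Proof. by move=> AB x; rewrite /= !in_itv/= => /andP[h1 h2]; lra. Qed.

Lemma ray_subW b (a y B : R) : 0 <= a -> y <= B -> ray b a y `<=` `[- B, B].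
Proof. by move=> a0 yB; apply: (subset_trans (ray_sub a0)); exact: sub_itvNN. Qed.

Lemma window_sub mu f A B : measurable_fun [set: R] f -> 0 <= A <= B ->
  \int[mu]_(x in `[- B, B]) f x - \int[mu]_(x in `[- A, A]) f x =
  \int[mu]_(x in ray true A B) f x + \int[mu]_(x in ray false A B) f x.
Proof.
move=> mf /andP[A0 AB].
have [s [w [_ _ muE]]] := finite_atoms mu (- B) B.
have int D : measurable D -> D `<=` `[- B, B] -> \int[mu]_(x in D) f x = \sum_(x <- s | x \in D) `|w x| * f x.
  by move=> mD DB; have [] := integral_atoms muE mD DB (measurable_funTS mf).
rewrite !int//; try exact: measurable_ray; try exact: ray_subW; try exact: sub_itvNN.
rewrite [X in X - _ = _]big_mkcond [X in _ - X = _]big_mkcond [X in _ = X + _]big_mkcond [X in _ = _ + X]big_mkcond.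
rewrite -sumrB -big_split/=; apply: eq_bigr => x _.
rewrite !mem_ray/= !mem_cc.
by case: (leP (- B) x) => h1; case: (leP x B) => h2; case: (leP (- A) x) => h3; case: (leP x A) => h4;
   case: (ltP A (- x)) => h5; case: (leP (- x) B) => h6; rewrite /= ?subr0 ?subrr ?addr0 ?add0r//; lra.
Qed.

Lemma window_split mu f A : measurable_fun [set: R] f -> 0 <= A ->
  \int[mu]_(x in `[- A, A]) f x =
  \int[mu]_(x in ray true 0 A) f x + \int[mu]_(x in ray false 0 A) f x + fine (mu [set 0]) * f 0.
Proof.
move=> mf A0.
have := @window_sub mu f 0 A mf; rewrite lexx A0 => /(_ isT) <-.
have -> : `[- 0, 0]%classic = [set 0 : R] by rewrite oppr0 set_itv1.
have [s [w [_ _ muE]]] := finite_atoms mu 0 0.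
have s0 : [set (0:R)] `<=` `[0, 0] by rewrite set_itv1.
have [_ ->] := integral_atoms muE (measurable_set1 0) s0 (measurable_funTS mf).
rewrite muE//= mulr_suml.
rewrite (eq_bigr (fun x => `|w x| * f 0)); last by move=> x /set_mem ->.
by rewrite subrK.
Qed.

(** Only the atoms of E, which contains the symmetric difference of the two windows, can
contribute. *)
Lemma window_diff mu f (a b c : R) (I1 I2 E : set R) : measurable_fun [set: R] f ->
  measurable I1 -> measurable I2 -> measurable E ->
  I1 `<=` `[a, b] -> I2 `<=` `[a, b] -> E `<=` `[a, b] ->
  (I1 `\` I2) `<=` E -> (I2 `\` I1) `<=` E -> (forall x, E x -> `|f x| <= c) ->
  `|\int[mu]_(x in I1) f x - \int[mu]_(x in I2) f x| <= c * fine (mu E).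
Proof.
move=> mf m1 m2 mE s1 s2 sE d1 d2 fc.
have [s [w [_ _ muE]]] := finite_atoms mu a b.
have [_ ->] := integral_atoms muE m1 s1 (measurable_funTS mf).
have [_ ->] := integral_atoms muE m2 s2 (measurable_funTS mf).
rewrite muE//= [X in X - _]big_mkcond [X in _ - X]big_mkcond [X in _ * X]big_mkcond -sumrB mulr_sumr/=.
apply: le_trans (ler_norm_sum _ _ _) _; apply: ler_sum => x _.
have H : x \in E -> `|w x| * `|f x| <= c * `|w x|.
  by move=> /set_mem /fc h; rewrite mulrC ler_wpM2r.
have [x1|x1] := boolP (x \in I1); have [x2|x2] := boolP (x \in I2); have [xE|xE] := boolP (x \in E);
  rewrite ?subrr ?subr0 ?sub0r ?normrN ?normr0 ?mulr0 ?normrM ?normr_id//; try exact: H.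
- by rewrite mulr_ge0//; apply: le_trans (fc x (set_mem xE)).
- by exfalso; move/negP: xE; apply; apply/mem_set/d1; split; [exact: set_mem|move=> /mem_set h; rewrite h in x2].
- by exfalso; move/negP: xE; apply; apply/mem_set/d2; split; [exact: set_mem|move=> /mem_set h; rewrite h in x1].
- by rewrite mulr_ge0//; apply: le_trans (fc x (set_mem xE)).
Qed.

Lemma massB mu b a y : 0 <= a <= y -> mass mu b y = mass mu b a + fine (mu (ray b a y)).
Proof.
move=> /andP[a0 ay]; rewrite /mass.
have [s [w [_ _ muE]]] := finite_atoms mu (- y) y.
rewrite !muE//; try exact: measurable_ray; try exact: ray_subW.
rewrite /= [LHS]big_mkcond [X in _ = X + _]big_mkcond [X in _ = _ + X]big_mkcond -big_split/=; apply: eq_bigr => x _.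
rewrite !mem_ray.
by case: (ltP 0 (flip b x)) => h0; case: (ltP a (flip b x)) => h1;
  case: (leP (flip b x) y) => h2; case: (leP (flip b x) a) => h3; rewrite /= ?addr0 ?add0r//; lra.
Qed.

Lemma mass_le mu b a y : 0 <= a <= y -> mass mu b a <= mass mu b y.
Proof. by move=> /massB ->; rewrite lerDl fine_ge0. Qed.

(** The atoms are isolated, so truncations are right-continuous step functions of the
radius; this makes them jointly measurable and reduces limits to rational radii. *)
Lemma right_gap mu A : 0 <= A -> exists2 e, 0 < e &
  forall b y, A <= y < A + e -> mu (ray b A y) = 0%E.
Proof.
move=> A0; have [s [w [_ _ muE]]] := finite_atoms mu (- (A + 1)) (A + 1).
have [e e0 He] : exists2 e, 0 < e & forall x, x \in s -> A < `|x| -> A + e <= `|x|.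
  elim: s {muE} => [|x s [e e0 He]]; first by exists 1.
  have [Ax|xA] := ltP A `|x|; last first.
    by exists e => // y; rewrite inE => /orP[/eqP ->|/He]//; rewrite ltNge xA.
  exists (Num.min e (`|x| - A)); first by rewrite lt_min e0/=; lra.
  move=> y; rewrite inE => /orP[/eqP ->|/He h]; first by move=> _; rewrite -lerBrDl ge_min lexx orbT.
  by move=> /h; apply: le_trans; rewrite lerD2l ge_min lexx.
exists (Num.min e 1); first by rewrite lt_min e0 ltr01.
move=> b y /andP[Ay yA].
have [ye y1] : y < A + e /\ y < A + 1.
  by split; apply: lt_le_trans yA _; rewrite lerD2l ge_min lexx ?orbT.
rewrite muE; [|exact: measurable_ray|by apply: ray_subW => //; exact: ltW].
rewrite big_seq_cond big1// => x /andP[xs]; rewrite mem_ray => /andP[h1 h2]; exfalso.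
have xE : flip b x = `|x| by case: b h1 h2 => /= h1 h2; [rewrite ger0_norm//|rewrite ler0_norm//]; lra.
have := He x xs; rewrite -xE => /(_ h1); lra.
Qed.

Lemma integral_ray0 mu b a y f : measurable_fun [set: R] f ->
  mu (ray b a y) = 0%E -> \int[mu]_(x in ray b a y) f x = 0.
Proof.
move=> mf m0; rewrite /Rintegral null_set_integral//; first exact: measurable_ray.
by apply/measurable_EFinP; exact: measurable_funTS.
Qed.

Lemma integral_shift mu (s a b : R) f : measurable_fun [set: R] f ->
  \int[wpm_shift s mu]_(x in `[a, b]) f x = \int[mu]_(x in `[s + a, s + b]) f (x - s).
Proof.
move=> mf; rewrite /Rintegral; congr fine.
have mg : measurable_fun [set: R] (fun x : R => x - s) by exact: (@measurable_funB _ _ R _ id (cst s)).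
have pre : (fun x : R => x - s) @^-1` `[a, b] = `[s + a, s + b]%classic.
  by apply/seteqP; split => x /=; rewrite !in_itv/= => /andP[h1 h2]; apply/andP; split; lra.
rewrite -pre; transitivity (\int[pushforward mu (fun x : R => (x - s)%R)]_(x in `[a, b]) (f x)%:E)%E.
  by [].
rewrite integral_pushforward//; first exact/measurable_EFinP.
rewrite pre; apply: (@wpm_integrable _ mu (s + a) (s + b)) => //.
by apply: measurable_funTS; exact: measurableT_comp.
Qed.

End windows.

(** * Measurability for the vague topology *)

Section vague_measurability.
Context {R : realType}.
Notation leb := (@lebesgue_measure R).
Notation VB := (vague_borel R).

Lemma continuous_cc_integral (phi : cc_fun R) :
  continuous ((fun mu : vague R => cc_integral mu phi) : vague R -> R).
Proof.
move=> mu; apply: (@continuous_comp _ _ _ (@cc_integral R : vague R -> {ptws cc_fun R -> R}) (fun g => g phi)).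
  exact: initial_continuous.
have /cvg_sup/(_ phi)/cvg_image h : (cc_integral mu : {ptws cc_fun R -> R}) --> cc_integral mu.
  exact: cvg_id.
apply: cvg_trans (h _).
  by move=> Q /= [W nbdW <-]; apply: filterS nbdW; exact: preimage_image.
by rewrite eqEsubset; split => y // _; exists (cst y).
Qed.

Lemma measurable_cc_integral (phi : cc_fun R) :
  measurable_fun [set: VB] (fun mu : VB => \int[(mu : wpm R)]_x (sval phi x)).
Proof.
apply: (measurability _ (@RGenOpens.measurableE R)) => _ [_ [a [b ->] <-]].
rewrite setTI; apply: sub_sigma_algebra.
have /continuousP h := @continuous_cc_integral phi; apply: h; exact: interval_open.
Qed.

(** A trapezoid that is 1 on [a + 1/(n+1), b] and vanishes outside ]a, b + 1/(n+1)[. *)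
Definition trap (a b : R) (n : nat) (x : R) : R :=
  Num.max 0 (Num.min 1 (Num.min (n.+1%:R * (x - a)) (1 - n.+1%:R * (x - b)))).

Lemma continuous_trap a b n : continuous (trap a b n).
Proof.
have c1 : continuous (fun x : R => n.+1%:R * (x - a)).
  by move=> x; apply: cvgM; [exact: cvg_cst|apply: cvgB; [exact: cvg_id|exact: cvg_cst]].
have c2 : continuous (fun x : R => 1 - n.+1%:R * (x - b)).
  move=> x; apply: cvgB; first exact: cvg_cst.
  by apply: cvgM; [exact: cvg_cst|apply: cvgB; [exact: cvg_id|exact: cvg_cst]].
have -> : trap a b n = (cst 0 \max (cst 1 \min ((fun x : R => n.+1%:R * (x - a)) \min (fun x : R => 1 - n.+1%:R * (x - b))))) by [].
apply: max_fun_continuous; first by move=> x; exact: cvg_cst.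
apply: min_fun_continuous; first by move=> x; exact: cvg_cst.
exact: (min_fun_continuous c1 c2).
Qed.

Lemma trap_eq0 a b n x : ~ (a <= x <= b + 1) -> trap a b n x = 0.
Proof.
move=> xab; rewrite /trap; apply/max_idPl; rewrite !ge_min.
have n1 : 1 <= n.+1%:R :> R by rewrite ler1n.
have [ax|xa] := leP a x.
  have xb : b + 1 < x by rewrite ltNge; apply/negP => h; apply: xab; rewrite ax h.
  apply/orP; right; apply/orP; right; nra.
apply/orP; right; apply/orP; left; nra.
Qed.

Lemma trap_ge0 a b n x : 0 <= trap a b n x.
Proof. by rewrite le_max lexx. Qed.

Lemma trap_le1 a b n x : trap a b n x <= 1.
Proof. by rewrite ge_max ler01 ge_min lexx. Qed.

Lemma compact_trap a b n : compact (closure [set x | trap a b n x != 0]).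
Proof.
apply: (@subclosed_compact _ _ `[a, b + 1]); first exact: closed_closure.
  exact: segment_compact.
rewrite (closure_id `[a, b + 1]).1; last exact: interval_closed.
apply: closure_subset => x /= /eqP h; rewrite in_itv/=.
by apply: contrapT => /(@trap_eq0 a b n).
Qed.

Definition cc_trap a b n : cc_fun R :=
  exist _ (trap a b n) (conj (@continuous_trap a b n) (@compact_trap a b n)).

Lemma cvg_trap a b x : trap a b n x @[n --> \oo] --> (\1_(`]a, b]) x : R).
Proof.
rewrite indicE; have [|] := boolP (x \in `]a, b]%classic).
  rewrite inE/= in_itv/= => /andP[ax xb].
  apply: cvg_near_cst; near=> n.
  rewrite /trap; have h1 : 1 <= n.+1%:R * (x - a).
    rewrite -ler_pdivrMr ?subr_gt0// div1r; apply: (@le_trans _ _ n%:R); last by rewrite ler_nat.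
    by apply: ltW; near: n; exact: nbhs_infty_gtr.
  have h2 : 1 <= 1 - n.+1%:R * (x - b).
    have : 0 <= n.+1%:R :> R by [].
    nra.
  rewrite (min_idPl _); last by rewrite le_min h1 h2.
  by apply/max_idPr.
move=> /negP h; have {h} : ~ (a < x <= b) by move=> h'; apply: h; rewrite inE/= in_itv/=.
move=> h; have [xa|ax] := leP x a.
  apply: cvg_near_cst; near=> n; rewrite /trap; apply/max_idPl; rewrite !ge_min.
  have : 0 <= n.+1%:R :> R by [].
  move=> n0; apply/orP; right; apply/orP; left; nra.
have bx : b < x by rewrite ltNge; apply/negP => h'; apply: h; rewrite ax h'.
apply: cvg_near_cst; near=> n; rewrite /trap; apply/max_idPl; rewrite !ge_min.
have h1 : 1 <= n.+1%:R * (x - b).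
  rewrite -ler_pdivrMr ?subr_gt0// div1r; apply: (@le_trans _ _ n%:R); last by rewrite ler_nat.
  by apply: ltW; near: n; exact: nbhs_infty_gtr.
apply/orP; right; apply/orP; right; lra.
Unshelve. all: by end_near.
Qed.

Lemma measurable_mu_itv (a b : R) :
  measurable_fun [set: VB] (fun mu : VB => (mu : wpm R) `]a, b]%classic).
Proof.
have fineE (mu : VB) : (mu : wpm R) `]a, b]%classic = (fine ((mu : wpm R) `]a, b]%classic))%:E.
  rewrite fineK//; apply: (@wpm_fin _ _ a b) => //; exact: subset_itv_oc_cc.
rewrite (_ : (fun mu : VB => _) = (fun mu : VB => (fine ((mu : wpm R) `]a, b]%classic))%:E)); last first.
  by apply/funext => mu; exact: fineE.
apply/measurable_EFinP.
apply: (@measurable_fun_cvg _ _ _ setT (fun n (mu : VB) => \int[(mu : wpm R)]_x (sval (cc_trap a b n) x))) => //.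
  move=> n; exact: measurable_cc_integral.
move=> mu _.
have mtrap n : measurable_fun [set: R] (trap a b n).
  by apply: continuous_measurable_fun; exact: continuous_trap.
have [|||||_ _] := @dominated_convergence _ _ _ (mu : wpm R) setT measurableT (fun n x => (trap a b n x)%:E) (fun x => (\1_(`]a, b]) x)%:E) (fun x => (\1_(`[a, b+1]) x)%:E).
- by move=> n; exact/measurable_EFinP.
- by apply/measurable_EFinP; exact: measurable_indic.
- by apply: aeW => x _; apply: cvg_EFin; [exact: nearW|exact: cvg_trap].
- apply/integrableP; split; first by apply/measurable_EFinP; exact: measurable_indic.
  under eq_integral do rewrite /= ger0_norm//.
  rewrite integral_indic// setIT -ge0_fin_numE//.
  exact: (@wpm_fin _ _ a (b + 1)).
- apply: aeW => x n _; rewrite lee_fin ger0_norm ?trap_ge0// indicE.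
  have [_|h] := boolP (x \in _); first exact: trap_le1.
  rewrite trap_eq0//; move: h; rewrite notin_setE/= in_itv/=; exact.
rewrite integral_indic// setIT fineE => h; exact: (fine_cvg h).
Qed.

(** Continuous functions with compact support give the half-open intervals by dominated
convergence, and these generate the Borel sets. *)
Lemma measurable_mu (U : set R) : measurable U ->
  measurable_fun [set: VB] (fun mu : VB => (mu : wpm R) U).
Proof.
move=> mU.
pose I n : set R := `]- n%:R, n%:R]%classic.
have mI n : measurable (I n) by exact: measurable_itv.
have finI (mu : VB) n D : measurable D -> D `<=` I n -> (mu : wpm R) D \is a fin_num.
  move=> mD DI; apply: (@wpm_fin _ _ (- n%:R) n%:R) => //; apply: subset_trans DI _; exact: subset_itv_oc_cc.
have key n : measurable_fun [set: VB] (fun mu : VB => (mu : wpm R) (U `&` I n)).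
  apply: (@dynkin_induction _ R (@ocitv R) (fun U => measurable_fun [set: VB] (fun mu : VB => (mu : wpm R) (U `&` I n)))) => //.
  - exact: ocitvI.
  - rewrite setTI; exact: measurable_mu_itv.
  - move=> D oD; have : ocitv (D `&` I n) by apply: ocitvI => //; exact: is_ocitv.
    by move=> [[c d] _ <-]; exact: measurable_mu_itv.
  - move=> S mS h.
    rewrite (_ : (fun mu : VB => _) = (fun mu : VB => (mu : wpm R) (I n) - (mu : wpm R) (S `&` I n)))%E.
      by apply: emeasurable_funB => //; exact: measurable_mu_itv.
    apply/funext => mu; have fI : ((mu : wpm R) (I n) < +oo)%E.
      by have := finI mu n _ (mI n) (@subset_refl _ _); rewrite ge0_fin_numE.
    by rewrite setIC -setDE measureD// setIC.
  - move=> F mF tF h.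
    rewrite (_ : (fun mu : VB => _) = (fun mu : VB => \sum_(k <oo) (mu : wpm R) (F k `&` I n)))%E.
      by apply: ge0_emeasurable_sum.
    apply/funext => mu; rewrite setI_bigcupl measure_semi_bigcup//.
    + by move=> k; exact: measurableI.
    + exact: trivIset_setIr.
    + by rewrite -setI_bigcupl; apply: measurableI => //; exact: bigcupT_measurable.
apply: (@emeasurable_fun_cvg _ _ _ _ (fun n (mu : VB) => (mu : wpm R) (U `&` I n))) => //.
move=> mu _.
have affine_meanE : U = \bigcup_n (U `&` I n).
  rewrite -setI_bigcupr; apply/seteqP; split => [x Ux|x []//]; split => //.
  exists (Num.bound `|x|) => //; rewrite /I/= in_itv/=.
  have := archi_boundP (normr_ge0 x); rewrite ltr_norml => /andP[-> /ltW ->]//.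
rewrite [in X in _ --> X]affine_meanE; apply: nondecreasing_cvg_mu => //.
- by move=> k; exact: measurableI.
- by rewrite -affine_meanE.
- move=> n m nm; apply/subsetPset; apply: setIS => x; rewrite /I/= !in_itv/= => /andP[h1 h2].
  have nm' : n%:R <= m%:R :> R by rewrite ler_nat.
  by apply/andP; split; lra.
Qed.

Lemma measurable_mu_integral (f : R -> \bar R) : (forall x, 0 <= f x)%E -> measurable_fun [set: R] f ->
  measurable_fun [set: VB] (fun mu : VB => \int[(mu : wpm R)]_x f x)%E.
Proof.
move=> f0 mf; apply: (measurable_fun_integral_kernel (l := fun mu : VB => (mu : wpm R))) => //.
exact: measurable_mu.
Qed.

Lemma measurable_mu_Rintegral (D : set R) (f : R -> R) : measurable D -> measurable_fun D f ->
  measurable_fun [set: VB] (fun mu : VB => \int[(mu : wpm R)]_(x in D) f x).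
Proof.
move=> mD mf; have mg : measurable_fun [set: R] (EFin \o (f \_ D)).
  by apply/measurable_EFinP; apply/(measurable_restrict _ mD measurableT); rewrite setTI.
have -> : (fun mu : VB => \int[(mu : wpm R)]_(x in D) f x) =
   (fun mu : VB => fine (\int[(mu : wpm R)]_x ((EFin \o (f \_ D))^\+ x) - \int[(mu : wpm R)]_x ((EFin \o (f \_ D))^\- x))%E).
  by apply/funext => mu; rewrite Rintegral_mkcond /Rintegral integralE.
apply: measurableT_comp => //; apply: emeasurable_funB; apply: measurable_mu_integral.
- by move=> x; exact: funepos_ge0.
- exact: measurable_funepos mg.
- by move=> x; exact: funeneg_ge0.
- exact: measurable_funeneg mg.
Qed.

End vague_measurability.

Section shift_measurable.
Context {R : realType}.
Notation VB := (vague_borel R).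

Lemma ptws_cvg (I : Type) (F : set_system (I -> R)) (f : I -> R) : Filter F ->
  (forall i, (fun g => g i) @ F --> f i) -> F --> (f : {ptws I -> R}).
Proof.
move=> FF h; rewrite cvg_sup => i.
rewrite cvg_image; last by rewrite eqEsubset; split=> v // _; exists (cst v).
move=> W //=; rewrite ?nbhs_simpl => Q; exists (@^~ i @^-1` W); first exact: h.
by rewrite eqEsubset; split => [j [? + <-//]|j Wj]; exists (fun _ => j).
Qed.

Lemma shift_cc (t : R) (phi : cc_fun R) : continuous (fun x => sval phi (x - t)) /\
  compact (closure [set x | sval phi (x - t) != 0]).
Proof.
case: phi => phi [/= cphi kphi]; split.
  by move=> x; apply: (@continuous_comp _ _ _ (fun x => x - t) phi); [apply: cvgB; [exact: cvg_id|exact: cvg_cst]|exact: cphi].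
have -> : [set x | phi (x - t) != 0] = (fun x => x + t) @` [set x | phi x != 0].
  apply/seteqP; split => [x h|_ [x h <-]]; last by rewrite /= addrK.
  by exists (x - t) => //; rewrite subrK.
have ct (a : R) : continuous (fun x : R => x + a).
  by move=> x; apply: cvgD; [exact: cvg_id|exact: cvg_cst].
apply: (@subclosed_compact _ _ ((fun x => x + t) @` closure [set x | phi x != 0])).
- exact: closed_closure.
- by apply: continuous_compact => //; exact: continuous_subspaceT.
- have cl : closed ((fun x : R => x + t) @` closure [set x | phi x != 0]).
    have -> : (fun x : R => x + t) @` closure [set x | phi x != 0] = (fun x => x + (- t)) @^-1` closure [set x | phi x != 0].
      apply/seteqP; split => [_ [x h <-]|x h]; first by rewrite /= addrK.
      by exists (x - t) => //; rewrite subrK.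
    by apply: closed_comp => [? _|]; [exact: ct|exact: closed_closure].
  rewrite [X in _ `<=` X](closure_id _).1//; apply: closure_subset.
  by apply: image_subset; exact: subset_closure.
Qed.

(** Translating the measure is translating the test functions, so the shift is continuous
for the vague topology. *)
Lemma measurable_wpm_shift t : measurable_fun [set: VB] (wpm_shift t : VB -> VB).
Proof.
apply: (@measurability _ _ VB VB setT _ (@open (vague R)) erefl) => _ [A oA <-]; rewrite setTI.
apply: sub_sigma_algebra; case: oA => B oB <-.
have /continuousP h : continuous ((fun mu : vague R => cc_integral (wpm_shift t mu)) : vague R -> {ptws cc_fun R -> R}).
  move=> mu; have FF : Filter ((fun mu : vague R => cc_integral (wpm_shift t mu)) @ nbhs mu).
    by apply: fmap_filter; exact: nbhs_filter.
  apply: (ptws_cvg FF) => phi.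
  have e : (fun mu : vague R => cc_integral (wpm_shift t mu) phi) =
           (fun mu : vague R => cc_integral mu (exist _ _ (shift_cc t phi))).
    apply/funext => nu; rewrite /cc_integral /=.
    have mg : measurable_fun [set: R] (fun x : R => x - t) by exact: (@measurable_funB _ _ R _ id (cst t)).
    have mphi : measurable_fun [set: R] (EFin \o sval phi).
      by apply/measurable_EFinP; apply: continuous_measurable_fun; case: (svalP phi).
    rewrite /Rintegral; congr fine; rewrite integralE [RHS]integralE; congr (_ - _)%E.
    - transitivity (\int[pushforward nu (fun x : R => (x - t)%R)]_x ((EFin \o sval phi)^\+ x))%E; first by [].
      rewrite ge0_integral_pushforward//; last exact: measurable_funepos mphi.
      by rewrite preimage_setT; apply: eq_integral => x _; rewrite /= ?funeposE ?funenegE.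
    - transitivity (\int[pushforward nu (fun x : R => (x - t)%R)]_x ((EFin \o sval phi)^\- x))%E; first by [].
      rewrite ge0_integral_pushforward//; last exact: measurable_funeneg mphi.
      by rewrite preimage_setT; apply: eq_integral => x _; rewrite /= ?funeposE ?funenegE.
  have H : {for mu, continuous (fun mu : vague R => cc_integral (wpm_shift t mu) phi)}.
    by rewrite e; exact: continuous_cc_integral.
  exact: H.
exact: h.
Qed.

End shift_measurable.

Section right_constant.
Context d (T : measurableType d) (R : realType).

(** Evaluating at the least multiple of 1/(n+1) above y gives a function that is measurable
on countably many strips, and right-constancy makes these functions converge. *)
Lemma measurable_right_constant (f : T -> R -> R) :
  (forall y, measurable_fun [set: T] (f ^~ y)) ->
  (forall w y, exists2 e, 0 < e & forall y', y <= y' < y + e -> f w y' = f w y) ->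
  measurable_fun [set: T * R] (fun z => f z.1 z.2).
Proof.
move=> mf rf.
(* the least multiple of 1 / (n + 1) above y *)
pose r (n : nat) (y : R) : R := (Num.floor (n.+1%:R * y) + 1)%:~R / n.+1%:R.
have rP n y : y < r n y <= y + n.+1%:R^-1.
  have n0 : 0 < n.+1%:R :> R by [].
  rewrite /r ltr_pdivlMr// ler_pdivrMr// mulrDl mulVf ?gt_eqF// mulrC.
  by rewrite lt_succ_floor intrD lerD2r floor_le.
apply: (@measurable_fun_cvg _ _ _ _ (fun n z => f z.1 (r n z.2))) => [n|[w y] _ /=].
  move=> _ U mU; rewrite setTI.
  have -> : (fun z : T * R => f z.1 (r n z.2)) @^-1` U =
     \bigcup_(k : int) ((f ^~ ((k + 1)%:~R / n.+1%:R)) @^-1` U `*` [set y | Num.floor (n.+1%:R * y) = k]).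
    apply/seteqP; split => [[w y] /= h|[w y] [k _ [/= h1 h2]]].
      by exists (Num.floor (n.+1%:R * y)).
    by rewrite /r h2.
  apply: countable_bigcupT_measurable => // k; apply: measurableX.
    by rewrite -[X in measurable X]setTI; exact: mf.
  have n0 : 0 < n.+1%:R :> R by [].
  rewrite (_ : [set y | _] = `[k%:~R / n.+1%:R, (k + 1)%:~R / n.+1%:R[%classic)//.
  apply/seteqP; split => y /=; rewrite in_itv/= ler_pdivrMr// ltr_pdivlMr// (mulrC y).
    by move=> <-; rewrite floor_le lt_succ_floor.
  exact: floor_def.
have [e e0 he] := rf w y.
apply: cvg_near_cst; near=> n; apply: he.
have /andP[h1 h2] := rP n y; rewrite (ltW h1)/=; apply: le_lt_trans h2 _.
rewrite ltrD2l; rewrite invf_plt ?posrE//; apply: (@lt_le_trans _ _ n%:R); last by rewrite ler_nat.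
near: n; exact: nbhs_infty_gtr.
Unshelve. all: by end_near.
Qed.
End right_constant.

(** * Means under stationarity *)

Section stationary_measure.
Context d (T : measurableType d) (R : realType) (P : probability T R).
Variables (M : {RV P >-> vague_borel R}) (K : R).
Hypotheses (K0 : 0 < K) (stM : stationary M) (intM : intensity M = K%:E).
Notation VB := (vague_borel R).
Notation leb := (@lebesgue_measure R).
Local Notation Mw w := (M w : wpm R).

Lemma measurable_M : measurable_fun [set: T] (M : T -> VB).
Proof. exact: measurable_funPT. Qed.

(** This is the only form in which stationarity is used. *)
Lemma ge0_integral_shift (t : R) (Phi : VB -> \bar R) :
  measurable_fun [set: VB] Phi -> (forall mu, 0 <= Phi mu)%E ->
  (\int[P]_w Phi (wpm_shift t (Mw w)) = \int[P]_w Phi (M w))%E.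
Proof.
move=> mPhi Phi0.
have mS : measurable_fun [set: T] ((wpm_shift t : VB -> VB) \o M).
  exact: measurableT_comp (measurable_wpm_shift t) measurable_M.
transitivity (\int[pushforward P ((wpm_shift t : VB -> VB) \o M)]_mu Phi mu)%E.
  by rewrite ge0_integral_pushforward.
transitivity (\int[distribution P M]_mu Phi mu)%E; last by rewrite ge0_integral_distribution.
by apply: eq_measure_integral => A mA _; exact: stM.
Qed.

Lemma measurable_M_set (U : set R) : measurable U -> measurable_fun [set: T] (fun w => Mw w U).
Proof. by move=> mU; exact: measurableT_comp (measurable_mu mU) measurable_M. Qed.

(** The intensity measure of M. *)
Definition mean_measure (U : set R) : \bar R := (\int[P]_w Mw w U)%E.

Lemma mean_measure_shift (t : R) (U : set R) : measurable U -> mean_measure ((fun x => x - t) @^-1` U) = mean_measure U.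
Proof.
move=> mU; rewrite /mean_measure.
by have := @ge0_integral_shift t (fun mu : VB => (mu : wpm R) U) (measurable_mu mU); apply => mu.
Qed.

Lemma mean_measure_itv (t a b : R) : mean_measure `]a + t, b + t]%classic = mean_measure `]a, b]%classic.
Proof.
rewrite -(mean_measure_shift t (measurable_itv `]a, b])); congr mean_measure; apply/seteqP; split => x /=; rewrite !in_itv/= => /andP[h1 h2]; apply/andP; split; lra.
Qed.

Lemma mean_measure_le (U V : set R) : measurable U -> measurable V -> U `<=` V -> (mean_measure U <= mean_measure V)%E.
Proof.
move=> mU mV UV; apply: ge0_le_integral => //; try exact: measurable_M_set.
by move=> w _; apply: le_measure => //; exact/mem_set.
Qed.

Lemma mean_measure_ge0 U : (0 <= mean_measure U)%E.
Proof. exact: integral_ge0. Qed.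

Lemma mean_measure_nat (h : R) (n : nat) : 0 <= h -> mean_measure `]0, n%:R * h]%classic = (n%:R%:E * mean_measure `]0%R, h]%classic)%E.
Proof.
move=> h0; elim: n => [|n IH].
  rewrite mul0r mul0e set_itv_ge ?bnd_simp//; apply: integral0_eq => w _; exact: measure0.
have n0 : 0 <= n%:R * h by rewrite mulr_ge0.
have -> : `]0, n.+1%:R * h]%classic = `]0, n%:R * h]%classic `|` `](0 + n%:R * h), (h + n%:R * h)]%classic.
  rewrite add0r; have -> : n.+1%:R * h = h + n%:R * h by rewrite -natr1 mulrDl mul1r addrC.
  by rewrite -itv_bndbnd_setU// bnd_simp// lerDr.
rewrite -natr1 EFinD ge0_muleDl ?lee_fin// mul1e -IH -(mean_measure_itv (n%:R * h) 0 h).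
rewrite /mean_measure -ge0_integralD//; try exact: measurable_M_set.
apply: eq_integral => w _; rewrite measureU//.
apply/seteqP; split => // x [] /=; rewrite !in_itv/= add0r => /andP[_ h1] /andP[h2 _].
by move: (lt_le_trans h2 h1); rewrite ltxx.
Qed.

Lemma mean_measure_unit : mean_measure `]0, 1]%classic = K%:E.
Proof. exact: intM. Qed.

(** A crude cover of [a, b] by unit intervals is enough: the mean mass is only used up to
constants. *)
Lemma mean_measure_bound (a b : R) : a <= b -> (mean_measure `[a, b]%classic <= (K * (b - a + 2))%:E)%E.
Proof.
(* n unit steps starting at a - 1 cover [a, b], including its left endpoint *)
move=> ab; pose n := (Num.trunc (b - a)).+2.
have ba : 0 <= b - a by lra.
have hn : b - a + 1 < n%:R <= b - a + 2.
  have /andP[h1 h2] := trunc_itv ba; rewrite /n -natr1; apply/andP; split; first by rewrite ltrD2r.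
  by rewrite -natr1; lra.
apply: (@le_trans _ _ (mean_measure `]0 + (a - 1), n%:R * 1 + (a - 1)]%classic)).
  apply: mean_measure_le => // x /=; rewrite !in_itv/= mulr1 => /andP[h1 h2]; apply/andP; split; lra.
rewrite mean_measure_itv mean_measure_nat// mean_measure_unit -EFinM lee_fin mulrC ler_pM2l//; lra.
Qed.

(** Split the unit interval into n translates: each has mean mass K / n. *)
Lemma mean_measure_set1 (s : R) : mean_measure [set s] = 0%E.
Proof.
apply/eqP; rewrite eq_le mean_measure_ge0 andbT; apply/lee_addgt0Pr => e e0.
rewrite add0e.
pose n := (Num.trunc (K / e)).+1.
have n0 : 0 < n%:R :> R by [].
have hn : K / e < n%:R.
  have Ke : 0 <= K / e by rewrite divr_ge0// ltW.
  by have /andP[_] := trunc_itv Ke.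
have ninv : 0 <= n%:R^-1 :> R by rewrite invr_ge0.
have := mean_measure_nat n ninv; rewrite mulfV ?gt_eqF// mean_measure_unit => EK.
apply: (@le_trans _ _ (mean_measure `]0 + (s - n%:R^-1), n%:R^-1 + (s - n%:R^-1)]%classic)).
  apply: mean_measure_le => // x /= ->; rewrite in_itv/=; have : 0 < n%:R^-1 :> R by rewrite invr_gt0.
  by move=> h; apply/andP; split; lra.
rewrite mean_measure_itv; rewrite -(@lee_pmul2l _ n%:R%:E)// -EK -EFinM lee_fin.
by rewrite -ler_pdivrMr// ltW.
Qed.

Lemma ae_no_atom (s : R) : {ae P, forall w, Mw w [set s] = 0%E}.
Proof.
have h : (\int[P]_w `|Mw w [set s]| = 0)%E.
  by rewrite -(mean_measure_set1 s); apply: eq_integral => w _; rewrite gee0_abs.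
have [/(_ h) + _] := ae_eq_integral_abs P measurableT (measurable_M_set (measurable_set1 s)).
by apply: filterS => w; apply.
Qed.

Lemma supp_atom (mu : wpm R) (s : R) : supp mu s -> (0 < mu [set s])%E.
Proof.
have [w [_ pos muE]] := wpmP mu; move=> ss; rewrite muE//.
have -> : supp mu `&` [set s] = [set s] by apply/seteqP; split => [x []//|x ->].
by rewrite esum_set1 ?lte_fin ?pos// lee_fin ltW// pos.
Qed.

Lemma ae_notin_supp (s : R) : {ae P, forall w, ~ supp (Mw w) s}.
Proof.
by apply: filterS (ae_no_atom s) => w h /supp_atom; rewrite h ltxx.
Qed.

Lemma measurable_mass b (y : R) : measurable_fun [set: T] (fun w => mass (Mw w) b y).
Proof.
by apply: measurableT_comp => //; apply: measurable_M_set; exact: measurable_ray.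
Qed.

(** Tonelli's theorem needs the discrepancy measurable jointly in the realization and in y. *)
Lemma measurable_disc2 b : measurable_fun [set: T * R] (fun z => disc (Mw z.1) b K z.2).
Proof.
apply: measurable_funB; last first.
  by apply: measurable_funM => //; exact: measurable_snd.
apply: (@measurable_right_constant _ _ _ (fun w y => mass (Mw w) b y)); first exact: measurable_mass.
move=> w y; have [y0|y0] := leP 0 y.
  have [e e0 he] := right_gap (Mw w) y0; exists e => // y' h.
  have /andP[yy' _] := h.
  by rewrite (massB (Mw w) b (a := y)) ?y0// (he b y' h) addr0.
exists (- y); first by lra.
move=> y' /andP[h1 h2]; rewrite /mass.
have e (z : R) : z < 0 -> ray b 0 z = set0.
  by move=> z0; apply/seteqP; split => // x /andP[h3 h4]; lra.
by rewrite !e//; lra.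
Qed.

Local Notation g := (discrepancy M K).

Lemma discrepancyE x : 0 <= x -> (g x = \int[P]_w `|disc (Mw w) true K x|%:E)%E.
Proof.
move=> x0; rewrite /discrepancy unlock; apply: eq_integral => w _.
rewrite /disc /mass /Defs.counting x0.
by rewrite (_ : `]0, x]%classic = ray true 0 x)//; apply/seteqP; split => y /=; rewrite /ray/= in_itv.
Qed.

(** Stationarity makes the two half-lines have the same mean discrepancy: shift by x and
ignore the endpoints, which almost surely carry no mass. *)
Lemma discrepancy_flip b x : 0 <= x -> (g x = \int[P]_w `|disc (Mw w) b K x|%:E)%E.
Proof.
case: b => x0; first exact: discrepancyE.
pose Phi (mu : VB) : \bar R := (`|fine ((mu : wpm R) `]0, x]%classic) - K * x|%:E)%E.
have mPhi : measurable_fun [set: VB] Phi.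
  apply/measurable_EFinP; apply: measurableT_comp => //; apply: measurable_funB => //.
  by apply: measurableT_comp => //; exact: measurable_mu.
have rE : `]0, x]%classic = ray true 0 x by apply/seteqP; split => y /=; rewrite /ray/= in_itv.
have -> : g x = (\int[P]_w Phi (M w))%E.
  by rewrite discrepancyE//; apply: eq_integral => w _; rewrite /Phi /disc /mass rE.
rewrite -(ge0_integral_shift (- x) mPhi); last by move=> mu; rewrite lee_fin.
apply: ge0_ae_eq_integral => //.
- apply: measurableT_comp mPhi _; exact: measurableT_comp (measurable_wpm_shift _) measurable_M.
- apply/measurable_EFinP; apply: measurableT_comp => //; apply: measurable_funB => //.
  exact: measurable_mass.
- by move=> w _; rewrite lee_fin.
- near=> w => _.
  rewrite /Phi /disc /mass; congr (`|fine _ - _|%:E).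
  rewrite -[LHS]/((Mw w) ((fun z => z - - x) @^-1` `]0, x]%classic)).
  have h0 : Mw w [set 0] = 0%E by near: w; exact: ae_no_atom.
  have hx : Mw w [set - x] = 0%E by near: w; exact: ae_no_atom.
  have mr := measurable_ray false 0 x.
  have -> : (fun z => z - - x) @^-1` `]0, x]%classic = `]- x, 0]%classic.
    by apply/seteqP; split => z /=; rewrite !in_itv/= => /andP[h1 h2]; apply/andP; split; lra.
  rewrite -(measureU0 _ (measurable_set1 (- x)) hx)// -[RHS](measureU0 mr (measurable_set1 0) h0).
  congr (_ _); apply/seteqP; split => z.
    case => [/=|/= ->]; rewrite ?in_itv/=.
      move=> /andP[h1 h2]; have [->|z0] := eqVneq z 0; [by right|left].
      by have := lt_neqAle z 0; rewrite z0 h2 /ray/= => zl; apply/andP; split; lra.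
    have [->|xn] := eqVneq x 0; first by right => /=; rewrite oppr0.
    by left; rewrite /ray /= opprK lexx andbT lt_def xn.
  case => [/=|/= ->].
    rewrite /ray/= => /andP[h1 h2]; have [->|zx] := eqVneq z (- x); [by right|left].
    rewrite in_itv/=; have := lt_neqAle (- x) z; rewrite eq_sym zx => zl.
    by apply/andP; split; [rewrite zl/=|]; lra.
  have [->|xn] := eqVneq x 0; first by right => /=; rewrite oppr0.
  by left; rewrite in_itv/= lexx andbT oppr_lt0 lt_def xn.
Unshelve. all: by end_near.
Qed.

Lemma mass_mean b a y : 0 <= a <= y ->
  (\int[P]_w (mass (Mw w) b y - mass (Mw w) b a)%:E <= (K * (y - a + 2))%:E)%E.
Proof.
move=> /andP[a0 ay].
(* the closed interval that contains the ray, on either side *)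
pose c := if b then a else - y.
pose e := if b then y else - a.
have ce : c <= e by rewrite /c /e; case: (b); lra.
have -> : y - a = e - c by rewrite /c /e; case: (b); lra.
apply: le_trans (mean_measure_bound ce); apply: ge0_le_integral => //.
- by move=> w _; rewrite lee_fin subr_ge0 mass_le// a0.
- by apply/measurable_EFinP; apply: measurable_funB; exact: measurable_mass.
- exact: measurable_M_set.
- move=> w _; rewrite (massB (Mw w) b (a := a) (y := y)) ?a0// addrAC subrr add0r fineK.
    apply: le_measure; rewrite ?inE//; first exact: measurable_ray.
    by move=> x; rewrite /ray/c/e /= in_itv/=; case: (b) => /= /andP[h1 h2]; apply/andP; split; lra.
  apply: (@wpm_fin _ _ (- y) y); [exact: measurable_ray|exact: ray_sub].
Qed.

Lemma discrepancy_ge0 x : (0 <= g x)%E.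
Proof. by rewrite /discrepancy unlock; apply: integral_ge0. Qed.

(** The mass is nondecreasing and its mean increment is linear, so g cannot drop faster
than linearly. *)
Lemma discrepancy_quasi x y : 0 <= x <= y -> (g x <= g y + (2 * K * (y - x + 1))%:E)%E.
Proof.
move=> /andP[x0 xy]; have y0 : 0 <= y by lra.
rewrite !discrepancyE//.
have mD z : measurable_fun [set: T] (fun w => `|disc (Mw w) true K z|%:E).
  apply/measurable_EFinP; apply: measurableT_comp => //; apply: measurable_funB => //.
  exact: measurable_mass.
have md : measurable_fun [set: T] (fun w => (mass (Mw w) true y - mass (Mw w) true x)%:E).
  by apply/measurable_EFinP; apply: measurable_funB; exact: measurable_mass.
have md0 w : 0 <= mass (Mw w) true y - mass (Mw w) true x by rewrite subr_ge0 mass_le// x0.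
have Kxy : 0 <= K * (y - x) by rewrite mulr_ge0 ?subr_ge0// ltW.
apply: (@le_trans _ _ (\int[P]_w (`|disc (Mw w) true K y|%:E + ((mass (Mw w) true y - mass (Mw w) true x)%:E + (K * (y - x))%:E)))%E).
  apply: ge0_le_integral => //.
  - by apply: emeasurable_funD => //; apply: emeasurable_funD => //.
  - move=> w _; rewrite -!EFinD lee_fin.
    have := md0 w; rewrite /disc; move: (mass _ _ x) (mass _ _ y) => u v h.
    have -> : u - K * x = (v - K * y) + ((- (v - u)) + K * (y - x)) by ring.
    apply: le_trans (ler_normD _ _) _; rewrite lerD2l; apply: le_trans (ler_normD _ _) _.
    by rewrite normrN (ger0_norm h) ger0_norm.
rewrite ge0_integralD//; [|by move=> w _; rewrite adde_ge0// lee_fin|exact: emeasurable_funD].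
rewrite leeD2l// ge0_integralD//; [|by move=> w _; rewrite lee_fin].
rewrite integral_cst//= [P _]probability_setT mule1.
apply: (@le_trans _ _ ((K * (y - x + 2))%:E + (K * (y - x))%:E)%E).
  by rewrite leeD2r//; apply: mass_mean; rewrite x0.
by rewrite -EFinD lee_fin; lra.
Qed.

Lemma discrepancy_bound x : 0 <= x -> (g x <= (2 * K * (x + 1))%:E)%E.
Proof.
move=> x0; rewrite discrepancyE//.
have m0 w : mass (Mw w) true 0 = 0.
  rewrite /mass (_ : ray true 0 0 = set0) ?measure0//.
  by apply/seteqP; split => // z /andP[h1 h2]; move: (lt_le_trans h1 h2); rewrite ltxx.
have mge w : 0 <= mass (Mw w) true x by rewrite -(m0 w) mass_le// lexx.
have Kx : 0 <= K * x by rewrite mulr_ge0// ltW.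
apply: (@le_trans _ _ (\int[P]_w ((mass (Mw w) true x - mass (Mw w) true 0)%:E + (K * x)%:E))%E).
  apply: ge0_le_integral => //.
  - apply/measurable_EFinP; apply: measurableT_comp => //; apply: measurable_funB => //; exact: measurable_mass.
  - by apply: emeasurable_funD => //; apply/measurable_EFinP; apply: measurable_funB; exact: measurable_mass.
  - move=> w _; rewrite -EFinD lee_fin m0 subr0 /disc; apply: le_trans (ler_normB _ _) _.
    by rewrite (ger0_norm (mge w)) ger0_norm.
rewrite ge0_integralD//; first last.
- by apply/measurable_EFinP; apply: measurable_funB; exact: measurable_mass.
- by move=> w _; rewrite m0 subr0 lee_fin.
rewrite integral_cst//= [P _]probability_setT mule1.
apply: (@le_trans _ _ ((K * (x - 0 + 2))%:E + (K * x)%:E)%E).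
  by rewrite leeD2r//; apply: mass_mean; rewrite lexx.
by rewrite -EFinD lee_fin; lra.
Qed.
Lemma tonelli_disc b (D : set R) (phi : R -> R) : measurable D -> D `<=` `[0, +oo[ ->
  measurable_fun D phi -> (forall y, D y -> 0 <= phi y) ->
  measurable_fun [set: T] (fun w => \int[leb]_(y in D) (`|disc (Mw w) b K y| * phi y)%:E)%E /\
  (\int[P]_w \int[leb]_(y in D) (`|disc (Mw w) b K y| * phi y)%:E = \int[leb]_(y in D) (g y * (phi y)%:E))%E.
Proof.
move=> mD D0 mphi phi0.
pose F (z : T * R) : \bar R := (`|disc (Mw z.1) b K z.2| * (phi \_ D) z.2)%:E.
have mF : measurable_fun [set: T * R] F.
  apply/measurable_EFinP; apply: measurable_funM.
    by apply: measurableT_comp => //; exact: measurable_disc2.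
  by apply: measurableT_comp (measurable_snd) => //; apply/(measurable_restrict _ mD measurableT); rewrite setTI.
have F0 z : (0 <= F z)%E.
  by rewrite lee_fin mulr_ge0// patchE; case: ifPn => // /set_mem /phi0.
have E w : (\int[leb]_(y in D) (`|disc (Mw w) b K y| * phi y)%:E = \int[leb]_y F (w, y))%E.
  rewrite integral_mkcond; apply: eq_integral => y _; rewrite /F/= !patchE.
  by case: ifPn => _ //; rewrite mulr0.
split.
  under eq_fun do rewrite E.
  exact: (@measurable_fun_fubini_tonelli_F _ _ _ _ _ leb F mF F0).
under eq_integral do rewrite E.
rewrite (@fubini_tonelli _ _ _ _ _ P leb F mF F0).
rewrite [RHS]integral_mkcond; apply: eq_integral => y _.
rewrite /F/= !patchE; case: ifPn => [/set_mem Dy|_].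
  have y0 : 0 <= y by have := D0 _ Dy; rewrite /= in_itv/= andbT.
  under eq_integral do rewrite EFinM.
  rewrite ge0_integralZr//; first by rewrite (discrepancy_flip b)//.
  - apply/measurable_EFinP; apply: measurableT_comp => //; apply: measurable_funB => //; exact: measurable_mass.
  - by rewrite lee_fin phi0.
by under eq_integral do rewrite mulr0; rewrite integral0.
Qed.

Lemma measurable_discrepancy (D : set R) : measurable D -> D `<=` `[0, +oo[ -> measurable_fun D g.
Proof.
move=> mD D0.
pose F (z : T * R) : \bar R := `|disc (Mw z.1) true K z.2|%:E.
have mF : measurable_fun [set: T * R] F.
  by apply/measurable_EFinP; apply: measurableT_comp => //; exact: measurable_disc2.
have F0 z : (0 <= F z)%E by rewrite lee_fin.
have mG := @measurable_fun_fubini_tonelli_G _ _ _ _ _ P F mF F0.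
apply: (eq_measurable_fun (fubini_G P F)).
  by move=> y /set_mem /D0; rewrite /= in_itv/= andbT => y0; rewrite discrepancyE.
exact: measurable_funTS.
Qed.

(** The mean of [integral_by_parts], with Tonelli's theorem for the last term. *)
Lemma mean_by_parts b (a B : R) (f f' : R -> R) :
  0 <= a < B -> measurable_fun [set: R] f ->
  (forall y, a <= y <= B -> is_derive y 1 f (f' y)) ->
  {within `[a, B], continuous f'} ->
  measurable_fun [set: T] (fun w => \int[Mw w]_(x in ray b a B) f (flip b x)) /\
  (\int[P]_w `|\int[Mw w]_(x in ray b a B) f (flip b x) - K * parts_cst f f' a B|%:E <=
    g B * `|f B|%:E + g a * `|f a|%:E + \int[leb]_(y in `[a, B]) (g y * `|f' y|%:E))%E.
Proof.
move=> aB mf df cf; have /andP[a0 aB'] := aB.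
have mI : measurable_fun [set: T] (fun w => \int[Mw w]_(x in ray b a B) f (flip b x)).
  apply: measurableT_comp (measurable_mu_Rintegral _ _) measurable_M; first exact: measurable_ray.
  by apply: measurable_funTS; apply: measurableT_comp => //; exact: measurable_flip.
split => //.
have mD z : measurable_fun [set: T] (fun w => `|disc (Mw w) b K z|%:E).
  apply/measurable_EFinP; apply: measurableT_comp => //; apply: measurable_funB => //.
  exact: measurable_mass.
have [|||mT IT] := @tonelli_disc b `[a, B] (fun y => `|f' y|) (measurable_itv _).
- by move=> y; rewrite /= !in_itv/= andbT => /andP[h _]; lra.
- apply: measurableT_comp => //; apply: subspace_continuous_measurable_fun => //.
- by [].
rewrite -IT.
rewrite (discrepancy_flip b a0) (discrepancy_flip b (x := B)); last by lra.
apply: (@le_trans _ _ (\int[P]_w ((`|disc (Mw w) b K B|%:E * `|f B|%:E + `|disc (Mw w) b K a|%:E * `|f a|%:E) +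
   \int[leb]_(y in `[a, B]) (`|disc (Mw w) b K y| * `|f' y|)%:E))%E).
  apply: ge0_le_integral => //.
  - apply/measurable_EFinP; apply: measurableT_comp => //; exact: measurable_funB.
  - apply: emeasurable_funD => //; apply: emeasurable_funD; exact: emeasurable_funM.
  - by move=> w _; rewrite -!EFinM; exact: integral_by_parts.
rewrite ge0_integralD//; first last.
- by move=> w _; apply: integral_ge0 => y _; rewrite lee_fin.
- by apply: emeasurable_funD; exact: emeasurable_funM.
- by move=> w _; rewrite -!EFinM -EFinD lee_fin addr_ge0.
rewrite leeD2r// ge0_integralD//; first last.
- exact: emeasurable_funM.
- exact: emeasurable_funM.
rewrite !ge0_integralZr//.
Qed.

End stationary_measure.

(** * A discrete Cauchy-Riemann equation for resolvents *)

Section resolvent_step.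
Import complex.
Context {R : realType}.
Local Notation C := R[i].
Local Notation N := (@Normc.normc R).

Lemma normc_ge0 (z : C) : 0 <= N z.
Proof. by case: z => x y; rewrite sqrtr_ge0. Qed.

Lemma normc_sqr (z : C) : N z ^+ 2 = complex.Re z ^+ 2 + complex.Im z ^+ 2.
Proof. by case: z => x y /=; rewrite sqr_sqrtr// addr_ge0 ?sqr_ge0. Qed.

Lemma ger_normc (z : C) c : 0 <= c -> complex.Re z ^+ 2 + complex.Im z ^+ 2 <= c ^+ 2 -> N z <= c.
Proof. by move=> c0 h; rewrite -(@ler_pXn2r _ 2)// ?nnegrE ?normc_ge0// normc_sqr. Qed.

Lemma Im_le_normc (z : C) : `|complex.Im z| <= N z.
Proof.
rewrite -(@ler_pXn2r _ 2)// ?nnegrE ?normc_ge0// normc_sqr real_normK ?num_real//.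
by rewrite lerDr sqr_ge0.
Qed.

Lemma normcB (x y : C) : N (x - y) <= N x + N y.
Proof. by rewrite -(normcN y) ; exact: le_normcD. Qed.

Lemma normc_real (x : R) : 0 <= x -> N x%:C%C = x.
Proof. by move=> x0; rewrite /= expr0n addr0 sqrtr_sqr ger0_norm. Qed.

Lemma normc_sum (I : Type) (s : seq I) (F : I -> C) : N (\sum_(i <- s) F i) <= \sum_(i <- s) N (F i).
Proof.
elim: s => [|i s IH]; first by rewrite !big_nil Normc.normc0.
by rewrite !big_cons; apply: le_trans (le_normcD _ _) _; rewrite lerD2l.
Qed.

Lemma Im_inv (z : C) : complex.Im z^-1 = - complex.Im z * N z^-1 ^+ 2.
Proof.
rewrite Normc.normcV exprVn normc_sqr; case: z => x y /=.
by rewrite mulNr.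
Qed.

Lemma Im_sum (I : Type) (s : seq I) (F : I -> C) : complex.Im (\sum_(i <- s) F i) = \sum_(i <- s) complex.Im (F i).
Proof.
elim: s => [|i s IH]; first by rewrite !big_nil.
by rewrite !big_cons -IH; case: (F i) (\sum_(_ <- _) _) => [? ?] [].
Qed.

Lemma Re_sum (I : Type) (s : seq I) (F : I -> C) : complex.Re (\sum_(i <- s) F i) = \sum_(i <- s) complex.Re (F i).
Proof.
elim: s => [|i s IH]; first by rewrite !big_nil.
by rewrite !big_cons -IH; case: (F i) (\sum_(_ <- _) _) => [? ?] [].
Qed.

Variables (s : seq R) (w : R -> R) (a b : R).
Hypotheses (w0 : forall x, 0 <= w x) (b0 : 0 < b).

Let f (z : C) (x : R) : C := (z - x%:C%C)^-1.
Let W (z : C) : C := \sum_(x <- s) (w x)%:C%C * f z x.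
Let G (z : C) : C := W z + (- a +i* b)%C.
Let S (z z' : C) : C := \sum_(x <- s) (w x)%:C%C * (f z x * f z' x).

Section three_points.
Variables (eta delta : R) (z0 z1 z2 : C).
Hypotheses (eta0 : 0 < eta) (delta0 : 0 < delta) (de : 2 * delta <= eta).
Hypotheses (I0 : complex.Im z0 <= - eta) (I1 : complex.Im z1 <= - eta) (I2 : complex.Im z2 <= - eta).
Hypotheses (h1 : N (z1 - z0) <= delta) (h2 : N (z2 - z0) <= delta) (h12 : N (z1 - z2) <= 2 * delta).

Let low z x : complex.Im z <= - eta -> eta <= N (z - x%:C%C).
Proof.
move=> Iz; apply: le_trans (Im_le_normc _); case: z Iz => u v /= Iz.
by rewrite subr0 -normrN; apply: le_trans (ler_norm _); rewrite lerNr.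
Qed.

Let nz z x : complex.Im z <= - eta -> z - x%:C%C != 0.
Proof.
move=> /(low x) h; apply/eqP => e; move: (lt_le_trans eta0 h); rewrite e Normc.normc0 ltxx.
by [].
Qed.

Let Nf z x : N (f z x) = (N (z - x%:C%C))^-1.
Proof. by rewrite /f Normc.normcV. Qed.

Let fB z z' x : complex.Im z <= - eta -> complex.Im z' <= - eta ->
  f z' x - f z x = (z - z') * (f z x * f z' x).
Proof.
move=> /(nz x) n1 /(nz x) n2; rewrite /f; field; by rewrite n1 n2.
Qed.

Let fle z z' x : complex.Im z <= - eta -> complex.Im z' <= - eta -> N (z' - z) <= delta ->
  N (f z' x) <= 2 * N (f z x).
Proof.
move=> Iz Iz' d; rewrite !Nf.
have l1 := low x Iz; have l2 := low x Iz'.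
have p1 := lt_le_trans eta0 l1; have p2 := lt_le_trans eta0 l2.
rewrite ler_pdivlMr// ler_pdivrMl// mulrC.
have -> : z - x%:C%C = (z' - x%:C%C) - (z' - z) by ring.
apply: le_trans (normcB _ _) _; rewrite mulrDl mul1r lerD2l; apply: le_trans d _; apply: le_trans l2; apply: le_trans de.
by rewrite ler_peMl ?ler1n// ltW.
Qed.

Let Y := \sum_(x <- s) w x * N (f z0 x) ^+ 2.
Let q := eta * Y / 4 + b.

Let Y0 : 0 <= Y.
Proof. by apply: sumr_ge0 => x _; rewrite mulr_ge0// exprn_ge0// normc_ge0. Qed.

Let q0 : 0 < q.
Proof. by rewrite /q ltr_wpDl// divr_ge0// mulr_ge0// ltW. Qed.

Let ginv z : complex.Im z <= - eta -> N (z - z0) <= delta -> q <= N (G z).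
Proof.
move=> Iz d; apply: le_trans (Im_le_normc _); apply: le_trans (ler_norm _).
rewrite /G; have -> : complex.Im (W z + (- a +i* b)%C) = complex.Im (W z) + b by case: (W z).
rewrite lerD2r /W Im_sum /Y mulr_sumr mulr_suml; apply: ler_sum => x _.
have -> : complex.Im ((w x)%:C%C * f z x) = w x * complex.Im (f z x).
  by case: (f z x) => u v /=; rewrite mul0r addr0.
rewrite /f Im_inv -/(f z x).
have -> : complex.Im (z - x%:C%C) = complex.Im z by case: (z) => u v /=; rewrite subr0.
have F : N (f z0 x) <= 2 * N (f z x).
  by apply: fle => //; rewrite -normcN opprB.
have F2 : N (f z0 x) ^+ 2 / 4 <= N (f z x) ^+ 2.
  have := normc_ge0 (f z0 x); have := normc_ge0 (f z x); nra.
have -> : eta * (w x * N (f z0 x) ^+ 2) / 4 = w x * (eta * (N (f z0 x) ^+ 2 / 4)) by ring.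
rewrite ler_wpM2l//.
have n1 := sqr_ge0 (N (f z x)); have n2 := sqr_ge0 (N (f z0 x)).
apply: le_trans (ler_wpM2l (ltW eta0) F2) _; apply: ler_wpM2r => //; lra.
Qed.

Let SB z z' c : (forall x, N (f z x * f z' x) <= c * N (f z0 x) ^+ 2) -> N (S z z') <= c * Y.
Proof.
move=> h; apply: le_trans (normc_sum _ _) _; rewrite mulr_sumr; apply: ler_sum => x _.
by rewrite Normc.normcM normc_real// mulrCA ler_wpM2l.
Qed.

Let WB z z' : complex.Im z <= - eta -> complex.Im z' <= - eta ->
  G z' - G z = (z - z') * S z z'.
Proof.
move=> Iz Iz'; rewrite /G opprD addrACA subrr addr0 /W -sumrB /S mulr_sumr.
by apply: eq_bigr => x _; rewrite -mulrBr fB// mulrCA.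
Qed.

(** With G = W - a + i b, the difference quotient of 1/G between z0 and zi is
- S(z0, zi) / (G(zi) G(z0)), so the quotients in two directions are compared here. The
sum Y of w_x / |z0 - x|^2 bounds S up to a constant, and eta Y / 4 + b bounds |G| from
below near z0. So Y / |G| is at most 4 / eta, and the bound depends neither on the number
of atoms nor on their weights. *)
Lemma resolvent_three_points :
  N (S z0 z1 / G z1 - S z0 z2 / G z2) / N (G z0) <= 288 * delta / (eta ^+ 2 * b).
Proof.
have d00 : N (z0 - z0) <= delta by rewrite subrr Normc.normc0 ltW.
have n0 := ginv I0 d00; have n1 := ginv I1 h1; have n2 := ginv I2 h2.
have f1 x := fle x I0 I1 h1; have f2 x := fle x I0 I2 h2.
have f00 x : N (f z0 x) <= eta^-1.
  by rewrite Nf lef_pV2 ?posrE//; [exact: low|apply: lt_le_trans eta0 _; exact: low].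
have B12 : N (S z1 z2) <= 4 * Y.
  apply: SB => x; rewrite Normc.normcM.
  have := f1 x; have := f2 x; have := normc_ge0 (f z0 x); have := normc_ge0 (f z1 x); have := normc_ge0 (f z2 x); nra.
have B02 : N (S z0 z2) <= 2 * Y.
  apply: SB => x; rewrite Normc.normcM.
  have := f2 x; have := normc_ge0 (f z0 x); have := normc_ge0 (f z2 x); nra.
have BD : N (S z0 z1 - S z0 z2) <= 2 * delta * (4 / eta * Y).
  have -> : S z0 z1 - S z0 z2 = (z2 - z1) * \sum_(x <- s) (w x)%:C%C * (f z0 x * (f z2 x * f z1 x)).
    rewrite /S -sumrB mulr_sumr; apply: eq_bigr => x _.
    by rewrite -mulrBr -mulrBr fB//; ring.
  rewrite Normc.normcM; apply: ler_pM; rewrite ?normc_ge0//.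
    by rewrite -normcN opprB.
  apply: le_trans (normc_sum _ _) _; rewrite mulr_sumr; apply: ler_sum => x _.
  rewrite Normc.normcM normc_real// [leRHS]mulrCA ler_wpM2l// !Normc.normcM.
  have -> : 4 / eta * N (f z0 x) ^+ 2 = eta^-1 * (4 * N (f z0 x) ^+ 2) by ring.
  apply: ler_pM; rewrite ?normc_ge0 ?mulr_ge0 ?normc_ge0//.
  have := f1 x; have := f2 x; have := normc_ge0 (f z0 x); have := normc_ge0 (f z1 x); have := normc_ge0 (f z2 x); nra.
have g1nz : G z1 != 0 by apply/eqP => e; move: (lt_le_trans q0 n1); rewrite e Normc.normc0 ltxx.
have g2nz : G z2 != 0 by apply/eqP => e; move: (lt_le_trans q0 n2); rewrite e Normc.normc0 ltxx.
have E : S z0 z1 / G z1 - S z0 z2 / G z2 = (S z0 z1 - S z0 z2) / G z1 + S z0 z2 * ((z1 - z2) * S z1 z2) / (G z1 * G z2).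
  by rewrite -WB//; field; rewrite g1nz g2nz.
have iv z : q <= N (G z) -> 0 <= N (G z)^-1 <= q^-1.
  move=> h; rewrite normc_ge0 Normc.normcV lef_pV2 ?posrE//; exact: lt_le_trans h.
have /andP[v0 u0] := iv _ n0; have /andP[v1 u1] := iv _ n1; have /andP[v2 u2] := iv _ n2.
have qV : 0 < q^-1 by rewrite invr_gt0.
have r4 : Y * q^-1 <= 4 / eta.
  rewrite ler_pdivrMr// /q; have -> : 4 / eta * (eta * Y / 4 + b) = Y + 4 / eta * b by field; rewrite gt_eqF.
  by rewrite lerDl mulr_ge0 ?divr_ge0// ltW.
have r0 : 0 <= Y * q^-1 by rewrite mulr_ge0// ltW.
have e0 : 0 <= eta^-1 by rewrite invr_ge0 ltW.
apply: (@le_trans _ _ ((32 * delta / eta ^+ 2 + 256 * delta / eta ^+ 2) * q^-1)).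
  (* 32 bounds the difference of the sums S, 256 the difference of the factors 1 / G *)
  rewrite -[(N (G z0))^-1]Normc.normcV; apply: ler_pM; rewrite ?normc_ge0// E.
  apply: le_trans (le_normcD _ _) _; apply: lerD.
    rewrite Normc.normcM; apply: (@le_trans _ _ (2 * delta * (4 / eta * Y) * q^-1)).
      by apply: ler_pM; rewrite ?normc_ge0.
    have -> : 2 * delta * (4 / eta * Y) / q = 8 * delta / eta * (Y * q^-1) by ring.
    have -> : 32 * delta / eta ^+ 2 = 8 * delta / eta * (4 / eta) by rewrite expr2 invfM; ring.
    by rewrite ler_wpM2l// divr_ge0 ?mulr_ge0// ltW.
  rewrite invfM !Normc.normcM.
  apply: (@le_trans _ _ (2 * Y * (2 * delta * (4 * Y)) * (q^-1 * q^-1))).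
    do ![apply: ler_pM; rewrite ?mulr_ge0 ?normc_ge0//].
  have -> : 2 * Y * (2 * delta * (4 * Y)) * (q^-1 * q^-1) = 16 * delta * (Y * q^-1) ^+ 2 by ring.
  have -> : 256 * delta / eta ^+ 2 = 16 * delta * (4 / eta) ^+ 2 by rewrite expr_div_n; ring.
  apply: ler_wpM2l; first by rewrite mulr_ge0// ltW.
  by rewrite ler_pXn2r ?nnegrE// divr_ge0// ltW.
have -> : 288 * delta / (eta ^+ 2 * b) = (32 * delta / eta ^+ 2 + 256 * delta / eta ^+ 2) * b^-1 by rewrite invfM; ring.
rewrite ler_wpM2l//.
  by rewrite -mulrDl divr_ge0 ?sqr_ge0// -mulrDl mulr_ge0// ltW.
by rewrite lef_pV2 ?posrE// /q lerDr divr_ge0// mulr_ge0// ltW.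
Qed.

(** The discrete Cauchy-Riemann equation for 1/G: the increment in the direction - i and
- i times the increment in the direction 1 agree up to second order in delta. *)
Lemma resolvent_CR : z1 - z0 = - 'i%C * delta%:C%C -> z2 - z0 = delta%:C%C ->
  N ((G z1)^-1 - (G z0)^-1 + 'i%C * ((G z2)^-1 - (G z0)^-1)) <= 288 * delta ^+ 2 / (eta ^+ 2 * b).
Proof.
move=> e1 e2.
have d00 : N (z0 - z0) <= delta by rewrite subrr Normc.normc0 ltW.
have nG z : complex.Im z <= - eta -> N (z - z0) <= delta -> G z != 0.
  by move=> Iz d; apply/eqP => e; move: (lt_le_trans q0 (ginv Iz d)); rewrite e Normc.normc0 ltxx.
have g0 := nG _ I0 d00; have g1 := nG _ I1 h1; have g2 := nG _ I2 h2.
have E1 : (G z1)^-1 - (G z0)^-1 = - 'i%C * delta%:C%C * (S z0 z1 / G z1) / G z0.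
  have -> : (G z1)^-1 - (G z0)^-1 = - (G z1 - G z0) / (G z1 * G z0) by field; rewrite g0 g1.
  by rewrite WB// -opprB e1; field; rewrite g0 g1.
have E2 : (G z2)^-1 - (G z0)^-1 = delta%:C%C * (S z0 z2 / G z2) / G z0.
  have -> : (G z2)^-1 - (G z0)^-1 = - (G z2 - G z0) / (G z2 * G z0) by field; rewrite g0 g2.
  by rewrite WB// -opprB e2; field; rewrite g0 g2.
have -> : (G z1)^-1 - (G z0)^-1 + 'i%C * ((G z2)^-1 - (G z0)^-1) =
   - 'i%C * delta%:C%C * ((S z0 z1 / G z1 - S z0 z2 / G z2) / G z0).
  by rewrite E1 E2; ring.
rewrite 2!Normc.normcM normcN normc_real; last exact: ltW.
have -> : N 'i%C = 1 :> R by rewrite /= expr0n add0r expr1n sqrtr1.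
rewrite mul1r Normc.normcM Normc.normcV.
have -> : 288 * delta ^+ 2 / (eta ^+ 2 * b) = delta * (288 * delta / (eta ^+ 2 * b)) by ring.
rewrite ler_pM2l//; exact: resolvent_three_points.
Qed.

End three_points.
End resolvent_step.

(** The real part of 1 / (u - i eta). *)
Definition reK {R : realType} (eta u : R) := u / (u ^+ 2 + eta ^+ 2).

(** The imaginary part of 1 / (u - i eta). *)
Definition imK {R : realType} (eta u : R) := eta / (u ^+ 2 + eta ^+ 2).

(** Minus the imaginary part of 1 / (u - a + i (v + b)). *)
Definition poisson {R : realType} (a b u v : R) := (v + b) / ((u - a) ^+ 2 + (v + b) ^+ 2).

(** The real part of 1 / (u - a + i (v + b)). *)
Definition cpoisson {R : realType} (a b u v : R) := (u - a) / ((u - a) ^+ 2 + (v + b) ^+ 2).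
Definition polesum {R : realType} (s : seq R) (w : R -> R) (k : R -> R -> R) (p eta : R) :=
  \sum_(x <- s) w x * k eta (p - x).

Definition pole_test {R : realType} (k : R -> R -> R -> R -> R) (s : seq R) (w : R -> R) (a b p eta : R) :=
  k a b (polesum s w reK p eta) (polesum s w imK p eta).

Section real_resolvent_step.
Import complex.

(** The imaginary part of [resolvent_CR]: raising the height of the Poisson kernel is
moving the conjugate kernel sideways, up to an error of order delta^2. *)
Lemma poisson_step {R : realType} (s : seq R) (w : R -> R) (a b p eta delta : R) :
  (forall x, 0 <= w x) -> 0 < b -> 0 < eta -> 0 < delta -> 2 * delta <= eta ->
  `|(pole_test poisson s w a b p (eta + delta) - pole_test poisson s w a b p eta) -
    (pole_test cpoisson s w a b (p + delta) eta - pole_test cpoisson s w a b p eta)|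
  <= 288 * delta ^+ 2 / (eta ^+ 2 * b).
Proof.
move=> w0 b0 eta0 delta0 de; rewrite /pole_test.
pose Gf (z : R[i]) := \sum_(x <- s) (w x)%:C%C * (z - x%:C%C)^-1 + (- a +i* b)%C.
have GE q e : (Gf (q -i* e)%C)^-1 = (cpoisson a b (polesum s w reK q e) (polesum s w imK q e) -i* poisson a b (polesum s w reK q e) (polesum s w imK q e))%C.
  have -> : Gf (q -i* e)%C = ((polesum s w reK q e - a) +i* (polesum s w imK q e + b))%C.
    rewrite /Gf.
    have -> : \sum_(x <- s) (w x)%:C%C * ((q -i* e)%C - x%:C%C)^-1 = (polesum s w reK q e +i* polesum s w imK q e)%C.
      apply/eqP; rewrite eq_complex Re_sum Im_sum /polesum; apply/andP; split; apply/eqP; apply: eq_bigr => x _ /=;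
      rewrite /reK /imK subr0 sqrrN; ring.
    by [].
  by [].
have I q e e' : e' <= e -> complex.Im (q -i* e)%C <= - e' :> R by rewrite /= lerN2.
have := @resolvent_CR R s w a b w0 b0 eta delta (p -i* eta)%C (p -i* (eta + delta))%C ((p + delta) -i* eta)%C eta0 delta0 de.
rewrite -/(Gf _) -/(Gf _) -/(Gf _) !GE.
have h1 : (p -i* (eta + delta))%C - (p -i* eta)%C = - 'i%C * delta%:C%C :> R[i].
  by apply/eqP; rewrite eq_complex /=; apply/andP; split; apply/eqP; ring.
have h2 : ((p + delta) -i* eta)%C - (p -i* eta)%C = delta%:C%C :> R[i].
  by apply/eqP; rewrite eq_complex /=; apply/andP; split; apply/eqP; ring.
have h3 : (p -i* (eta + delta))%C - ((p + delta) -i* eta)%C = (- delta -i* delta)%C :> R[i].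
  by apply/eqP; rewrite eq_complex /=; apply/andP; split; apply/eqP; ring.
have Ni : Normc.normc ('i%C : R[i]) = 1 by rewrite /= expr0n add0r expr1n sqrtr1.
move=> /(_ (I _ _ _ (lexx _))) /(_ (I _ _ _ _)) /(_ (I _ _ _ (lexx _))).
rewrite h1 h2 h3 => H.
have {H} : Normc.normc
  ((cpoisson a b (polesum s w reK p (eta + delta)) (polesum s w imK p (eta + delta)) -i*
    poisson a b (polesum s w reK p (eta + delta)) (polesum s w imK p (eta + delta)))%C -
   (cpoisson a b (polesum s w reK p eta) (polesum s w imK p eta) -i*
    poisson a b (polesum s w reK p eta) (polesum s w imK p eta))%C +
   'i%C * ((cpoisson a b (polesum s w reK (p + delta) eta) (polesum s w imK (p + delta) eta) -i*
      poisson a b (polesum s w reK (p + delta) eta) (polesum s w imK (p + delta) eta))%C -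
     (cpoisson a b (polesum s w reK p eta) (polesum s w imK p eta) -i*
      poisson a b (polesum s w reK p eta) (polesum s w imK p eta))%C)) <= 288 * delta ^+ 2 / (eta ^+ 2 * b).
  apply: H => //.
  - lra.
  - by rewrite Normc.normcM normcN Ni mul1r normc_real// ltW.
  - by rewrite normc_real// ltW.
  - apply: ger_normc; first by rewrite mulr_ge0// ltW.
    by rewrite /= sqrrN; nra.
move=> H; apply: le_trans H; apply: le_trans (Im_le_normc _).
rewrite le_eqVlt; apply/orP; left; apply/eqP; rewrite -[LHS]normrN; congr (`|_|) => /=; ring.
Qed.

End real_resolvent_step.

(** * The kernels u / (u^2 + eta^2) and eta / (u^2 + eta^2) *)

Section calculus.
Context {R : realType}.
Implicit Types (eta x u : R).

Lemma sqrD_gt0 eta u : eta != 0 -> 0 < u ^+ 2 + eta ^+ 2.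
Proof. by move=> e0; rewrite ltr_wpDl ?sqr_ge0// exprn_even_gt0. Qed.

Lemma is_derive_sqrD eta u : is_derive u 1 (fun x => x ^+ 2 + eta ^+ 2) (2 * u).
Proof.
have h := is_deriveD (@is_deriveX _ _ (@id R) 2 u 1 1 (is_derive_id _ _)) (is_derive_cst (eta ^+ 2) u 1).
by apply: (is_derive_eq h); rewrite /GRing.scale/=; ring.
Qed.

Definition dreK eta u := (eta ^+ 2 - u ^+ 2) / (u ^+ 2 + eta ^+ 2) ^+ 2.
Definition dimK eta u := - (2 * eta * u) / (u ^+ 2 + eta ^+ 2) ^+ 2.

Lemma is_derive_reK eta u : eta != 0 -> is_derive u 1 (reK eta) (dreK eta u).
Proof.
move=> e0; have n0 := sqrD_gt0 u e0.
have h1 := is_derive_sqrD eta u.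
have h2 := @is_deriveV _ (fun x => x ^+ 2 + eta ^+ 2) u _ 1 (lt0r_neq0 n0) h1.
have := @is_deriveM _ _ (@id R) _ u 1 _ _ (is_derive_id _ _) h2.
move=> h; apply: (is_derive_eq h); rewrite /dreK /GRing.scale/=; field; exact: lt0r_neq0.
Qed.

Lemma is_derive_imK eta u : eta != 0 -> is_derive u 1 (imK eta) (dimK eta u).
Proof.
move=> e0; have n0 := sqrD_gt0 u e0.
have h1 := is_derive_sqrD eta u.
have h2 := @is_deriveV _ (fun x => x ^+ 2 + eta ^+ 2) u _ 1 (lt0r_neq0 n0) h1.
have := @is_deriveM _ _ (@cst R R eta) _ u 1 _ _ (is_derive_cst _ _ _) h2.
move=> h; apply: (is_derive_eq h); rewrite /dimK /GRing.scale/=; field; exact: lt0r_neq0.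
Qed.

Lemma is_derive_inv u : u != 0 -> is_derive u 1 (fun x => x^-1) (- u ^- 2).
Proof.
move=> u0; have h := @is_deriveV _ (@id R) u _ 1 u0 (is_derive_id _ _).
by apply: (is_derive_eq h); rewrite /GRing.scale/= mulr1.
Qed.

Lemma continuous_sqrDV eta : eta != 0 -> continuous (fun u => (u ^+ 2 + eta ^+ 2)^-1).
Proof.
move=> e0 u; apply: cvgV; first by rewrite lt0r_neq0// sqrD_gt0.
by apply: cvgD; [exact: exprn_continuous|exact: cvg_cst].
Qed.

Lemma continuous_reK eta : eta != 0 -> continuous (reK eta).
Proof. by move=> e0 u; apply: cvgM; [exact: cvg_id|exact: continuous_sqrDV]. Qed.

Lemma continuous_dreK eta : eta != 0 -> continuous (dreK eta).
Proof.
move=> e0 u; rewrite /dreK.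
have -> : (fun u => (eta ^+ 2 - u ^+ 2) / (u ^+ 2 + eta ^+ 2) ^+ 2) =
   (fun u => (eta ^+ 2 - u ^+ 2) * ((u ^+ 2 + eta ^+ 2)^-1 * (u ^+ 2 + eta ^+ 2)^-1)).
  by apply/funext => v; rewrite expr2 invfM.
apply: cvgM; first by apply: cvgB; [exact: cvg_cst|exact: exprn_continuous].
by apply: cvgM; exact: continuous_sqrDV.
Qed.

Lemma continuous_dimK eta : eta != 0 -> continuous (dimK eta).
Proof.
move=> e0 u; rewrite /dimK.
have -> : (fun u => - (2 * eta * u) / (u ^+ 2 + eta ^+ 2) ^+ 2) =
   (fun u => - (2 * eta * u) * ((u ^+ 2 + eta ^+ 2)^-1 * (u ^+ 2 + eta ^+ 2)^-1)).
  by apply/funext => v; rewrite expr2 invfM.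
apply: cvgM; first by apply: cvgN; apply: cvgM; [exact: cvg_cst|exact: cvg_id].
by apply: cvgM; exact: continuous_sqrDV.
Qed.

Lemma dreK_le eta u : eta != 0 -> `|dreK eta u| <= (u ^+ 2 + eta ^+ 2)^-1.
Proof.
move=> e0; have n0 := sqrD_gt0 u e0.
rewrite /dreK normrM normfV (ger0_norm (exprn_ge0 _ (ltW n0))) expr2 invfM mulrA ler_piMl ?invr_ge0 ?(ltW n0)//.
rewrite ler_pdivrMr// mul1r ler_norml; have := sqr_ge0 u; have := sqr_ge0 eta; move=> h1 h2.
by apply/andP; split; lra.
Qed.

Lemma dimK_le eta u : eta != 0 -> `|dimK eta u| <= (u ^+ 2 + eta ^+ 2)^-1.
Proof.
move=> e0; have n0 := sqrD_gt0 u e0.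
rewrite /dimK normrM normfV (ger0_norm (exprn_ge0 _ (ltW n0))) expr2 invfM mulrA ler_piMl ?invr_ge0 ?(ltW n0)//.
rewrite ler_pdivrMr// mul1r normrN ler_norml.
have := sqr_ge0 (u - eta); have := sqr_ge0 (u + eta); rewrite sqrrB sqrrD => h1 h2.
by apply/andP; split; nra.
Qed.

Lemma reK_le eta u : 0 < u -> `|reK eta u| <= u^-1.
Proof.
move=> u0; have n0 : 0 < u ^+ 2 + eta ^+ 2 by rewrite ltr_pwDl ?exprn_gt0// sqr_ge0.
rewrite /reK normrM normfV (ger0_norm (ltW u0)) (ger0_norm (ltW n0)).
by rewrite ler_pdivrMr// ler_pdivlMl// -expr2 lerDl sqr_ge0.
Qed.

Lemma imK_le eta u : 0 < u -> `|imK eta u| <= u^-1.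
Proof.
move=> u0; rewrite /imK normrM normfV (ger0_norm (_ : 0 <= u ^+ 2 + eta ^+ 2)) ?addr_ge0 ?sqr_ge0//.
have n0 : 0 < u ^+ 2 + eta ^+ 2 by rewrite ltr_pwDl ?exprn_gt0// sqr_ge0.
rewrite ler_pdivrMr// ler_pdivlMl// -(real_normK (num_real eta)).
have := sqr_ge0 (u - `|eta|); rewrite sqrrB; have := normr_ge0 eta; nra.
Qed.

Lemma reK0 u : reK 0 u = u^-1.
Proof.
rewrite /reK expr0n addr0; have [->|u0] := eqVneq u 0; first by rewrite mul0r invr0.
by field.
Qed.

Lemma imK0 u : imK 0 u = 0.
Proof. by rewrite /imK mul0r. Qed.

Lemma measurable_inv : measurable_fun [set: R] (fun x : R => x^-1).
Proof.
apply: (@measurable_fun_cvg _ _ _ setT (fun n x => reK n.+1%:R^-1 x)) => [n|x _].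
  by apply: continuous_measurable_fun; apply: continuous_reK; rewrite invr_neq0.
have [->|x0] := eqVneq x 0.
  have -> : (fun n => reK n.+1%:R^-1 (0:R)) = (fun n => 0).
    by apply/funext => n; rewrite /reK mul0r.
  by rewrite invr0; exact: cvg_cst.
rewrite -reK0 /reK; apply: cvgM; first exact: cvg_cst.
apply: cvgV; first by rewrite expr0n addr0 expf_neq0.
apply: cvgD; first exact: cvg_cst.
apply: (@cvg_comp _ _ _ (fun n : nat => n.+1%:R^-1 : R) (fun x => x ^+ 2) _ (nbhs (0:R))).
  exact: cvg_harmonic.
exact: exprn_continuous.
Qed.

Lemma measurable_reK eta : measurable_fun [set: R] (reK eta).
Proof.
by apply: measurable_funM => //; apply: measurableT_comp measurable_inv _; apply: measurable_funD.
Qed.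

Lemma measurable_imK eta : measurable_fun [set: R] (imK eta).
Proof.
by apply: measurable_funM => //; apply: measurableT_comp measurable_inv _; apply: measurable_funD.
Qed.

(** As B grows, both half-lines together give twice pi / 2: this is where the constant pi
in the Cauchy scale comes from. *)
Lemma parts_cst_imK eta B : 0 < eta -> 0 < B -> parts_cst (imK eta) (dimK eta) 0 B = atan (B / eta).
Proof.
move=> e0 B0; have en := lt0r_neq0 e0.
pose Phi y := y * imK eta y - atan (y / eta).
have dPhi (y : R) : is_derive y 1 Phi (y * dimK eta y).
  have h1 := @is_deriveM _ _ (@id R) _ y 1 _ _ (is_derive_id _ _) (is_derive_imK y en).
  have h3 : is_derive y 1 (fun y : R => y / eta) eta^-1.
    have := @is_deriveM _ _ (@id R) (cst eta^-1) y 1 _ _ (is_derive_id _ _) (is_derive_cst _ _ _).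
    by move=> h; apply: (is_derive_eq h); rewrite /GRing.scale/= mulr0 add0r mulr1.
  have h2 := @is_derive1_comp _ atan (fun y : R => y / eta) y _ _ (is_derive1_atan _) h3.
  have := is_deriveB h1 h2; move=> h; apply: (is_derive_eq h).
  have n0 := lt0r_neq0 (sqrD_gt0 y en).
  rewrite /GRing.scale/= /imK /dimK; field; by rewrite en n0.
have cf : continuous (fun y : R => y * dimK eta y).
  by move=> y; apply: cvgM; [exact: cvg_id|exact: continuous_dimK].
rewrite /parts_cst /Rintegral (@continuous_FTC2 _ _ Phi)//.
- by rewrite /Phi /= !mul0r atan0; lra.
- exact: continuous_subspaceT.
- have cP : continuous Phi.
    move=> y; apply: differentiable_continuous; apply/derivable1_diffP; exact: ex_derive.
  split.
  + by move=> y _; apply: ex_derive; exact: dPhi.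
  + apply: cvg_at_right_filter; exact: cP.
  + apply: cvg_at_left_filter; exact: cP.
- by move=> y _; rewrite derive1E; apply: derive_val; exact: dPhi.
Qed.

End calculus.

(** * Tails of convergent integrals and sublinearity *)

Section tails.
Context {R : realType}.
Notation leb := (@lebesgue_measure R).

(** The sublevel sets of N exhaust D. *)
Lemma tail_integral d (X : measurableType d) (m : {measure set X -> \bar R}) (N : X -> R) (D : set X) (f : X -> \bar R) :
  measurable_fun [set: X] N ->
  measurable D -> measurable_fun D f -> (forall x, D x -> (0 <= f x)%E) ->
  (\int[m]_(x in D) f x < +oo)%E ->
  forall e : R, 0 < e -> exists A0 : R, forall A : R, A0 <= A ->
    (\int[m]_(x in D `&` [set x | (A <= N x)%R]) f x <= e%:E)%E.
Proof.
move=> mN mD mf f0 fi e e0.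
pose E (n : nat) := D `&` [set x | N x < n%:R].
have mn (A : R) : measurable [set x | N x < A].
  rewrite (_ : [set x | _] = N @^-1` `]-oo, A[); last by apply/seteqP; split => x /=; rewrite in_itv.
  by rewrite -[X in measurable X]setTI; exact: mN.
have mn' (A : R) : measurable [set x | A <= N x].
  rewrite (_ : [set x | _] = N @^-1` `[A, +oo[); last by apply/seteqP; split => x /=; rewrite in_itv/= andbT.
  by rewrite -[X in measurable X]setTI; exact: mN.
have mE n : measurable (E n) by exact: measurableI.
have affine_meanE : \bigcup_n E n = D.
  apply/seteqP; split => [x [n _ []]//|x Dx]; exists (Num.bound `|N x|) => //; split => //=.
  by apply: le_lt_trans (ler_norm _) _; exact: archi_boundP.
have := @ge0_nondecreasing_set_cvg_integral _ _ _ E f m.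
rewrite affine_meanE => h.
have {h} cv : (\int[m]_(x in E i) f x)%E @[i --> \oo] --> (\int[m]_(x in D) f x)%E.
  apply: h => //.
  - move=> n k nk; apply/subsetPset => x [Dx /= xn]; split => //=; apply: lt_le_trans xn _.
    by rewrite ler_nat.
  - by move=> i; apply: measurable_funS mf => // x [].
  - by move=> i x [Dx _]; exact: f0.
have fin : (\int[m]_(x in D) f x)%E \is a fin_num by rewrite ge0_fin_numE//; exact: integral_ge0.
move: cv; rewrite -(fineK fin) => /fine_cvgP[finE /cvgr_dist_le/(_ e e0) [k _ HN]].
have [N' _ HN'] := finE.
pose n := maxn k N'.
exists n%:R => A An.
have hn : `|fine (\int[m]_(x in D) f x)%E - fine (\int[m]_(x in E n) f x)%E| <= e.
  by apply: HN => /=; exact: leq_maxl.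
have fn : (\int[m]_(x in E n) f x)%E \is a fin_num by apply: HN' => /=; exact: leq_maxr.
pose F := D `&` [set x | n%:R <= N x].
have mF : measurable F by exact: measurableI.
have split_int : (\int[m]_(x in D) f x = \int[m]_(x in E n) f x + \int[m]_(x in F) f x)%E.
  have {1}-> : D = E n `|` F.
    apply/seteqP; split => [x Dx|x [[]|[]]//].
    by have [h|h] := ltP (N x) n%:R; [left|right].
  rewrite ge0_integral_setU//.
  - by apply: measurable_funS mf => // x [[]|[]].
  - by move=> x [[]|[]] + _; exact: f0.
  - by apply/disj_setPS => x [[_ /= h1] [_ /= h2]]; move: (lt_le_trans h1 h2); rewrite ltxx.
apply: (@le_trans _ _ (\int[m]_(x in F) f x)%E).
  apply: ge0_subset_integral => //.
  - exact: measurableI.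
  - by apply: measurable_funS mf => // x [].
  - by move=> x [Dx _]; exact: f0.
  - by move=> x [Dx /= h]; split => //=; apply: le_trans h.
have fF : (\int[m]_(x in F) f x)%E \is a fin_num.
  move: fin; rewrite split_int fin_numD => /andP[]//.
move: hn; rewrite split_int fineD// addrAC subrr add0r => hn.
rewrite -(fineK fF) lee_fin; apply: le_trans hn; exact: ler_norm.
Qed.

(** If f(x) > e x then, because f cannot drop fast on one side of x, it exceeds e x / 2 on
an interval of length proportional to x near x. This interval contributes a fixed
amount to the integral of f(y) / y^2, which a tail cannot do. *)
Lemma quasi_sublinear (f : R -> R) (c c' : R) : 0 < c -> 0 <= c' ->
  measurable_fun (`[1, +oo[ : set R) f -> (forall x, 1 <= x -> 0 <= f x) ->
  (forall x, 2 <= x -> (forall y, x <= y <= 2 * x -> f x <= f y + c * (y - x) + c') \/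
                       (forall y, x / 2 <= y <= x -> f x <= f y + c * (x - y) + c')) ->
  (\int[leb]_(y in `[1%R, +oo[) (f y * y ^- 2)%:E < +oo)%E ->
  forall e, 0 < e -> exists A0 : R, 1 <= A0 /\ forall x, A0 <= x -> f x <= e * x.
Proof.
move=> c0 c'0 mf f0 q fi e e0.
(* rho x is the length over which f stays above e x / 2 *)
pose rho := Num.min (2^-1) (e / (4 * c)).
have rho0 : 0 < rho by rewrite lt_min invr_gt0 ltr0n/= divr_gt0// mulr_gt0.
have rho2 : rho <= 2^-1 by rewrite ge_min lexx.
have rhoc : c * rho <= e / 4.
  have : rho <= e / (4 * c) by rewrite ge_min lexx orbT.
  rewrite -(ler_pM2l c0) => /le_trans; apply; rewrite le_eqVlt; apply/orP; left; apply/eqP.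
  by field; exact: lt0r_neq0.
have mF : measurable_fun (`[1, +oo[ : set R) (fun y => (f y * y ^- 2)%:E).
  apply/measurable_EFinP; apply: measurable_funM => //.
  by apply: measurable_funTS; apply: measurableT_comp (measurable_inv) _.
have F0 (y : R) : `[1, +oo[%classic y -> (0 <= (f y * y ^- 2)%:E)%E.
  rewrite /= in_itv/= andbT => y1; rewrite lee_fin mulr_ge0 ?f0// invr_ge0 exprn_ge0//; lra.
have er0 : 0 < e * rho / 16 by rewrite divr_gt0// mulr_gt0.
have [A0 HA0] := @tail_integral _ _ leb (fun y => `|y|) `[1, +oo[ _ (@normr_measurable _ _) (measurable_itv _) mF F0 fi _ er0.
(* beyond 4 c' / e the constant c' is at most e x / 4 *)
exists (Num.max (Num.max 2 (2 * A0)) (4 * c' / e)); split.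
  by rewrite !le_max; apply/orP; left; apply/orP; left; lra.
move=> x; rewrite !ge_max => /andP[/andP[x2 xA0] xc'].
have x0 : 0 < x by lra.
have ce : c' <= e * x / 4.
  move: xc'; rewrite ler_pdivrMr// => h; lra.
rewrite leNgt; apply/negP => fx.
have [J [mJ lJ JP]] : exists J : set R, [/\ measurable J, (leb J = (rho * x)%:E)%E &
   forall y, J y -> x / 2 <= y <= 2 * x /\ e * x / 2 <= f y].
  have rx : 0 < rho * x by rewrite mulr_gt0.
  have rx2 : rho * x <= 2^-1 * x by rewrite ler_pM2r.
  have crx : c * (rho * x) <= e / 4 * x by rewrite mulrA ler_pM2r.
  case: (q x x2) => H.
  - exists `[x, x + rho * x]%classic; split; first exact: measurable_itv.
    + by rewrite lebesgue_measure_itv/= lte_fin ltrDl rx -EFinB addrAC subrr add0r.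
    + move=> y; rewrite /= in_itv/= => /andP[h1 h2]; split; first by apply/andP; split; lra.
      have := H y; rewrite h1/= => /(_ _)/wrap[]; first lra.
      move=> h; have : c * (y - x) <= c * (rho * x) by rewrite ler_pM2l//; lra.
      lra.
  - exists `[x - rho * x, x]%classic; split; first exact: measurable_itv.
    + by rewrite lebesgue_measure_itv/= lte_fin gtrBl rx -EFinB opprB addrCA subrr addr0.
    + move=> y; rewrite /= in_itv/= => /andP[h1 h2]; split; first by apply/andP; split; lra.
      have := H y; rewrite h2 andbT => /(_ _)/wrap[]; first lra.
      move=> h; have : c * (x - y) <= c * (rho * x) by rewrite ler_pM2l//; lra.
      lra.
have sub : J `<=` `[1, +oo[ `&` [set y | x / 2 <= `|y|].
  move=> y /JP[/andP[h1 h2] _]; split; first by rewrite /= in_itv/= andbT; lra.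
  by rewrite /= ger0_norm//; lra.
have h1 : (\int[leb]_(y in J) (f y * y ^- 2)%:E <= (e * rho / 16)%:E)%E.
  apply: le_trans (HA0 (x / 2) _); last lra.
  apply: ge0_subset_integral => //.
  - apply: measurableI => //.
    rewrite (_ : [set y : R | _] = ~` `]- (x / 2), x / 2[%classic); first exact: measurableC.
    by apply/seteqP; split => y /=; rewrite in_itv/= -ltr_norml leNgt => /negP.
  - by apply: measurable_funS mF => // y [].
  - by move=> y [h _]; exact: F0.
have h2 : ((e / (8 * x))%:E * (rho * x)%:E <= \int[leb]_(y in J) (f y * y ^- 2)%:E)%E.
  rewrite -lJ -integral_cst//; apply: ge0_le_integral => //.
  - by move=> y _; rewrite lee_fin divr_ge0 ?mulr_ge0//; lra.
  - by apply: measurable_funS mF => // y /sub[].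
  - move=> y /JP[/andP[y1 y2] fy]; rewrite lee_fin.
    have y0 : 0 < y by lra.
    apply: (@le_trans _ _ (e * x / 2 * (2 * x) ^- 2)).
      rewrite le_eqVlt; apply/orP; left; apply/eqP; field; exact: lt0r_neq0.
    apply: ler_pM => //; first by rewrite divr_ge0// mulr_ge0// ltW.
      by rewrite invr_ge0 exprn_ge0//; lra.
    by rewrite lef_pV2 ?posrE ?exprn_gt0//; [rewrite ler_pXn2r ?nnegrE//; lra|lra].
have := le_trans h2 h1; rewrite -EFinM lee_fin.
have -> : e / (8 * x) * (rho * x) = e * rho / 8 by field; exact: lt0r_neq0.
have := mulr_gt0 e0 rho0; lra.
Qed.

End tails.

(** * Measurability of the principal value *)

Section cauchy_criterion.
Context {R : realType}.

Definition cauchy_at_infty (F : R -> R) :=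
  forall e, 0 < e -> exists A0, forall A B, A0 <= A -> A <= B -> `|F B - F A| <= e.

Lemma cauchy_at_inftyP (F : R -> R) : cvg (F A @[A --> +oo]) <-> cauchy_at_infty F.
Proof.
split => [/cvgrPdist_le h e e0|h].
  have e2 : 0 < e / 2 by rewrite divr_gt0.
  have [A0 [_ HA0]] := h _ e2.
  exists (A0 + 1) => A B A0A AB.
  have hA := HA0 A; have hB := HA0 B.
  set l := lim _ in hA hB.
  have -> : F B - F A = (l - F A) - (l - F B) by ring.
  apply: le_trans (ler_normB _ _) _.
  have := hA ltac:(lra); have := hB ltac:(lra); lra.
apply: cauchy_cvg; apply: cauchy_exP => e e0.
have e2 : 0 < e / 2 by rewrite divr_gt0.
have [A0 HA0] := h _ e2; exists (F A0).
exists A0; split; first exact: num_real.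
move=> B A0B /=; rewrite /ball/= distrC; apply: le_lt_trans (HA0 _ _ (lexx _) (ltW A0B)) _; lra.
Qed.

Lemma cvg_at_infty_nat (F : R -> R) : cvg (F A @[A --> +oo]) -> F n%:R @[n --> \oo] --> lim (F A @[A --> +oo]).
Proof.
move=> h; apply: (@cvg_comp _ _ _ (fun n : nat => n%:R : R) F \oo (pinfty_nbhs R) _ _ h).
exact: cvgr_idn.
Qed.

End cauchy_criterion.

Lemma countable_bigcapT_measurable d (T : measurableType d) (U : countType) (F : U -> set T) :
  (forall i, measurable (F i)) -> measurable (\bigcap_i F i).
Proof.
move=> mF; rewrite -[X in measurable X]setCK setC_bigcap; apply: measurableC.
by apply: countable_bigcupT_measurable => // i; exact: measurableC.
Qed.

Section principal_value_measurable.
Context {R : realType}.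
Notation VB := (vague_borel R).

Lemma measurable_pole (s : R) : measurable_fun [set: R] (fun x : R => (s - x)^-1).
Proof. by apply: measurableT_comp measurable_inv _; exact: measurable_funB. Qed.

Lemma measurable_F_trunc (A s : R) : measurable_fun [set: VB] (fun mu : VB => F_trunc (mu : wpm R) A s).
Proof. by apply: measurable_mu_Rintegral => //; apply: measurable_funTS; exact: measurable_pole. Qed.

Lemma F_trunc_right (mu : wpm R) (A s : R) : 0 <= A ->
  exists2 e, 0 < e & forall B, A <= B < A + e -> F_trunc mu B s = F_trunc mu A s.
Proof.
move=> A0; have [e e0 he] := right_gap mu A0; exists e => // B AB.
apply/eqP; rewrite -subr_eq0 /F_trunc window_sub ?A0; [|exact: measurable_pole|by case/andP: AB].
by rewrite !integral_ray0 ?addr0//; [exact: measurable_pole|exact: he|exact: measurable_pole|exact: he].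
Qed.

Definition osc (mu : wpm R) (s : R) (p q : rat) : R := `|F_trunc mu (ratr q) s - F_trunc mu (ratr p) s|.

(** Right-continuity in the radius reduces Cauchy's criterion to rational radii. *)
Lemma cvg_F_truncP (mu : wpm R) (s : R) : cvg (F_trunc mu A s @[A --> +oo]) <->
  forall k : nat, exists n : nat, forall p q : rat, (n%:R <= p <= q) -> osc mu s p q <= k.+1%:R^-1.
Proof.
split => [/cauchy_at_inftyP h k|h].
  have k0 : 0 < k.+1%:R^-1 :> R by rewrite invr_gt0.
  have [A0 HA0] := h _ k0; exists (Num.bound `|A0|) => p q /andP[np pq].
  apply: HA0; last by rewrite ler_rat.
  apply: (@le_trans _ _ (Num.bound `|A0|)%:R).
    by apply: le_trans (ler_norm _) _; apply: ltW; exact: archi_boundP.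
  by rewrite -(ratr_nat R) ler_rat.
apply/cauchy_at_inftyP => e e0.
pose k := Num.bound e^-1.
have ke : k.+1%:R^-1 <= e.
  rewrite -[leRHS]invrK lef_pV2 ?posrE ?invr_gt0//.
  apply: (@le_trans _ _ k%:R); last by rewrite ler_nat.
  by apply: ltW; apply: archi_boundP; rewrite invr_ge0 ltW.
have [n Hn] := h k; exists n%:R => A B nA AB.
have A0 : 0 <= A by apply: le_trans nA.
have B0 : 0 <= B by lra.
have [eA eA0 HA] := F_trunc_right mu s A0.
have [eB eB0 HB] := F_trunc_right mu s B0.
have [|q qB] := @rat_in_itvoo R B (B + eB); first by rewrite ltrDl.
have [|p pA] := @rat_in_itvoo R A (Num.min (A + eA) (ratr q)).
  rewrite lt_min ltrDl eA0/=; apply: le_lt_trans AB _; by move: qB; rewrite in_itv/= => /andP[].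
move: qB pA; rewrite !in_itv/= lt_min => /andP[q1 q2] /and3P[p1 p2 p3].
rewrite -(HB (ratr q)) ?(ltW q1)// -(HA (ratr p)) ?(ltW p1)//.
apply: le_trans ke; apply: Hn; apply/andP; split; last by rewrite -(ler_rat R) ltW.
by rewrite -(ler_rat R) ratr_nat; apply: le_trans nA (ltW p1).
Qed.

Lemma measurable_cvg_F_trunc (s : R) : measurable [set mu : VB | cvg (F_trunc (mu : wpm R) A s @[A --> +oo])].
Proof.
have -> : [set mu : VB | cvg (F_trunc (mu : wpm R) A s @[A --> +oo])] =
  \bigcap_(k : nat) \bigcup_(n : nat) \bigcap_(p : rat) \bigcap_(q : rat)
     [set mu : VB | (n%:R <= p <= q) ==> (osc (mu : wpm R) s p q <= k.+1%:R^-1)].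
  apply/seteqP; split => mu /=.
    move=> /cvg_F_truncP h k _; have [n Hn] := h k; exists n => // p _ q _ /=; apply/implyP; exact: Hn.
  move=> h; apply/cvg_F_truncP => k; have [n _ Hn] := h k I; exists n => p q pq.
  by have := Hn p I q I; move=> /= /implyP; apply.
apply: bigcapT_measurable => k; apply: bigcupT_measurable => n.
apply: countable_bigcapT_measurable => // p; apply: countable_bigcapT_measurable => // q.
have [pq|pq] := boolP (n%:R <= p <= q); last first.
  by rewrite (_ : [set mu : VB | _] = setT)//; apply/seteqP; split => mu.
rewrite (_ : [set mu : VB | _] = (fun mu : VB => osc (mu : wpm R) s p q) @^-1` `]-oo, k.+1%:R^-1]); last first.
  by apply/seteqP; split => mu /=; rewrite in_itv/=.
rewrite -[X in measurable X]setTI.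
have mosc : measurable_fun [set: VB] (fun mu : VB => osc (mu : wpm R) s p q).
  by apply: measurableT_comp => //; apply: measurable_funB; exact: measurable_F_trunc.
exact: mosc.
Qed.

(** Where the limit does not exist, F_pv has a fixed value, so F_pv is a limit of measurable
functions on the whole space. *)
Lemma measurable_F_pv (s : R) : measurable_fun [set: VB] (fun mu : VB => F_pv (mu : wpm R) s).
Proof.
pose C := [set mu : VB | cvg (F_trunc (mu : wpm R) A s @[A --> +oo])].
(* [lim] returns [point] off C *)
pose h (n : nat) (mu : VB) : R := \1_C mu * F_trunc (mu : wpm R) n%:R s + (1 - \1_C mu) * (point : R).
apply: (@measurable_fun_cvg _ _ _ setT h) => [n|mu _].
  have mC : measurable_fun [set: VB] (\1_C : VB -> R) by apply: measurable_indic; exact: measurable_cvg_F_trunc.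
  apply: measurable_funD; apply: measurable_funM => //; first exact: measurable_F_trunc.
  exact: measurable_funB.
have [c|nc] := pselect (C mu).
  have -> : (fun n => h n mu) = (fun n => F_trunc (mu : wpm R) n%:R s).
    by apply/funext => n; rewrite /h indicE mem_set// mul1r subrr mul0r addr0.
  exact: cvg_at_infty_nat.
have -> : (fun n => h n mu) = (fun n => (point : R)).
  by apply/funext => n; rewrite /h indicE memNset// mul0r subr0 mul1r add0r.
by rewrite /F_pv dvgP//; exact: cvg_cst.
Qed.

End principal_value_measurable.

(** * Sublinearity of the discrepancy and existence of the principal value at 0 *)

Section envelope_estimates.
Context d (T : measurableType d) (R : realType) (P : probability T R).
Variables (M : {RV P >-> vague_borel R}) (K : R).
Hypotheses (K0 : 0 < K) (stM : stationary M) (intM : intensity M = K%:E).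
Notation VB := (vague_borel R).
Notation leb := (@lebesgue_measure R).
Local Notation Mw w := (M w : wpm R).
Local Notation g := (discrepancy M K).
Hypothesis gint : (\int[leb]_(y in `[1%R, +oo[) (g y * (y ^- 2)%:E) < +oo)%E.

Lemma g_fin x : 0 <= x -> g x \is a fin_num.
Proof.
move=> x0; rewrite ge0_fin_numE ?discrepancy_ge0//.
exact: le_lt_trans (discrepancy_bound K0 stM intM x0) (ltry _).
Qed.

Let gf x := fine (g x).
Let gfE x : 0 <= x -> g x = (gf x)%:E.
Proof. by move=> x0; rewrite fineK// g_fin. Qed.

Lemma sqrV_measurable (D : set R) : measurable_fun D (fun y : R => y ^- 2).
Proof. by apply: measurable_funTS; apply: measurableT_comp measurable_inv _. Qed.

Lemma measurable_g_tail : measurable_fun (`[1, +oo[%classic : set R) (fun y => (g y * (y ^- 2)%:E)%E).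
Proof.
apply: emeasurable_funM.
  apply: measurable_discrepancy; first exact: measurable_itv.
  by move=> x /=; rewrite !in_itv/= !andbT; lra.
by apply/measurable_EFinP; exact: sqrV_measurable.
Qed.

Lemma g_tail_ge0 y : 1 <= y -> (0 <= g y * (y ^- 2)%:E)%E.
Proof.
move=> y1; rewrite mule_ge0 ?discrepancy_ge0// lee_fin invr_ge0 exprn_ge0//; lra.
Qed.

Lemma g_sublinear e : 0 < e -> exists A0 : R, 1 <= A0 /\ forall x, A0 <= x -> gf x <= e * x.
Proof.
move: e; have K2 : 0 < 2 * K by rewrite mulr_gt0.
apply: (@quasi_sublinear R gf (2 * K) (2 * K) K2 (ltW K2)).
- apply: measurableT_comp => //; apply: measurable_discrepancy; first exact: measurable_itv.
  by move=> x /=; rewrite !in_itv/= !andbT; lra.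
- by move=> x _; rewrite fine_ge0// discrepancy_ge0.
- move=> x x2; left => y /andP[xy _].
  have x0 : 0 <= x by lra. have y0 : 0 <= y by lra.
  have := @discrepancy_quasi _ _ _ _ M K K0 stM intM x y; rewrite x0 xy => /(_ isT).
  by rewrite !gfE// -EFinD lee_fin => /le_trans; apply; lra.
- move: gint; congr (_ < _)%E; apply: eq_integral => y; rewrite inE/= in_itv/= andbT => y1.
  by rewrite gfE//; lra.
Qed.

Lemma g_tail e : 0 < e -> exists A0 : R, 1 <= A0 /\ forall A, A0 <= A ->
  (\int[leb]_(y in `[A, +oo[) (g y * (y ^- 2)%:E) <= e%:E)%E.
Proof.
move=> e0.
have g0 (y : R) : `[1, +oo[%classic y -> (0 <= g y * (y ^- 2)%:E)%E.
  by rewrite /= in_itv/= andbT; exact: g_tail_ge0.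
have [A0 HA0] := @tail_integral _ _ _ leb (fun y => `|y|) `[1, +oo[ _ (@normr_measurable _ _) (measurable_itv _) measurable_g_tail g0 gint _ e0.
exists (Num.max 1 A0); split; first by rewrite le_max lexx.
move=> A; rewrite ge_max => /andP[A1 /HA0].
have -> // : `[1, +oo[ `&` [set x : R | A <= `|x|] = `[A, +oo[%classic.
apply/seteqP; split => x /=.
  by rewrite !in_itv/= !andbT => -[x1]; rewrite ger0_norm//; lra.
rewrite !in_itv/= !andbT => Ax; have x1 : 1 <= x by lra.
by rewrite ger0_norm//; lra.
Qed.

Lemma tail_bound_cvg0 : tail_bound g A @[A --> +oo] --> 0%E.
Proof.
have tb0 A : 1 <= A -> (0 <= tail_bound g A)%E.
  move=> A1; rewrite /tail_bound adde_ge0//.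
    by rewrite !mule_ge0 ?discrepancy_ge0// lee_fin invr_ge0; lra.
  rewrite mule_ge0//; apply: integral_ge0 => y; rewrite /= in_itv/= andbT => Ay; apply: g_tail_ge0; lra.
have bnd e : 0 < e -> \forall A \near +oo, (0 <= tail_bound g A <= e%:E)%E.
  move=> e0; have e4 : 0 < e / 4 by rewrite divr_gt0.
  have [A1 [A11 H1]] := g_sublinear e4; have [A2 [A21 H2]] := g_tail e4.
  exists (Num.max A1 A2); split; first exact: num_real.
  move=> A; rewrite gt_max => /andP[h1 h2].
  have A0 : 0 < A by lra.
  rewrite tb0/=; last lra.
  rewrite /tail_bound (_ : e%:E = 2%:E * (e / 4)%:E + 2%:E * (e / 4)%:E)%E; last first.
    by rewrite -!EFinM -EFinD; congr EFin; field.
  apply: leeD.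
    rewrite -muleA lee_pmul2l// gfE; last exact: ltW.
    rewrite -EFinM lee_fin ler_pdivrMr//; apply: H1; exact: ltW.
  rewrite lee_pmul2l//; apply: H2; exact: ltW.
apply/fine_cvgP; split.
  have := bnd 1 ltr01; apply: filterS => A /andP[h1 h2].
  by rewrite ge0_fin_numE// (le_lt_trans h2) ?ltry.
apply/cvgrPdist_le => e e0; have := bnd e e0; apply: filterS => A /andP[h1 h2].
have fin : tail_bound g A \is a fin_num by rewrite ge0_fin_numE// (le_lt_trans h2) ?ltry.
rewrite sub0r normrN /= ger0_norm ?fine_ge0//.
by rewrite -lee_fin fineK.
Qed.
Definition disc_integrable (mu : wpm R) := forall b,
  (\int[leb]_(y in `[1%R, +oo[) (`|disc mu b K y| * y ^- 2)%:E < +oo)%E.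

Lemma disc_tail_ge0 (mu : wpm R) b : (0 <= \int[leb]_(y in `[1%R, +oo[) (`|disc mu b K y| * y ^- 2)%:E)%E.
Proof.
apply: integral_ge0 => y; rewrite /= in_itv/= andbT => y1.
by rewrite lee_fin mulr_ge0// invr_ge0 exprn_ge0//; lra.
Qed.

(** By Tonelli's theorem the mean of the integral is the integral of g(y) / y^2. *)
Lemma ae_disc_integrable : {ae P, forall w, disc_integrable (Mw w)}.
Proof.
have H b : {ae P, forall w, (\int[leb]_(y in `[1%R, +oo[) (`|disc (Mw w) b K y| * y ^- 2)%:E < +oo)%E}.
  have [||||mT IT] := @tonelli_disc _ _ _ _ M K K0 stM intM b `[1, +oo[ (fun y => y ^- 2).
  - exact: measurable_itv.
  - by move=> x /=; rewrite !in_itv/= !andbT; lra.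
  - exact: sqrV_measurable.
  - by move=> y; rewrite /= in_itv/= andbT => y1; rewrite invr_ge0 exprn_ge0//; lra.
  have : P.-integrable setT (fun w => \int[leb]_(y in `[1%R, +oo[) (`|disc (Mw w) b K y| * y ^- 2)%:E)%E.
    apply/integrableP; split => //.
    rewrite -(_ : (\int[P]_w \int[leb]_(y in `[1%R, +oo[) (`|disc (Mw w) b K y| * y ^- 2)%:E = \int[P]_w `|\int[leb]_(y in `[1%R, +oo[) (`|disc (Mw w) b K y| * y ^- 2)%:E|)%E).
      by rewrite IT.
    by apply: eq_integral => w _; rewrite gee0_abs//; exact: disc_tail_ge0.
  move=> /(integrable_ae measurableT); apply: filterS => w /(_ I).
  by rewrite ge0_fin_numE//; exact: disc_tail_ge0.
by apply: filterS2 (H true) (H false) => w h1 h2 [].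
Qed.

Lemma measurable_disc b w (D : set R) : measurable_fun D (disc (Mw w) b K).
Proof.
apply: measurable_funTS.
exact: (measurableT_comp (measurable_disc2 M K b) (@pair1_measurable _ _ T R w)).
Qed.

(** Apply [quasi_sublinear] to the absolute discrepancy: a positive discrepancy decreases
at most at rate K to the right, a negative one increases at most at rate K when moving
to the left. *)
Lemma disc_sublinear w : disc_integrable (Mw w) -> forall b e, 0 < e -> exists A0 : R, 1 <= A0 /\
  forall x, A0 <= x -> `|disc (Mw w) b K x| <= e * x.
Proof.
move=> gw b; apply: (@quasi_sublinear R (fun x => `|disc (Mw w) b K x|) K 0 K0 (lexx _)).
- apply: measurableT_comp => //; exact: measurable_disc.
- by [].
- move=> x x2; have [D0|D0] := leP 0 (disc (Mw w) b K x); [left|right] => y /andP[h1 h2].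
    have := @mass_le _ (Mw w) b x y; rewrite h1 => /(_ ltac:(apply/andP; split => //; lra)).
    move: D0; rewrite /disc => D0 m; rewrite addr0 ger0_norm//.
    have := ler_norm (mass (Mw w) b y - K * y); nra.
  have y0 : 0 <= y by lra.
  have := @mass_le _ (Mw w) b y x; rewrite h2 y0 => /(_ isT).
  move: D0; rewrite /disc => D0 m; rewrite addr0 ltr0_norm//.
  have := ler_norm (- (mass (Mw w) b y - K * y)); rewrite normrN; nra.
- exact: gw.
Qed.
Definition inv_error (mu : wpm R) b (A B : R) : \bar R :=
  ((`|disc mu b K B| * B^-1)%:E + (`|disc mu b K A| * A^-1)%:E +
   \int[leb]_(y in `[A, B]) (`|disc mu b K y| * y ^- 2)%:E)%E.

Definition inv_ray (mu : wpm R) b (A B : R) : R := \int[mu]_(x in ray b A B) (flip b x)^-1.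

Lemma inv_cond (A B : R) : 0 < A < B -> [/\ 0 <= A < B, (forall y : R, A <= y <= B -> is_derive y 1 (fun x : R => x^-1) (- y ^- 2)) &
  {within `[A, B], continuous (fun y : R => - y ^- 2)}].
Proof.
move=> /andP[A0 AB]; split; first by rewrite ltW.
  by move=> y /andP[h _]; apply: is_derive_inv; rewrite gt_eqF//; lra.
apply: continuous_in_subspaceT => y; rewrite inE/= in_itv/= => /andP[h _].
apply: cvgN; apply: cvgV; first by rewrite expf_neq0// gt_eqF//; lra.
exact: exprn_continuous.
Qed.

Definition inv_cst A B := K * parts_cst (fun x : R => x^-1) (fun y => - y ^- 2) A B.

Lemma inv_ray_le (mu : wpm R) b (A B : R) : 0 < A < B ->
  (`|inv_ray mu b A B - inv_cst A B|%:E <= inv_error mu b A B)%E.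
Proof.
move=> AB; have [aB df cf] := inv_cond AB; have /andP[A0 AB'] := AB.
have := @integral_by_parts _ mu b A B K (fun x => x^-1) (fun y => - y ^- 2) aB measurable_inv df cf.
rewrite /inv_error (@ger0_norm R B^-1) ?invr_ge0 ?(ltW (lt_trans A0 AB'))// (@ger0_norm R A^-1) ?invr_ge0 ?(ltW A0)//.
move=> /le_trans; apply; rewrite leeD2l// le_eqVlt; apply/orP; left; apply/eqP.
apply: eq_integral => y; rewrite inE/= in_itv/= => /andP[h _].
by rewrite (@normrN R R) (@ger0_norm R (y ^- 2))// invr_ge0 exprn_ge0//; lra.
Qed.

Lemma F_truncB (mu : wpm R) A B : 0 <= A <= B ->
  F_trunc mu B 0 - F_trunc mu A 0 = inv_ray mu false A B - inv_ray mu true A B.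
Proof.
move=> AB; have /andP[A0 AB'] := AB.
rewrite /F_trunc window_sub//; last exact: measurable_pole.
rewrite addrC /inv_ray; congr (_ + _).
  by apply: eq_Rintegral => x _; rewrite sub0r.
have -> : \int[mu]_(x in ray true A B) (0 - x)^-1 = \int[mu]_(x in ray true A B) (-1 * x^-1).
  by apply: eq_Rintegral => x _; rewrite sub0r invrN mulN1r.
rewrite RintegralZl ?mulN1r//; first exact: measurable_ray.
apply: (@wpm_integrable _ _ (- B) B); [exact: measurable_ray|exact: ray_sub|].
by apply: measurable_funTS; exact: measurable_inv.
Qed.

(** The kernel is odd, so the Lebesgue terms of the two half-lines cancel. *)
Lemma F_truncB_le (mu : wpm R) A B : 0 < A < B ->
  (`|F_trunc mu B 0 - F_trunc mu A 0|%:E <= inv_error mu true A B + inv_error mu false A B)%E.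
Proof.
move=> AB; have /andP[A0 AB'] := AB.
rewrite F_truncB; last by apply/andP; split; lra.
have -> : inv_ray mu false A B - inv_ray mu true A B =
  (inv_ray mu false A B - inv_cst A B) - (inv_ray mu true A B - inv_cst A B) by ring.
rewrite addeC; apply: le_trans (leeD (inv_ray_le mu false AB) (inv_ray_le mu true AB)).
by rewrite -EFinD lee_fin ler_normB.
Qed.

Lemma F_trunc_cauchy0 w : disc_integrable (Mw w) -> cauchy_at_infty (fun A => F_trunc (Mw w) A 0).
Proof.
move=> gw e e0.
have e6 : 0 < e / 6 by rewrite divr_gt0.
have H b : exists A0 : R, 1 <= A0 /\ forall A B, A0 <= A -> A < B -> (inv_error (Mw w) b A B <= (e / 2)%:E)%E.
  have [A1 [A11 H1]] := disc_sublinear gw b e6.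
  have mF : measurable_fun (`[1, +oo[%classic : set R) (fun y => (`|disc (Mw w) b K y| * y ^- 2)%:E).
    apply/measurable_EFinP; apply: measurable_funM; last exact: sqrV_measurable.
    by apply: measurableT_comp => //; exact: measurable_disc.
  have F0 (y : R) : `[1, +oo[%classic y -> (0 <= (`|disc (Mw w) b K y| * y ^- 2)%:E)%E.
    by rewrite /= in_itv/= andbT => y1; rewrite lee_fin mulr_ge0// invr_ge0 exprn_ge0//; lra.
  have [A2 HA2] := @tail_integral _ _ _ leb (fun y => `|y|) `[1, +oo[ _ (@normr_measurable _ _) (measurable_itv _) mF F0 (gw b) _ e6.
  exists (Num.max A1 A2); split; first by rewrite le_max A11.
  move=> A B; rewrite ge_max => /andP[hA1 hA2] AB.
  have -> : (e / 2)%:E = ((e / 6)%:E + (e / 6)%:E + (e / 6)%:E)%E.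
    by rewrite -!EFinD; congr EFin; field.
  have A0 : 0 < A by lra. have B0 : 0 < B by lra.
  rewrite /inv_error; apply: leeD; [apply: leeD|].
  - rewrite lee_fin ler_pdivrMr//; apply: H1; lra.
  - rewrite lee_fin ler_pdivrMr//; exact: H1.
  - apply: le_trans (HA2 A hA2); apply: ge0_subset_integral => //.
    + apply: measurableI => //; rewrite (_ : [set y : R | _] = (fun y : R => `|y|) @^-1` `[A, +oo[%classic).
        by rewrite -[X in measurable X]setTI; apply: normr_measurable.
      by apply/seteqP; split => y /=; rewrite in_itv/= andbT.
    + by apply: measurable_funS mF => // y [].
    + by move=> y [h _]; exact: F0.
    + move=> y /=; rewrite !in_itv/= andbT => /andP[h1 h2]; split; first lra.
      by rewrite ger0_norm//; lra.
have [A1 [A11 H1]] := H true; have [A2 [A21 H2]] := H false.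
exists (Num.max A1 A2) => A B; rewrite ge_max => /andP[h1 h2]; rewrite le_eqVlt => /predU1P[->|AB].
  by rewrite subrr normr0 ltW.
have AB0 : 0 < A < B by apply/andP; split; lra.
rewrite -lee_fin; apply: le_trans (F_truncB_le (Mw w) AB0) _.
have -> : e%:E = ((e / 2)%:E + (e / 2)%:E)%E by rewrite -EFinD; congr EFin; field.
by apply: leeD; [exact: H1|exact: H2].
Qed.

End envelope_estimates.

(** * Mean absolute values and bounded expectations *)

Section mean_absolute_value.
Context d (T : measurableType d) (R : realType) (P : probability T R).
Implicit Types (f h : T -> R) (c : R).

Definition mabs f : \bar R := (\int[P]_w `|f w|%:E)%E.

Lemma measurable_normE f : measurable_fun [set: T] f ->
  measurable_fun [set: T] (fun w => `|f w|%:E).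
Proof. by move=> mf; apply/measurable_EFinP; exact: measurableT_comp. Qed.

Lemma mabs_ge0 f : (0 <= mabs f)%E.
Proof. by apply: integral_ge0 => w _; rewrite lee_fin. Qed.

Lemma mabs_le f h : measurable_fun [set: T] f -> measurable_fun [set: T] h ->
  {ae P, forall w, `|f w| <= `|h w|} -> (mabs f <= mabs h)%E.
Proof.
move=> mf mh fh; apply: ae_ge0_le_integral => //.
- exact: measurable_normE.
- exact: measurable_normE.
- by apply: filterS fh => w fhw _; rewrite lee_fin.
Qed.

Lemma mabsD f h : measurable_fun [set: T] f -> measurable_fun [set: T] h ->
  (mabs (fun w => (f w + h w)%R) <= mabs f + mabs h)%E.
Proof.
move=> mf mh; rewrite /mabs -ge0_integralD//; first last.
- exact: measurable_normE.
- exact: measurable_normE.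
apply: ge0_le_integral => //.
- by apply: measurable_normE; exact: measurable_funD.
- by apply: emeasurable_funD; exact: measurable_normE.
- by move=> w _; rewrite -EFinD lee_fin ler_normD.
Qed.

Lemma mabsZ f c : 0 <= c -> measurable_fun [set: T] f ->
  mabs (fun w => c * f w) = (c%:E * mabs f)%E.
Proof.
move=> c0 mf; rewrite /mabs -ge0_integralZl//.
- by apply: eq_integral => w _; rewrite normrM ger0_norm.
- exact: measurable_normE.
Qed.

Lemma mabs_cst c : mabs (cst c) = `|c|%:E.
Proof. by rewrite /mabs (_ : (fun w => `|cst c w|%:E) = cst `|c|%:E)// integral_cst//= [P _]probability_setT mule1. Qed.

Lemma limn_einf_le (u : (\bar R)^nat) (l : \bar R) :
  (forall n, u n <= l)%E -> (limn_einf u <= l)%E.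
Proof.
move=> ul; rewrite limn_einf_lim; apply: lime_le; first exact: is_cvg_einfs.
apply: nearW => n; apply: le_trans (ul n); apply: ereal_inf_lbound.
by exists n => //=.
Qed.

(** Fatou's lemma. The means of the approximations need to be close to l only eventually. *)
Lemma mabs_limit (f : nat -> T -> R) h (l : \bar R) :
  (forall n, measurable_fun [set: T] (f n)) -> measurable_fun [set: T] h ->
  {ae P, forall w, f n w @[n --> \oo] --> h w} ->
  (forall e : R, 0 < e -> exists N : nat, forall n, (N <= n)%N -> (mabs (f n) <= l + e%:E)%E) ->
  (mabs h <= l)%E.
Proof.
move=> mf mh fh fl; apply/lee_addgt0Pr => e e0; have [N HN] := fl e e0.
pose u n w : \bar R := `|f (n + N)%N w|%:E.
have mu n : measurable_fun [set: T] (u n) by exact: measurable_normE.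
have -> : mabs h = (\int[P]_w limn_einf (u ^~ w))%E.
  apply: ae_eq_integral => //; first exact: measurable_normE.
    rewrite (_ : (fun w => limn_einf (u ^~ w)) = (fun w => - limn_esup (-%E \o u ^~ w))%E).
      by apply: measurableT_comp => //; apply: measurable_fun_limn_esup => n; exact: measurableT_comp.
    by apply/funext => w; rewrite limn_esupN oppeK.
  apply: filterS fh => w fw _; have : u n w @[n --> \oo] --> `|h w|%:E.
    apply: cvg_EFin; first exact: nearW.
    by apply: cvg_norm; move: fw; rewrite -(cvg_shiftn N).
  by move=> /cvg_limn_einf_sup[->].
apply: le_trans (fatou P measurableT mu _) _; first by move=> n w _; rewrite lee_fin.
by apply: limn_einf_le => n; apply: HN; rewrite leq_addl.
Qed.
Definition rmean f : R := \int[P]_w f w.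

Lemma bounded_integrable f c : measurable_fun [set: T] f -> (forall w, `|f w| <= c) ->
  P.-integrable setT (EFin \o f).
Proof.
move=> mf fc; apply: (@le_integrable _ _ _ P _ measurableT _ (EFin \o cst c)).
- exact/measurable_EFinP.
- by move=> w _ /=; rewrite lee_fin (le_trans (fc w))// ler_norm.
- exact: finite_measure_integrable_cst.
Qed.

Lemma rmean_cst c : rmean (cst c) = c.
Proof. by rewrite /rmean Rintegral_cst//= [P _]probability_setT mulr1. Qed.

Lemma rmean_dist f h c e : measurable_fun [set: T] f -> measurable_fun [set: T] h ->
  (forall w, `|f w| <= c) -> (forall w, `|h w| <= c) ->
  (mabs (fun w => (f w - h w)%R) <= e%:E)%E -> `|rmean f - rmean h| <= e.
Proof.
move=> mf mh fc hc fh.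
have fi := bounded_integrable mf fc; have hi := bounded_integrable mh hc.
rewrite /rmean -RintegralB//.
have di : P.-integrable setT (EFin \o (fun w => f w - h w)) by exact: integrableB_EFin.
apply: le_trans (le_normr_Rintegral measurableT di) _.
rewrite -lee_fin; apply: le_trans fh; rewrite /Rintegral fineK//.
apply: integrable_fin_num => //.
have := integrable_norm di; apply: eq_integrable => //.
Qed.

Lemma rmean_cvg (f : nat -> T -> R) h c :
  (forall n, measurable_fun [set: T] (f n)) -> measurable_fun [set: T] h ->
  (forall n w, `|f n w| <= c) ->
  {ae P, forall w, f n w @[n --> \oo] --> h w} ->
  rmean (f n) @[n --> \oo] --> rmean h.
Proof.
move=> mf mh fc fh.
have [| | | | | hi _ H] := @dominated_convergence _ _ _ P _ measurableT (fun n => EFin \o f n) (EFin \o h) (EFin \o cst c).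
- by move=> n; exact/measurable_EFinP.
- exact/measurable_EFinP.
- by apply: filterS fh => w fw _; apply: cvg_EFin fw; exact: nearW.
- exact: finite_measure_integrable_cst.
- by apply: nearW => w n _ /=; rewrite lee_fin.
have fin n : (\int[P]_w (f n w)%:E)%E \is a fin_num.
  by apply: integrable_fin_num => //; exact: bounded_integrable (fc n).
have hfin : (\int[P]_w (h w)%:E)%E \is a fin_num by exact: integrable_fin_num.
by rewrite -(fineK hfin) in H; exact: fine_cvg H.
Qed.

End mean_absolute_value.

(** * Mean estimates for truncated principal values *)

Section truncation_estimates.
Context d (T : measurableType d) (R : realType) (P : probability T R).
Variables (M : {RV P >-> vague_borel R}) (K : R).
Hypotheses (K0 : 0 < K) (stM : stationary M) (intM : intensity M = K%:E).
Notation VB := (vague_borel R).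
Notation leb := (@lebesgue_measure R).
Local Notation Mw w := (M w : wpm R).
Local Notation g := (discrepancy M K).

(** Integrals of the kernel k(p - x) over windows centred at 0 and at p. The former are
the truncations that define the principal value; the latter are stationary in p. *)
Definition window_int (mu : wpm R) (k : R -> R) (n p : R) : R := \int[mu]_(x in `[- n, n]) k (p - x).
Definition centred_int (mu : wpm R) (k : R -> R) (n p : R) : R := \int[mu]_(x in `[p - n, p + n]) k (p - x).

Lemma measurable_reflect (k : R -> R) (p : R) : measurable_fun [set: R] k -> measurable_fun [set: R] (fun x => k (p - x)).
Proof.
move=> mk; apply: measurableT_comp => //; exact: measurable_funB.
Qed.

Lemma measurable_window_int k n p : measurable_fun [set: R] k ->
  measurable_fun [set: T] (fun w => window_int (Mw w) k n p).
Proof.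
move=> mk; apply: (measurableT_comp (f := fun mu : VB => window_int (mu : wpm R) k n p)); last exact: measurable_M.
by apply: measurable_mu_Rintegral => //; apply: measurable_funTS; exact: measurable_reflect.
Qed.

Lemma measurable_centred_int k n p : measurable_fun [set: R] k ->
  measurable_fun [set: T] (fun w => centred_int (Mw w) k n p).
Proof.
move=> mk; apply: (measurableT_comp (f := fun mu : VB => centred_int (mu : wpm R) k n p)); last exact: measurable_M.
by apply: measurable_mu_Rintegral => //; apply: measurable_funTS; exact: measurable_reflect.
Qed.

Lemma centred_int_shift (mu : wpm R) k n p : measurable_fun [set: R] k ->
  centred_int mu k n p = window_int (wpm_shift p mu) k n 0.
Proof.
move=> mk; rewrite /window_int integral_shift; last exact: measurable_reflect.
by rewrite /centred_int; apply: eq_Rintegral => x _; congr k; ring.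
Qed.

Lemma mean_fine_mu (U : set R) : measurable U ->
  (mabs P (fun w => fine (Mw w U)) <= mean_measure M U)%E.
Proof.
move=> mU; apply: ge0_le_integral => //.
- by apply: measurable_normE; apply: measurableT_comp => //; exact: measurable_M_set.
- exact: measurable_M_set.
- move=> w _; rewrite ger0_norm ?fine_ge0//; have [->|n] := eqVneq (Mw w U) +oo%E; first exact: leey.
  by rewrite fineK// ge0_fin_numE// ltey.
Qed.

(** The two windows differ inside two intervals of length 2 |p|, on which the kernel is at most
1 / (n - 2 |p|). *)
Lemma mean_window (k : R -> R) (n p : R) : measurable_fun [set: R] k -> (forall u, u != 0 -> `|k u| <= `|u|^-1) ->
  2 * `|p| < n ->
  (mabs P (fun w => (window_int (Mw w) k n p - centred_int (Mw w) k n p)%R) <=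
    (K * (4 * `|p| + 4) / (n - 2 * `|p|))%:E)%E.
Proof.
move=> mk kle pn; have p0 := normr_ge0 p.
(* two intervals containing the symmetric difference of the windows *)
pose E1 := `[- n - `|p|, - n + `|p|]%classic; pose E2 := `[n - `|p|, n + `|p|]%classic.
have mE1 : measurable E1 by exact: measurable_itv.
have mE2 : measurable E2 by exact: measurable_itv.
pose c := (n - 2 * `|p|)^-1.
have c0 : 0 <= c by rewrite invr_ge0; lra.
have np := ler_norm p; have npN : - p <= `|p| by rewrite -normrN ler_norm.
have key w : `|window_int (Mw w) k n p - centred_int (Mw w) k n p| <= c * fine (Mw w (E1 `|` E2)).
  apply: (@window_diff R (Mw w) _ (- n - `|p|) (n + `|p|)) => //.
  - exact: measurable_reflect.
  - exact: measurableU.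
  - by move=> x /=; rewrite !in_itv/=; lra.
  - by move=> x /=; rewrite !in_itv/=; lra.
  - by move=> x [|]; rewrite /E1 /E2 /= !in_itv/=; lra.
  - move=> x [] /=; rewrite !in_itv/= => h1 h2.
    have [xp|xp] := leP (p - n) x; [right|left]; rewrite /E1 /E2 /= in_itv/=; last lra.
    have [xp'|xp'] := leP x (p + n); last lra.
    by exfalso; apply: h2; rewrite xp xp'.
  - move=> x [] /=; rewrite !in_itv/= => h1 h2.
    have [xp|xp] := leP (- n) x; [right|left]; rewrite /E1 /E2 /= in_itv/=; last lra.
    have [xp'|xp'] := leP x n; last lra.
    by exfalso; apply: h2; rewrite xp xp'.
  - move=> x Ex.
    have xn : n - 2 * `|p| <= `|p - x|.
      case: Ex; rewrite /E1 /E2 /= in_itv/= => h.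
        by apply: le_trans (ler_norm _); lra.
      by rewrite distrC; apply: le_trans (ler_norm _); lra.
    have px0 : 0 < `|p - x| by lra.
    apply: le_trans (kle _ _) _; first by rewrite -normr_gt0.
    by rewrite lef_pV2// posrE; lra.
apply: (@le_trans _ _ (mabs P (fun w => c * fine (Mw w (E1 `|` E2))))).
  apply: mabs_le.
  - by apply: measurable_funB; [exact: measurable_window_int|exact: measurable_centred_int].
  - apply: measurable_funM => //; apply: measurableT_comp => //; apply: measurable_M_set; exact: measurableU.
  - apply: nearW => w; apply: le_trans (key w) (ler_norm _).
rewrite mabsZ//; last by apply: measurableT_comp => //; apply: measurable_M_set; exact: measurableU.
rewrite [leRHS](_ : _ = c%:E * (K * (4 * `|p| + 4))%:E)%E; last first.
  by rewrite -EFinM; congr EFin; rewrite mulrC.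
apply: lee_wpmul2l => //; apply: le_trans (mean_fine_mu _) _; first exact: measurableU.
have : (mean_measure M (E1 `|` E2) <= mean_measure M E1 + mean_measure M E2)%E.
  rewrite /mean_measure -ge0_integralD//; first last.
  - exact: measurable_M_set.
  - exact: measurable_M_set.
  apply: ge0_le_integral => //.
  - by apply: measurable_M_set; exact: measurableU.
  - by apply: emeasurable_funD; exact: measurable_M_set.
  - by move=> w _; exact: measureU2.
move=> /le_trans; apply.
have -> : (K * (4 * `|p| + 4))%:E = ((K * (- n + `|p| - (- n - `|p|) + 2))%:E + (K * (n + `|p| - (n - `|p|) + 2))%:E)%E.
  by rewrite -EFinD; congr EFin; ring.
by apply: leeD; apply: mean_measure_bound => //; lra.
Qed.
Lemma F_symE (mu : wpm R) (A s : R) : F_sym mu A s = centred_int mu (fun u => u^-1) A s.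
Proof. by []. Qed.

Lemma F_truncE (mu : wpm R) (A s : R) : F_trunc mu A s = window_int mu (fun u => u^-1) A s.
Proof. by []. Qed.

Lemma inv_norm_le (u : R) : u != 0 -> `|u^-1| <= `|u|^-1.
Proof. by rewrite normfV. Qed.

Lemma measurable_inv_ray b (A B : R) : measurable_fun [set: T] (fun w => inv_ray (Mw w) b A B).
Proof.
apply: (measurableT_comp (f := fun mu : VB => inv_ray (mu : wpm R) b A B)); last exact: measurable_M.
apply: measurable_mu_Rintegral; first exact: measurable_ray.
by apply: measurable_funTS; apply: measurableT_comp measurable_inv (measurable_flip b).
Qed.

Lemma mean_inv_ray b (A B : R) : 0 < A < B ->
  (mabs P (fun w => (inv_ray (Mw w) b A B - inv_cst K A B)%R) <=
   g B * (B^-1)%:E + g A * (A^-1)%:E + \int[leb]_(y in `[A, B]) (g y * (y ^- 2)%:E))%E.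
Proof.
move=> AB; have [aB df cf] := inv_cond AB; have /andP[A0 AB'] := AB.
have [_] := mean_by_parts K0 stM intM b aB measurable_inv df cf.
rewrite (@ger0_norm R B^-1) ?invr_ge0 ?(ltW (lt_trans A0 AB'))// (@ger0_norm R A^-1) ?invr_ge0 ?(ltW A0)//.
move=> /le_trans; apply; rewrite leeD2l// le_eqVlt; apply/orP; left; apply/eqP.
apply: eq_integral => y; rewrite inE/= in_itv/= => /andP[h _].
by rewrite (@normrN R R) (@ger0_norm R (y ^- 2))// invr_ge0 exprn_ge0//; lra.
Qed.

(** The terms at A and the tail integral form the bound; the term at B vanishes as B
tends to infinity. *)
Lemma mean_F_truncB (A B : R) : 1 <= A < B ->
  (mabs P (fun w => (F_trunc (Mw w) B 0 - F_trunc (Mw w) A 0)%R) <=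
   2%:E * (g B * (B^-1)%:E) + tail_bound g A)%E.
Proof.
move=> /andP[A1 AB]; have A0 : 0 < A < B by apply/andP; split; lra.
have A0' : 0 <= A <= B by apply/andP; split; lra.
have mI b := measurable_funB (measurable_inv_ray b A B) (measurable_cst (inv_cst K A B)).
have -> : (fun w => F_trunc (Mw w) B 0 - F_trunc (Mw w) A 0) =
  (fun w => (inv_ray (Mw w) false A B - inv_cst K A B) + -1 * (inv_ray (Mw w) true A B - inv_cst K A B)).
  by apply/funext => w; rewrite F_truncB//; ring.
have mI' : measurable_fun [set: T] (fun w => -1 * (inv_ray (Mw w) true A B - inv_cst K A B)).
  by apply: measurable_funM => //; exact: mI.
apply: le_trans (mabsD P (mI false) mI') _.
have -> : mabs P (fun w => -1 * (inv_ray (Mw w) true A B - inv_cst K A B)) =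
   mabs P (fun w => inv_ray (Mw w) true A B - inv_cst K A B).
  by apply: eq_integral => w _; rewrite mulN1r normrN.
apply: le_trans (leeD (mean_inv_ray false A0) (mean_inv_ray true A0)) _.
have J0 : (\int[leb]_(y in `[A, B]) (g y * (y ^- 2)%:E) <= \int[leb]_(y in `[A, +oo[) (g y * (y ^- 2)%:E))%E.
  apply: ge0_subset_integral => //.
  - apply: emeasurable_funM; last by apply/measurable_EFinP; exact: sqrV_measurable.
    apply: measurable_discrepancy => //.
    by move=> x /=; rewrite !in_itv/= !andbT; lra.
  - move=> y; rewrite /= in_itv/= andbT => h; apply: g_tail_ge0; lra.
  - by move=> y; rewrite /= !in_itv/= andbT => /andP[].
have gB0 : (0 <= g B * (B^-1)%:E)%E by rewrite mule_ge0 ?discrepancy_ge0// lee_fin invr_ge0; lra.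
have gA0 : (0 <= g A * (A^-1)%:E)%E by rewrite mule_ge0 ?discrepancy_ge0// lee_fin invr_ge0; lra.
have I0 : (0 <= \int[leb]_(y in `[A, +oo[) (g y * (y ^- 2)%:E))%E.
  by apply: integral_ge0 => y; rewrite /= in_itv/= andbT => h; apply: g_tail_ge0; lra.
have two (x : \bar R) : (0 <= x)%E -> (2%:E * x = x + x)%E.
  by move=> x0; rewrite (_ : 2%:E = 1 + 1)%E// ge0_muleDl// mul1e.
rewrite /tail_bound -muleA two// two// two// [leRHS]addeA.
move: J0; set J := (X in (X <= _)%E); set I := (X in (_ <= X)%E) => JI.
have JI' := leeD2l (g B * (B^-1)%:E + g A * (A^-1)%:E)%E JI.
apply: le_trans (leeD JI' JI') _.
by rewrite addeACA [X in (X + _ <= _)%E]addeACA.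
Qed.

Lemma measurable_F_truncM A s : measurable_fun [set: T] (fun w => F_trunc (Mw w) A s).
Proof. by apply: measurable_window_int; exact: measurable_inv. Qed.

Lemma measurable_F_symM A s : measurable_fun [set: T] (fun w => F_sym (Mw w) A s).
Proof. by apply: measurable_centred_int; exact: measurable_inv. Qed.

Lemma measurable_F_pvM s : measurable_fun [set: T] (fun w => F_pv (Mw w) s).
Proof. exact: (measurableT_comp (measurable_F_pv s) (measurable_M M)). Qed.

Lemma mabs_shift (t : R) (Phi : VB -> R) : measurable_fun [set: VB] Phi ->
  mabs P (fun w => Phi (wpm_shift t (Mw w))) = mabs P (fun w => Phi (Mw w)).
Proof.
move=> mPhi; apply: (@ge0_integral_shift _ _ _ P M stM t (fun mu => `|Phi mu|%:E)) => //.
exact: measurable_normE.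
Qed.

(** By stationarity the windows centred at s behave as those centred at 0, and the
window [-n, n] is close to [s - n, s + n]. *)
Lemma mean_F_trunc_sym (s A : R) (n : R) : 1 <= A < n -> 2 * `|s| < n ->
  (mabs P (fun w => (F_trunc (Mw w) n s - F_sym (Mw w) A s)%R) <=
   tail_bound g A + 2%:E * (g n * (n^-1)%:E) + (K * (4 * `|s| + 4) / (n - 2 * `|s|))%:E)%E.
Proof.
move=> An sn.
have -> : (fun w => F_trunc (Mw w) n s - F_sym (Mw w) A s) =
  (fun w => (F_sym (Mw w) n s - F_sym (Mw w) A s) + (F_trunc (Mw w) n s - F_sym (Mw w) n s)).
  by apply/funext => w; ring.
apply: le_trans (mabsD P _ _) _.
- by apply: measurable_funB; exact: measurable_F_symM.
- by apply: measurable_funB; [exact: measurable_F_truncM|exact: measurable_F_symM].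
apply: leeD; last exact: (mean_window measurable_inv inv_norm_le sn).
rewrite addeC; apply: le_trans (mean_F_truncB An).
have -> : mabs P (fun w => (F_sym (Mw w) n s - F_sym (Mw w) A s)%R) =
  mabs P (fun w => (fun mu : VB => F_trunc (mu : wpm R) n 0 - F_trunc (mu : wpm R) A 0) (wpm_shift s (Mw w))).
  apply: eq_integral => w _; congr (`|_|%:E).
  by rewrite !F_symE !F_truncE !centred_int_shift//; exact: measurable_inv.
rewrite (@mabs_shift s (fun mu : VB => F_trunc (mu : wpm R) n 0 - F_trunc (mu : wpm R) A 0)) => //.
by apply: measurable_funB; exact: measurable_F_trunc.
Qed.

Hypothesis gint : (\int[leb]_(y in `[1%R, +oo[) (g y * (y ^- 2)%:E) < +oo)%E.

(** The condition that makes the convergence of the truncations independent of the point s. *)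
Definition imK_integrable (mu : wpm R) := (\int[mu]_x (imK 1 x)%:E < +oo)%E.

Lemma imK_ge0 (eta u : R) : 0 <= eta -> 0 <= imK eta u.
Proof. by move=> e0; rewrite /imK mulr_ge0// invr_ge0 addr_ge0// sqr_ge0. Qed.

Lemma imKN (eta u : R) : imK eta (- u) = imK eta u.
Proof. by rewrite /imK sqrrN. Qed.

Lemma g_near0 (y : R) : 0 <= y <= 1 -> (g y <= (4 * K)%:E)%E.
Proof.
move=> /andP[y0 y1]; apply: le_trans (discrepancy_bound K0 stM intM y0) _.
have Ky : K * y <= K * 1 by rewrite ler_pM2l.
by rewrite lee_fin; lra.
Qed.

(** Integration by parts for 1 / (1 + x^2), with g at most 4 K on [0, 1]. *)
Lemma mean_imK_bound : exists c : R, forall b (n : R), 1 <= n ->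
  (\int[P]_w (\int[Mw w]_(x in ray b 0 n) imK 1 (flip b x))%:E <= c%:E)%E.
Proof.
pose J := (\int[leb]_(y in `[1%R, +oo[) (g y * (y ^- 2)%:E))%E.
have J0 : (0 <= J)%E by apply: integral_ge0 => y; rewrite /= in_itv/= andbT => h; exact: g_tail_ge0.
have Jf : J \is a fin_num by rewrite ge0_fin_numE.
exists (4 * K + (2 * K + (4 * K + fine J)) + K * (pi / 2)) => b n n1.
have n0 : 0 < n by lra.
have an : (0 : R) <= 0 < n by rewrite lexx n0.
have nz : (1 : R) != 0 by [].
have [mI HI] := mean_by_parts K0 stM intM b an (measurable_imK 1) (fun y _ => is_derive_imK y nz)
  (continuous_in_subspaceT (fun y _ => continuous_dimK nz (x := y))).
have I0 w : 0 <= \int[Mw w]_(x in ray b 0 n) imK 1 (flip b x).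
  by apply: Rintegral_ge0 => // x _; exact: imK_ge0.
have -> : (\int[P]_w (\int[Mw w]_(x in ray b 0 n) imK 1 (flip b x))%R%:E =
    mabs P (fun w => (\int[Mw w]_(x in ray b 0 n) imK 1 (flip b x)
     - K * parts_cst (imK 1) (dimK 1) 0 n) + K * parts_cst (imK 1) (dimK 1) 0 n)%R)%E.
  by apply: eq_integral => w _; rewrite subrK ger0_norm.
apply: le_trans (mabsD P _ _) _; [exact: measurable_funB|exact: measurable_cst|].
rewrite mabs_cst [leRHS]EFinD; apply: leeD; last first.
  rewrite parts_cst_imK// divr1 lee_fin normrM (gtr0_norm K0) ler_pM2l// ltW//.
  by rewrite ltr_norml atan_gtNpi2 atan_ltpi2.
apply: le_trans HI _; rewrite [leRHS]EFinD EFinD [leRHS]addeA.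
apply: leeD; first apply: leeD.
- have n0' := ltW n0; apply: (@le_trans _ _ ((2 * K * (n + 1))%:E * (n^-1)%:E)%E).
    apply: lee_pmul => //; first exact: discrepancy_ge0.
      exact: (discrepancy_bound K0 stM intM n0').
    by rewrite lee_fin; exact: imK_le.
  rewrite -EFinM lee_fin ler_pdivrMr// (_ : 2 * K * (n + 1) = 4 * K * n + 2 * K * (1 - n)); last by ring.
  by rewrite gerDl; apply: mulr_ge0_le0; [exact: mulr_ge0 (ltW K0)|rewrite subr_le0].
- rewrite (_ : `|imK 1 0| = 1) ?mule1; last by rewrite /imK expr0n/= add0r expr1n divr1 normr1.
  by apply: le_trans (discrepancy_bound K0 stM intM (lexx 0)) _; rewrite add0r mulr1.
have -> : `[0%R, n]%classic = (`[0%R, 1%R[%classic `|` `[1%R, n]%classic)%classic :> set R.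
  apply/seteqP; split => y /=; rewrite !in_itv/=; last by case => /andP[]; lra.
  by move=> /andP[h1 h2]; have [h3|h3] := ltP y 1; [left|right]; apply/andP; split.
have mg (D : set R) : measurable D -> D `<=` `[0, +oo[ -> measurable_fun D (fun y => g y * `|dimK 1 y|%:E)%E.
  move=> mD sD; apply: emeasurable_funM; first exact: measurable_discrepancy.
  apply/measurable_EFinP; apply: measurable_funTS; apply: measurableT_comp => //.
  by apply: continuous_measurable_fun; exact: continuous_dimK.
have dle (y : R) : `|dimK 1 y| <= (y ^+ 2 + 1)^-1 by have := dimK_le y nz; rewrite expr1n.
have y21 (y : R) : 0 < y ^+ 2 + 1 by have := sqr_ge0 y; lra.
rewrite ge0_integral_setU//=; first last.
- apply/disj_setPS => y [] /=; rewrite !in_itv/= => /andP[h1 h2] /andP[h3 h4]; by have := lt_le_trans h2 h3; rewrite ltxx.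
- by move=> y _; rewrite mule_ge0 ?discrepancy_ge0.
- apply: mg; first exact: measurableU.
  by move=> y []; rewrite /= !in_itv/= !andbT => /andP[]// h _; exact: le_trans ler01 h.
rewrite [leRHS]EFinD; apply: leeD.
  apply: (@le_trans _ _ (\int[leb]_(y in `[0%R, 1%R[) (4 * K)%:E)%E).
    apply: ge0_le_integral => //.
    - by move=> y _; rewrite mule_ge0 ?discrepancy_ge0.
    - by apply: mg => // y; rewrite /= !in_itv/= !andbT => /andP[].
    - move=> y; rewrite /= in_itv/= => /andP[h1 h2].
      rewrite -[leRHS]mule1; apply: lee_pmul => //; first exact: discrepancy_ge0.
        by apply: g_near0; rewrite h1 ltW.
      by rewrite lee_fin (le_trans (dle y))// invf_le1// lerDr sqr_ge0.
  by rewrite integral_cst//= lebesgue_measure_itv/= lte01 oppr0 adde0 mule1.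
rewrite fineK//; apply: (@le_trans _ _ (\int[leb]_(y in `[1%R, n]) (g y * (y ^- 2)%:E))%E).
  apply: ge0_le_integral => //.
  - by move=> y _; rewrite mule_ge0 ?discrepancy_ge0.
  - by apply: mg => // y; rewrite /= !in_itv/= !andbT => /andP[h _]; exact: le_trans ler01 h.
  - apply: measurable_funS (measurable_g_tail M K) => //.
    by move=> y /=; rewrite !in_itv/= andbT => /andP[].
  - move=> y; rewrite /= in_itv/= => /andP[h _]; apply: lee_wpmul2l; first exact: discrepancy_ge0.
    rewrite lee_fin (le_trans (dle y))// lef_pV2 ?posrE//; last by rewrite exprn_gt0// (lt_le_trans ltr01 h).
    by rewrite lerDl.
apply: ge0_subset_integral => //.
- exact: measurable_g_tail.
- by move=> y; rewrite /= in_itv/= andbT; exact: g_tail_ge0.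
- by move=> y; rewrite /= !in_itv/= andbT => /andP[].
Qed.

End truncation_estimates.

(** * Existence of the principal value and the mean error bound *)

Section auxiliary_limits.
Context {R : realType}.

Lemma nat_large (x : R) : exists N : nat, forall n : nat, (N <= n)%N -> x < n%:R.
Proof.
exists (Num.bound `|x|) => n Nn.
apply: le_lt_trans (ler_norm x) _; apply: lt_le_trans (archi_boundP (normr_ge0 x)) _.
by rewrite ler_nat.
Qed.

(** Fatou's lemma for an exhaustion of the line. *)
Lemma integral_le_einf (mu : {measure set R -> \bar R}) (f : R -> \bar R) :
  (forall x, 0 <= f x)%E -> measurable_fun [set: R] f ->
  (\int[mu]_x f x <= limn_einf (fun n => \int[mu]_(x in `[(- n.+1%:R)%R, n.+1%:R%R]) f x))%E.
Proof.
move=> f0 mf.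
have := fatou mu measurableT (f := fun n => f \_ `[- n.+1%:R, n.+1%:R]%classic).
have -> : (fun n => \int[mu]_x (f \_ `[(- n.+1%:R)%R, n.+1%:R%R]%classic) x)%E = (fun n => \int[mu]_(x in `[(- n.+1%:R)%R, n.+1%:R%R]) f x)%E.
  by apply/funext => n; rewrite -integral_mkcond.
move=> H; apply: le_trans (H _ _).
- rewrite le_eqVlt; apply/orP; left; apply/eqP; apply: eq_integral => x _.
  have : (fun n : nat => (f \_ `[- n.+1%:R, n.+1%:R]%classic) x) @ \oo --> f x.
    have [N HN] := nat_large `|x|.
    apply: cvg_near_cst; exists N => // n /= Nn; rewrite patchE ifT//.
    by rewrite inE/= in_itv/= -ler_norml ltW// HN// ltnW.
  by move=> /cvg_limn_einf_sup[->].
- by move=> n; apply/(measurable_restrictT _ _).1 => //; apply: measurable_funTS.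
- by move=> n x _; rewrite patchE; case: ifP.
Qed.

End auxiliary_limits.

Section principal_value.
Context d (T : measurableType d) (R : realType) (P : probability T R).
Variables (M : {RV P >-> vague_borel R}) (K : R).
Hypotheses (K0 : 0 < K) (stM : stationary M) (intM : intensity M = K%:E).
Notation VB := (vague_borel R).
Notation leb := (@lebesgue_measure R).
Local Notation Mw w := (M w : wpm R).
Local Notation g := (discrepancy M K).
Hypothesis gint : (\int[leb]_(y in `[1%R, +oo[) (g y * (y ^- 2)%:E) < +oo)%E.

Lemma EFin_Rintegral (mu : wpm R) (a b : R) (D : set R) (f : R -> R) : measurable D -> D `<=` `[a, b] ->
  measurable_fun D f -> (\int[mu]_(x in D) f x)%R%:E = (\int[mu]_(x in D) (f x)%:E)%E.
Proof.
move=> mD sD mf; rewrite /Rintegral fineK//; apply: integrable_fin_num => //.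
have H := @wpm_integrable R mu a b D f mD sD mf.
exact: H.
Qed.

Lemma window_int_imK (mu : wpm R) (eta n : R) : 0 <= n -> window_int mu (imK eta) n 0 =
  \int[mu]_(x in ray true 0 n) imK eta (flip true x) + \int[mu]_(x in ray false 0 n) imK eta (flip false x) +
  fine (mu [set 0]) * imK eta 0.
Proof.
move=> n0; have -> : window_int mu (imK eta) n 0 = \int[mu]_(x in `[- n, n]) imK eta x.
  by apply: eq_Rintegral => x _; rewrite sub0r imKN.
rewrite window_split//; last exact: measurable_imK.
by do 2 congr (_ + _); apply: eq_Rintegral => x _; rewrite /flip ?imKN.
Qed.

Lemma reKN (eta u : R) : reK eta (- u) = - reK eta u.
Proof. by rewrite /reK sqrrN mulNr. Qed.

Lemma window_int_reK (mu : wpm R) (eta n : R) : 0 <= n -> window_int mu (reK eta) n 0 =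
  \int[mu]_(x in ray false 0 n) reK eta (flip false x) - \int[mu]_(x in ray true 0 n) reK eta (flip true x).
Proof.
move=> n0; have -> : window_int mu (reK eta) n 0 = \int[mu]_(x in `[- n, n]) (-1 * reK eta x).
  by apply: eq_Rintegral => x _; rewrite sub0r reKN mulN1r.
have mr : measurable_fun [set: R] (fun x => -1 * reK eta x) by apply: measurable_funM => //; exact: measurable_reK.
rewrite window_split// (_ : -1 * reK eta 0 = 0); last by rewrite /reK mul0r mulr0.
rewrite mulr0 addr0 addrC; congr (_ + _).
  by apply: eq_Rintegral => x _; rewrite /flip reKN mulN1r.
rewrite RintegralZl ?mulN1r//; first exact: measurable_ray.
apply: (@wpm_integrable _ _ (- n) n); [exact: measurable_ray|exact: ray_sub|].
by apply: measurable_funTS; exact: measurable_reK.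
Qed.

Lemma measurable_ray_int (k : R -> R) b (n : R) : measurable_fun [set: R] k ->
  measurable_fun [set: T] (fun w => \int[Mw w]_(x in ray b 0 n) k (flip b x)).
Proof.
move=> mk; apply: (measurableT_comp (f := fun mu : VB => \int[(mu : wpm R)]_(x in ray b 0 n) k (flip b x))); last exact: measurable_M.
apply: measurable_mu_Rintegral; first exact: measurable_ray.
by apply: measurable_funTS; apply: measurableT_comp mk (measurable_flip b).
Qed.

Lemma ae_imK_integrable : {ae P, forall w, imK_integrable (Mw w)}.
Proof.
have i0 x : (0 <= (imK 1 x)%:E :> \bar R)%E by rewrite lee_fin imK_ge0.
have mi : measurable_fun [set: R] (fun x : R => (imK 1 x)%:E).
  by apply/measurable_EFinP; exact: measurable_imK.
have mW n : measurable_fun [set: T] (fun w => window_int (Mw w) (imK 1) n%:R 0).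
  by apply: measurable_window_int; exact: measurable_imK.
have W0 n w : 0 <= window_int (Mw w) (imK 1) n%:R 0.
  by apply: Rintegral_ge0 => x _; exact: imK_ge0.
have [c Hc] := mean_imK_bound K0 stM intM gint.
have fin : (\int[P]_w \int[Mw w]_x (imK 1 x)%:E <= (c + c)%:E)%E.
  apply: (@le_trans _ _ (\int[P]_w limn_einf (fun n => (window_int (Mw w) (imK 1) n.+1%:R 0)%:E))%E).
    apply: ge0_le_integral => //.
    - by move=> w _; apply: integral_ge0.
    - exact: (measurableT_comp (measurable_mu_integral i0 mi) (measurable_M M)).
    - rewrite (_ : (fun w => _) = (fun w => - limn_esup (-%E \o (fun n => (window_int (Mw w) (imK 1) n.+1%:R 0)%:E)))%E).
        apply: measurableT_comp => //; apply: measurable_fun_limn_esup => n.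
        by apply: measurableT_comp => //; apply/measurable_EFinP.
      by apply/funext => w; rewrite limn_esupN oppeK.
    - move=> w _; apply: le_trans (integral_le_einf (Mw w) i0 mi) _.
      rewrite le_eqVlt; apply/orP; left; apply/eqP; congr limn_einf; apply/funext => n.
      rewrite /window_int (@EFin_Rintegral _ (- n.+1%:R) n.+1%:R)//.
        by apply: eq_integral => x _; rewrite sub0r imKN.
      by apply: measurable_funTS; apply: measurable_reflect; exact: measurable_imK.
  apply: le_trans (fatou P measurableT (f := fun n w => (window_int (Mw w) (imK 1) n.+1%:R 0)%:E) _ _) _.
  - by move=> n; apply/measurable_EFinP.
  - by move=> n w _; rewrite lee_fin.
  apply: limn_einf_le => n.
  pose I b w := \int[Mw w]_(x in ray b 0 n.+1%:R) imK 1 (flip b x).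
  have mI b : measurable_fun [set: T] (fun w => (I b w)%:E).
    by apply/measurable_EFinP; apply: measurable_ray_int; exact: measurable_imK.
  have I0 b w : (0 <= (I b w)%:E)%E by rewrite lee_fin; apply: Rintegral_ge0 => x _; exact: imK_ge0.
  have n1 : 1 <= n.+1%:R :> R by rewrite ler1n.
  rewrite [leRHS]EFinD; apply: le_trans (leeD (Hc true _ n1) (Hc false _ n1)).
  rewrite -/(I true _) -/(I false _).
  have -> : (\int[P]_w (window_int (Mw w) (imK 1) n.+1%:R 0)%:E = \int[P]_w ((I true w)%:E + (I false w)%:E))%E.
    apply: ae_eq_integral => //.
    + exact/measurable_EFinP.
    + exact: emeasurable_funD.
    + apply: filterS (ae_no_atom K0 stM intM 0) => w w0 _.
      by rewrite window_int_imK// w0 mul0r addr0 EFinD.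
  by rewrite ge0_integralD.
have : P.-integrable setT (fun w => \int[Mw w]_x (imK 1 x)%:E)%E.
  apply/integrableP; split.
    exact: (measurableT_comp (measurable_mu_integral i0 mi) (measurable_M M)).
  apply: le_lt_trans (ltry (c + c)); apply: le_trans fin.
  rewrite le_eqVlt; apply/orP; left; apply/eqP; apply: eq_integral => w _.
  by rewrite gee0_abs//; exact: integral_ge0.
move=> /(integrable_ae measurableT); apply: filterS => w /(_ I).
by rewrite ge0_fin_numE//; apply: integral_ge0.
Qed.

(** The kernels at s and at 0 differ by s / (x (s - x)), which decays like 1 / x^2. *)
Lemma pole_shift_le (s x : R) : 1 <= `|x| -> 2 * `|s| <= `|x| ->
  `|(s - x)^-1 - (0 - x)^-1| <= 4 * `|s| * imK 1 x.
Proof.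
move=> x1 sx.
have x0 : x != 0 by rewrite -normr_gt0; apply: lt_le_trans x1.
have dx : `|x| / 2 <= `|s - x|.
  by rewrite distrC; apply: le_trans (lerB_dist _ _); lra.
have nd : s - x != 0 by rewrite -normr_gt0; apply: lt_le_trans dx; lra.
have -> : (s - x)^-1 - (0 - x)^-1 = s / (x * (s - x)) by field; rewrite nd x0.
have pos : 0 < x ^+ 2 + 1 by have := sqr_ge0 x; lra.
rewrite normrM normfV -mulrA [leRHS](_ : _ = `|s| * (4 / (x ^+ 2 + 1))); last by rewrite /imK expr1n; ring.
apply: ler_wpM2l => //; rewrite normrM.
have x2 : `|x| * `|x| = x ^+ 2 by rewrite -expr2 real_normK ?num_real.
have key : (x ^+ 2 + 1) / 4 <= `|x| * `|s - x|.
  have h1 : `|x| * (`|x| / 2) <= `|x| * `|s - x| by apply: ler_wpM2l.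
  have h2 : 1 * 1 <= `|x| * `|x| by apply: ler_pM.
  rewrite mulrA x2 in h1; rewrite x2 in h2; lra.
have p4 : 0 < (x ^+ 2 + 1) / 4 by lra.
rewrite (_ : 4 / (x ^+ 2 + 1) = ((x ^+ 2 + 1) / 4)^-1); last by field; rewrite gt_eqF.
by rewrite lef_pV2// posrE; apply: lt_le_trans key.
Qed.

(** Convergence at 0 gives convergence at every s, because the difference of the kernels
is integrable. One exceptional null set then serves all s. *)
Lemma F_trunc_cauchy (mu : wpm R) (s : R) : cauchy_at_infty (fun A => F_trunc mu A 0) -> imK_integrable mu ->
  cauchy_at_infty (fun A => F_trunc mu A s).
Proof.
move=> c0 tm e e0.
have e2 : 0 < e / 2 by rewrite divr_gt0.
pose c := 4 * `|s| + 1.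
have cp : 0 < c by rewrite ltr_wpDl// mulr_ge0.
have ec : 0 < e / (4 * c) by rewrite divr_gt0// mulr_gt0.
have [A1 H1] := c0 _ e2.
have i0 x : [set: R] x -> (0 <= (imK 1 x)%:E :> \bar R)%E by rewrite lee_fin imK_ge0.
have mi : measurable_fun [set: R] (fun x : R => (imK 1 x)%:E).
  by apply/measurable_EFinP; exact: measurable_imK.
have [A2 H2] := @tail_integral _ _ _ mu (fun x : R => `|x|) setT _ (@normr_measurable _ _) measurableT mi i0 tm _ ec.
exists (Num.max A1 (Num.max A2 (Num.max 1 (2 * `|s|)))) => A B; rewrite !ge_max => /and4P[A1A A2A A1' As] AB.
pose H x := (s - x)^-1 - (0 - x)^-1.
have mH : measurable_fun [set: R] H by apply: measurable_funB; exact: measurable_pole.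
have A0 : 0 <= A by lra.
have AB0 : 0 <= A <= B by rewrite A0 AB.
have HE L : \int[mu]_(x in `[- L, L]) H x = F_trunc mu L s - F_trunc mu L 0.
  by rewrite RintegralB//; apply: (@wpm_integrable _ _ (- L) L) => //; apply: measurable_funTS; exact: measurable_pole.
have ray_le b : `|\int[mu]_(x in ray b A B) H x| <= e / 4.
  have mr := measurable_ray b A B; have sr := @ray_sub R b A B A0.
  have Hi : mu.-integrable (ray b A B) (EFin \o H) by apply: wpm_integrable mr sr _; exact: measurable_funTS.
  have ii : mu.-integrable (ray b A B) (EFin \o imK 1).
    by apply: wpm_integrable mr sr _; apply: measurable_funTS; exact: measurable_imK.
  have far x : ray b A B x -> A <= `|x|.
    by case: b {mr sr Hi ii} => /andP[h _]; [have := ler_norm x|have := ler_norm (- x); rewrite normrN]; move: h; rewrite /flip; lra.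
  apply: le_trans (le_normr_Rintegral mr Hi) _.
  apply: (@le_trans _ _ (\int[mu]_(x in ray b A B) (c * imK 1 x))).
    apply: le_Rintegral => //; [exact: integrable_norm|exact: integrableZ_EFin|].
    move=> x /far Ax; apply: le_trans (pole_shift_le _ _) _; try lra.
    by apply: ler_wpM2r; [exact: imK_ge0|rewrite lerDl].
  rewrite RintegralZl// mulrC -ler_pdivlMr// -lee_fin (@EFin_Rintegral mu (- B) B _ _ mr sr); last first.
    by apply: measurable_funTS; exact: measurable_imK.
  rewrite (_ : e / 4 / c = e / (4 * c)); last by field; rewrite gt_eqF.
  apply: le_trans (H2 A A2A); apply: ge0_subset_integral => //.
  - rewrite setTI (_ : [set y : R | _] = (fun y : R => `|y|) @^-1` `[A, +oo[%classic).
      by rewrite -[X in measurable X]setTI; apply: normr_measurable.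
    by apply/seteqP; split => y /=; rewrite in_itv/= andbT.
  - exact: measurable_funTS.
  - by move=> x _; exact: i0.
  - by move=> x /far Ax.
have -> : F_trunc mu B s - F_trunc mu A s = (F_trunc mu B 0 - F_trunc mu A 0) +
   (\int[mu]_(x in ray true A B) H x + \int[mu]_(x in ray false A B) H x).
  by rewrite -window_sub// !HE; ring.
have h1 := H1 A B A1A AB; have h2 := ray_le true; have h3 := ray_le false.
apply: le_trans (ler_normD _ _) _; have := ler_normD (\int[mu]_(x in ray true A B) H x) (\int[mu]_(x in ray false A B) H x).
lra.
Qed.

Lemma ae_cvg_F_trunc : {ae P, forall w, forall s : R, cvg (F_trunc (Mw w) A s @[A --> +oo])}.
Proof.
apply: filterS2 (ae_disc_integrable K0 stM intM gint) ae_imK_integrable => w gw tw s.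
by apply/cauchy_at_inftyP; apply: F_trunc_cauchy => //; exact: F_trunc_cauchy0 gw.
Qed.

(** The error bound at radius A: let the radius n of the outer window tend to infinity. *)
Lemma mean_F_pv_F_sym (s A : R) : 1 <= A ->
  (mabs P (fun w => (F_pv (Mw w) s - F_sym (Mw w) A s)%R) <= tail_bound g A)%E.
Proof.
move=> A1.
apply: (@mabs_limit _ _ _ P (fun n w => F_trunc (Mw w) n%:R s - F_sym (Mw w) A s)).
- by move=> n; apply: measurable_funB; [exact: measurable_F_truncM|exact: measurable_F_symM].
- by apply: measurable_funB; [exact: measurable_F_pvM|exact: measurable_F_symM].
- apply: filterS ae_cvg_F_trunc => w cw; apply: cvgB; last exact: cvg_cst.
  exact: cvg_at_infty_nat.
move=> e e0; have e4 : 0 < e / 4 by rewrite divr_gt0.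
have [A0 [A01 HA0]] := g_sublinear K0 stM intM gint e4.
pose c := K * (4 * `|s| + 4).
have c0 : 0 <= c by rewrite mulr_ge0 ?ltW// ltr_wpDl// mulr_ge0.
have [N HN] := nat_large (Num.max A (Num.max A0 (2 * `|s| + 2 * c / e))).
exists N => n /HN; rewrite !gt_max => /and3P[nA nA0 ns].
have ce : 0 <= 2 * c / e by apply: divr_ge0; [exact: mulr_ge0|exact: ltW].
have s0 := normr_ge0 s.
have nn : 0 < n%:R :> R by lra.
apply: le_trans (mean_F_trunc_sym K0 stM intM _ _) _; [by rewrite A1|lra|].
rewrite -addeA leeD2l// (_ : e%:E = (e / 2)%:E + (e / 2)%:E)%E; last first.
  by rewrite -EFinD; congr EFin; field.
apply: leeD.
  rewrite (_ : (e / 2)%:E = 2%:E * (e / 4)%:E)%E; last by rewrite -EFinM; congr EFin; field.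
  rewrite lee_pmul2l// -(fineK (g_fin K0 stM intM (ltW nn))) -EFinM lee_fin ler_pdivrMr//.
  by apply: HA0; exact: ltW.
rewrite lee_fin -/c ler_pdivrMr; last lra.
have : 2 * c / e <= n%:R - 2 * `|s| by lra.
by rewrite ler_pdivrMr// => h; lra.
Qed.

End principal_value.

(** * Poisson kernels at a resolvent *)

Section poisson_kernels.
Context {R : realType}.
Implicit Types a b u v : R.

Lemma reK_norm_le (eta u : R) : u != 0 -> `|reK eta u| <= `|u|^-1.
Proof.
rewrite neq_lt => /orP[u0|u0]; last by rewrite (gtr0_norm u0) reK_le.
have Nu0 : 0 < - u by rewrite oppr_gt0.
by rewrite (ltr0_norm u0); have := reK_le eta Nu0; rewrite reKN normrN.
Qed.

Lemma imK_norm_le (eta u : R) : u != 0 -> `|imK eta u| <= `|u|^-1.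
Proof.
rewrite neq_lt => /orP[u0|u0]; last by rewrite (gtr0_norm u0) imK_le.
have Nu0 : 0 < - u by rewrite oppr_gt0.
by rewrite -(opprK u) imKN normrN (gtr0_norm Nu0) imK_le.
Qed.

(** |1/z - 1/z'|^2 = |z - z'|^2 / |z z'|^2 in coordinates. *)
Lemma inv_dist_sqr (X Y X' Y' : R) : X ^+ 2 + Y ^+ 2 != 0 -> X' ^+ 2 + Y' ^+ 2 != 0 ->
  (Y / (X ^+ 2 + Y ^+ 2) - Y' / (X' ^+ 2 + Y' ^+ 2)) ^+ 2 +
  (X / (X ^+ 2 + Y ^+ 2) - X' / (X' ^+ 2 + Y' ^+ 2)) ^+ 2 =
  ((X - X') ^+ 2 + (Y - Y') ^+ 2) / ((X ^+ 2 + Y ^+ 2) * (X' ^+ 2 + Y' ^+ 2)).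
Proof. by move=> h h'; field; rewrite h h'. Qed.

Lemma inv_lipschitz (b X Y X' Y' : R) : 0 < b -> b <= Y -> b <= Y' ->
  `|Y / (X ^+ 2 + Y ^+ 2) - Y' / (X' ^+ 2 + Y' ^+ 2)| <= (`|X - X'| + `|Y - Y'|) / b ^+ 2 /\
  `|X / (X ^+ 2 + Y ^+ 2) - X' / (X' ^+ 2 + Y' ^+ 2)| <= (`|X - X'| + `|Y - Y'|) / b ^+ 2.
Proof.
move=> b0 bY bY'.
have low (x y : R) : b <= y -> b ^+ 2 <= x ^+ 2 + y ^+ 2.
  move=> h; have : b ^+ 2 <= y ^+ 2 by rewrite ler_pXn2r// nnegrE; lra.
  by have := sqr_ge0 x; lra.
have b2 : 0 < b ^+ 2 by rewrite exprn_gt0.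
have h := low X Y bY; have h' := low X' Y' bY'.
have p : 0 < X ^+ 2 + Y ^+ 2 by lra. have p' : 0 < X' ^+ 2 + Y' ^+ 2 by lra.
have n : X ^+ 2 + Y ^+ 2 != 0 by rewrite gt_eqF.
have n' : X' ^+ 2 + Y' ^+ 2 != 0 by rewrite gt_eqF.
set c := (_ + _) / b ^+ 2.
have c0 : 0 <= c by rewrite divr_ge0 ?addr_ge0// ltW.
have cle : ((X - X') ^+ 2 + (Y - Y') ^+ 2) / ((X ^+ 2 + Y ^+ 2) * (X' ^+ 2 + Y' ^+ 2)) <= c ^+ 2.
  rewrite /c expr_div_n; apply: ler_pM.
  - by rewrite addr_ge0 ?sqr_ge0.
  - by rewrite invr_ge0 ltW// mulr_gt0.
  - have e (x : R) : x ^+ 2 = `|x| ^+ 2 by rewrite real_normK ?num_real.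
    rewrite (e (X - X')) (e (Y - Y')) sqrrD lerD2r lerDl mulrn_wge0// mulr_ge0//.
  - rewrite lef_pV2 ?posrE ?exprn_gt0 ?mulr_gt0// expr2; apply: ler_pM => //; exact: ltW.
have key (x y : R) : x ^+ 2 + y ^+ 2 <= c ^+ 2 -> `|x| <= c.
  move=> hx; rewrite -(@ler_pXn2r _ 2) ?nnegrE// real_normK ?num_real//.
  by have := sqr_ge0 y; lra.
rewrite -(inv_dist_sqr n n') in cle.
by split; [exact: key cle|apply: key; rewrite addrC; exact: cle].
Qed.

Lemma poisson_lipschitz a b u v u' v' : 0 < b -> 0 <= v -> 0 <= v' ->
  `|poisson a b u v - poisson a b u' v'| <= (`|u - u'| + `|v - v'|) / b ^+ 2 /\
  `|cpoisson a b u v - cpoisson a b u' v'| <= (`|u - u'| + `|v - v'|) / b ^+ 2.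
Proof.
move=> b0 v0 v0'.
have := @inv_lipschitz b (u - a) (v + b) (u' - a) (v' + b) b0.
rewrite !lerDr => /(_ v0 v0').
by rewrite (_ : u - a - (u' - a) = u - u') 1?(_ : v + b - (v' + b) = v - v')//; ring.
Qed.

Lemma poisson_bound a b u v : 0 < b -> 0 <= v ->
  `|poisson a b u v| <= b^-1 /\ `|cpoisson a b u v| <= b^-1.
Proof.
move=> b0 v0; rewrite /poisson /cpoisson; set X := u - a; set Y := v + b.
have bY : b <= Y by rewrite /Y lerDr.
have Y0 : 0 < Y by lra.
have D0 : 0 < X ^+ 2 + Y ^+ 2 by rewrite ltr_wpDl ?sqr_ge0// exprn_gt0.
have YY : b * Y <= Y * Y by rewrite ler_pM2r.
split; rewrite normrM normfV (gtr0_norm D0) ler_pdivrMr// -ler_pdivrMl ?invr_gt0// invrK.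
  by rewrite gtr0_norm// expr2 expr2; have := sqr_ge0 X; rewrite expr2; lra.
have e : X ^+ 2 = `|X| * `|X| by rewrite -expr2 real_normK ?num_real.
have := sqr_ge0 (`|X| - Y); rewrite sqrrB -expr2 in e *; rewrite e.
have : b * `|X| <= Y * `|X| by rewrite ler_wpM2r.
have := mulr_ge0 (normr_ge0 X) (ltW Y0); rewrite !expr2; lra.
Qed.

Lemma measurable_poisson d (T : measurableType d) a b (U V : T -> R) :
  measurable_fun [set: T] U -> measurable_fun [set: T] V ->
  measurable_fun [set: T] (fun w => poisson a b (U w) (V w)) /\
  measurable_fun [set: T] (fun w => cpoisson a b (U w) (V w)).
Proof.
move=> mU mV.
have mX : measurable_fun [set: T] (fun w => U w - a) by exact: measurable_funB.
have mY : measurable_fun [set: T] (fun w => V w + b) by exact: measurable_funD.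
have mD : measurable_fun [set: T] (fun w => ((U w - a) ^+ 2 + (V w + b) ^+ 2)^-1).
  apply: measurableT_comp measurable_inv _; apply: measurable_funD; exact: measurable_funX.
by split; exact: measurable_funM.
Qed.

End poisson_kernels.

Section poisson_law.
Context d (T : measurableType d) (R : realType) (P : probability T R).
Variables (M : {RV P >-> vague_borel R}) (K : R).
Hypotheses (K0 : 0 < K) (stM : stationary M) (intM : intensity M = K%:E).
Notation VB := (vague_borel R).
Notation leb := (@lebesgue_measure R).
Local Notation Mw w := (M w : wpm R).
Local Notation g := (discrepancy M K).

(** Adding the constant c reduces the bounded case to the nonnegative one. *)
Lemma rmean_shift (t c : R) (Phi : VB -> R) : measurable_fun [set: VB] Phi ->
  (forall mu, `|Phi mu| <= c) ->
  rmean P (fun w => Phi (wpm_shift t (Mw w))) = rmean P (fun w => Phi (Mw w)).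
Proof.
move=> mPhi Pc.
have mS := measurableT_comp (measurable_wpm_shift t) (measurable_M M).
have mS' : measurable_fun [set: T] (fun w => Phi (wpm_shift t (Mw w))) := measurableT_comp mPhi mS.
have mP : measurable_fun [set: T] (fun w => Phi (Mw w)) := measurableT_comp mPhi (measurable_M M).
have addc (f : T -> R) : measurable_fun [set: T] f -> (forall w, `|f w| <= c) ->
    rmean P f = fine (\int[P]_w (f w + c)%:E) - c.
  move=> mf fc; have fi := bounded_integrable P mf fc.
  rewrite -[X in _ - X](rmean_cst P c) /rmean -RintegralB//.
  - by apply: eq_Rintegral => w _ /=; rewrite addrK.
  - apply: (@bounded_integrable _ _ _ P _ (c + `|c|)); first exact: measurable_funD.
    by move=> w; apply: le_trans (ler_normD _ _) _; rewrite lerD2r.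
  - exact: finite_measure_integrable_cst.
rewrite (addc _ mS')// (addc _ mP)//; congr (fine _ - _).
apply: (@ge0_integral_shift _ _ _ P M stM t (fun mu => (Phi mu + c)%:E)).
  by apply/measurable_EFinP; exact: measurable_funD.
by move=> mu; rewrite lee_fin; have := Pc mu; rewrite ler_norml => /andP[]; lra.
Qed.

(** A Poisson or conjugate kernel evaluated at the resolvent of the window [-n, n]. *)
Definition resolvent_test (k : R -> R -> R -> R -> R) a b (mu : wpm R) (n p eta : R) : R :=
  k a b (window_int mu (reK eta) n p) (window_int mu (imK eta) n p).

(** One finite list of atoms serves all kernels, heights and points at once. *)
Lemma window_int_polesum (mu : wpm R) (n : R) : exists (s : seq R) (w : R -> R),
  (forall x, 0 <= w x) /\ forall k eta p, measurable_fun [set: R] (k eta) ->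
     window_int mu (k eta) n p = polesum s w k p eta.
Proof.
have [s [w [_ sn ms]]] := finite_atoms mu (- n) n.
exists s, (fun x => `|w x|); split => // k eta p mk.
rewrite /window_int; have [|_ ->] := @integral_atoms _ mu s w (- n) n ms _ (fun x => k eta (p - x)) (measurable_itv _) (@subset_refl _ _).
  by apply: measurable_funTS; exact: measurable_reflect.
rewrite /polesum big_seq_cond [RHS]big_seq; apply: eq_bigl => x.
by case: (boolP (x \in s)) => //= /sn[xn _]; rewrite mem_cc xn.
Qed.

Lemma window_int_imK_ge0 (mu : wpm R) eta n p : 0 <= eta -> 0 <= window_int mu (imK eta) n p.
Proof. by move=> e0; apply: Rintegral_ge0 => x _; exact: imK_ge0. Qed.

Lemma measurable_resolvent_test a b n p eta :
  measurable_fun [set: T] (fun w => resolvent_test poisson a b (Mw w) n p eta) /\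
  measurable_fun [set: T] (fun w => resolvent_test cpoisson a b (Mw w) n p eta).
Proof.
by apply: measurable_poisson; apply: measurable_window_int; [exact: measurable_reK|exact: measurable_imK].
Qed.

Variables (a b : R).
Hypothesis b0 : 0 < b.

Definition mean_poisson n eta := rmean P (fun w => resolvent_test poisson a b (Mw w) n 0 eta).

(** For the window centred at delta the mean would be exactly that at 0, by stationarity;
moving the window costs a vanishing amount. *)
Lemma rmean_cpoisson_shift (n delta eta : R) : 0 < eta -> 2 * `|delta| < n ->
  `|rmean P (fun w => resolvent_test cpoisson a b (Mw w) n delta eta) -
    rmean P (fun w => resolvent_test cpoisson a b (Mw w) n 0 eta)| <=
  2 / b ^+ 2 * (K * (4 * `|delta| + 4) / (n - 2 * `|delta|)).
Proof.
move=> e0 dn; have e0' := ltW e0.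
set W := K * _ / _.
pose c' mu := cpoisson a b (centred_int mu (reK eta) n delta) (centred_int mu (imK eta) n delta).
have ci0 (mu : wpm R) : 0 <= centred_int mu (imK eta) n delta by apply: Rintegral_ge0 => x _; exact: imK_ge0.
have mr := measurable_reK eta; have mi := measurable_imK eta.
have mwr := measurable_window_int M n delta mr; have mwi := measurable_window_int M n delta mi.
have mcr := measurable_centred_int M n delta mr; have mci := measurable_centred_int M n delta mi.
have mC : measurable_fun [set: T] (fun w => c' (Mw w)).
  by have [] := measurable_poisson a b mcr mci.
have mwP : measurable_fun [set: VB] (fun mu : VB => resolvent_test cpoisson a b (mu : wpm R) n 0 eta).
  have H k : measurable_fun [set: R] k -> measurable_fun [set: VB] (fun mu : VB => window_int (mu : wpm R) k n 0).
    by move=> mk; apply: measurable_mu_Rintegral => //; apply: measurable_funTS; exact: measurable_reflect.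
  by have [] := measurable_poisson a b (H _ mr) (H _ mi).
have <- : rmean P (fun w => c' (Mw w)) = rmean P (fun w => resolvent_test cpoisson a b (Mw w) n 0 eta).
  rewrite -(@rmean_shift delta b^-1 _ mwP); last first.
    by move=> mu; have [] := poisson_bound a (window_int mu (reK eta) n 0) b0 (window_int_imK_ge0 mu n 0 e0').
  by apply: eq_Rintegral => w _; rewrite /c' /resolvent_test !centred_int_shift.
apply: (@rmean_dist _ _ _ P _ _ b^-1) => //.
- by have [] := measurable_resolvent_test a b n delta eta.
- by move=> w; have [] := poisson_bound a (window_int (Mw w) (reK eta) n delta) b0 (window_int_imK_ge0 (Mw w) n delta e0').
- by move=> w; have [] := poisson_bound a (centred_int (Mw w) (reK eta) n delta) b0 (ci0 (Mw w)).
pose U w := `|window_int (Mw w) (reK eta) n delta - centred_int (Mw w) (reK eta) n delta|.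
pose V w := `|window_int (Mw w) (imK eta) n delta - centred_int (Mw w) (imK eta) n delta|.
have mU : measurable_fun [set: T] U by apply: measurableT_comp => //; exact: measurable_funB.
have mV : measurable_fun [set: T] V by apply: measurableT_comp => //; exact: measurable_funB.
have b20 : 0 <= (b ^+ 2)^-1 by rewrite invr_ge0 sqr_ge0.
apply: (@le_trans _ _ (mabs P (fun w => (b ^+ 2)^-1 * (U w + V w)))).
  apply: mabs_le.
  - by apply: measurable_funB => //; have [] := measurable_resolvent_test a b n delta eta.
  - by apply: measurable_funM => //; exact: measurable_funD.
  - apply: nearW => w; apply: le_trans _ (ler_norm _); rewrite mulrC.
    by have [] := poisson_lipschitz a (window_int (Mw w) (reK eta) n delta) (centred_int (Mw w) (reK eta) n delta)
       b0 (window_int_imK_ge0 (Mw w) n delta e0') (ci0 (Mw w)).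
rewrite mabsZ//; last exact: measurable_funD.
rewrite (_ : 2 / b ^+ 2 * W = (b ^+ 2)^-1 * (W + W)); last by ring.
rewrite EFinM; apply: lee_wpmul2l => //.
apply: le_trans (mabsD P mU mV) _; rewrite EFinD.
have norm_id (f : T -> R) : mabs P (fun w => `|f w|) = mabs P f.
  by apply: eq_integral => w _; rewrite normr_id.
rewrite !norm_id; apply: leeD.
- by apply: (mean_window K0 stM intM mr _ dn) => u u0; exact: reK_norm_le.
- by apply: (mean_window K0 stM intM mi _ dn) => u u0; exact: imK_norm_le.
Qed.

(** The step in height is traded for a step sideways by [poisson_step], which stationarity
makes negligible. *)
Lemma mean_poisson_step (n eta delta : R) : 0 < eta -> 0 < delta -> 2 * delta <= eta -> 2 * delta < n ->
  `|mean_poisson n (eta + delta) - mean_poisson n eta| <=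
  288 * delta ^+ 2 / (eta ^+ 2 * b) + 2 / b ^+ 2 * (K * (4 * delta + 4) / (n - 2 * delta)).
Proof.
move=> e0 d0 de dn; have e0' := ltW e0.
have ed0 : 0 <= eta + delta by rewrite addr_ge0// ltW.
pose c1 := 288 * delta ^+ 2 / (eta ^+ 2 * b).
pose p2 w := resolvent_test poisson a b (Mw w) n 0 (eta + delta).
pose p1 w := resolvent_test poisson a b (Mw w) n 0 eta.
pose q2 w := resolvent_test cpoisson a b (Mw w) n delta eta.
pose q1 w := resolvent_test cpoisson a b (Mw w) n 0 eta.
have mp2 : measurable_fun [set: T] p2 by have [] := measurable_resolvent_test a b n 0 (eta + delta).
have mp1 : measurable_fun [set: T] p1 by have [] := measurable_resolvent_test a b n 0 eta.
have mq2 : measurable_fun [set: T] q2 by have [] := measurable_resolvent_test a b n delta eta.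
have mq1 : measurable_fun [set: T] q1 by have [] := measurable_resolvent_test a b n 0 eta.
have bp2 w : `|p2 w| <= b^-1.
  by have [] := poisson_bound a (window_int (Mw w) (reK (eta + delta)) n 0) b0 (window_int_imK_ge0 (Mw w) n 0 ed0).
have bp1 w : `|p1 w| <= b^-1.
  by have [] := poisson_bound a (window_int (Mw w) (reK eta) n 0) b0 (window_int_imK_ge0 (Mw w) n 0 e0').
have bq2 w : `|q2 w| <= b^-1.
  by have [] := poisson_bound a (window_int (Mw w) (reK eta) n delta) b0 (window_int_imK_ge0 (Mw w) n delta e0').
have bq1 w : `|q1 w| <= b^-1.
  by have [] := poisson_bound a (window_int (Mw w) (reK eta) n 0) b0 (window_int_imK_ge0 (Mw w) n 0 e0').
have step w : `|(p2 w - p1 w) - (q2 w - q1 w)| <= c1.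
  have [s [m [m0 E]]] := window_int_polesum (Mw w) n.
  rewrite /p2 /p1 /q2 /q1 /resolvent_test !(E reK _ _ (measurable_reK _)) !(E imK _ _ (measurable_imK _)).
  have := @poisson_step R s m a b 0 eta delta m0 b0 e0 d0 de.
  by rewrite /pole_test add0r.
have sub f h (F H : T -> R) (c : R) : measurable_fun [set: T] F -> measurable_fun [set: T] H ->
   (forall w, `|F w| <= c) -> (forall w, `|H w| <= c) -> rmean P F = f -> rmean P H = h ->
   rmean P (fun w => F w - H w) = f - h.
  move=> mF mH bF bH <- <-; rewrite /rmean RintegralB//; exact: bounded_integrable.
have shift := rmean_cpoisson_shift (n := n) (delta := delta) e0.
rewrite (gtr0_norm d0) in shift; have {}shift := shift dn.
have h := @rmean_dist _ _ _ P (fun w => p2 w - p1 w) (fun w => q2 w - q1 w) (b^-1 + b^-1) c1 (measurable_funB mp2 mp1) (measurable_funB mq2 mq1).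
have {}h : `|rmean P (fun w => p2 w - p1 w) - rmean P (fun w => q2 w - q1 w)| <= c1.
  apply: h.
  - by move=> w; apply: le_trans (ler_normB _ _) (lerD _ _).
  - by move=> w; apply: le_trans (ler_normB _ _) (lerD _ _).
  have c10 : 0 <= c1 by rewrite /c1 divr_ge0// ?mulr_ge0 ?sqr_ge0// ltW.
  apply: (@le_trans _ _ (mabs P (cst c1))); last by rewrite mabs_cst ger0_norm.
  apply: mabs_le => //; first exact: measurable_funB (measurable_funB _ _) (measurable_funB _ _).
  by apply: nearW => w; rewrite /= (ger0_norm c10).
rewrite (sub _ _ _ _ _ mp2 mp1 bp2 bp1 erefl erefl) (sub _ _ _ _ _ mq2 mq1 bq2 bq1 erefl erefl) in h.
rewrite -/c1 /mean_poisson -/p2 -/p1.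
rewrite -[rmean P p2 - rmean P p1](subrK (rmean P q2 - rmean P q1)).
exact: le_trans (ler_normD _ _) (lerD h shift).
Qed.

(** Cut the segment from eta1 to eta2 into m steps. The errors of second order add up to
O(1/m), and for m fixed the window errors vanish as n grows. *)
Lemma mean_poisson_asymptotically_constant (eta1 eta2 : R) : 0 < eta1 < eta2 ->
  forall e, 0 < e -> exists N : nat, forall n : nat, (N <= n)%N -> `|mean_poisson n%:R eta2 - mean_poisson n%:R eta1| <= e.
Proof.
move=> /andP[e10 e12] e e0; pose D := eta2 - eta1.
have D0 : 0 < D by rewrite subr_gt0.
pose c := 288 * D ^+ 2 / (eta1 ^+ 2 * b).
have c0 : 0 < c by rewrite divr_gt0 ?mulr_gt0 ?exprn_gt0.
have [m0 Hm0] := nat_large (Num.max (2 * D / eta1) (2 * c / e)).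
(* m makes the steps at most eta1 / 2 and the total second order error at most e / 2 *)
pose m := m0.+1.
have := Hm0 m (leqnSn _); rewrite gt_max => /andP[m1 m2].
have mp : 0 < m%:R :> R by rewrite ltr0n.
pose delta := D / m%:R.
have d0 : 0 < delta by rewrite divr_gt0.
have de : 2 * delta <= eta1.
  by move: m1; rewrite ltr_pdivrMr// /delta mulrA ler_pdivrMr// [_ * eta1]mulrC => /ltW.
pose k := 2 / b ^+ 2 * (K * (4 * delta + 4)).
have k0 : 0 <= k.
  apply: mulr_ge0; first by rewrite divr_ge0// sqr_ge0.
  by apply: mulr_ge0; [exact: ltW|lra].
have [N HN] := nat_large (2 * delta + 2 * m%:R * k / e).
exists N => n /HN nbig.
have kk : 0 <= 2 * m%:R * k / e by apply: divr_ge0; [apply: mulr_ge0 k0; exact: mulr_ge0 (ltW mp)|exact: ltW].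
have nd : 2 * delta < n%:R by lra.
pose q := c / m%:R ^+ 2 + k / (n%:R - 2 * delta).
have step i : `|mean_poisson n%:R (eta1 + i%:R * delta + delta) - mean_poisson n%:R (eta1 + i%:R * delta)| <= q.
  have id0 : 0 <= i%:R * delta by rewrite mulr_ge0// ltW.
  apply: le_trans (mean_poisson_step _ d0 _ nd) _; [by lra|by lra|].
  rewrite /q; apply: lerD; last by rewrite mulrA.
  rewrite /c /delta expr_div_n.
  rewrite (_ : 288 * D ^+ 2 / (eta1 ^+ 2 * b) / m%:R ^+ 2 = 288 * (D ^+ 2 / m%:R ^+ 2) / (eta1 ^+ 2 * b)); last by ring.
  apply: ler_wpM2l; first by rewrite mulr_ge0// divr_ge0 ?sqr_ge0.
  have ei : eta1 <= eta1 + i%:R * (D / m%:R) by rewrite lerDl.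
  have ei0 := lt_le_trans e10 ei.
  rewrite lef_pV2 ?posrE ?mulr_gt0 ?exprn_gt0// ler_pM2r// ler_pXn2r ?nnegrE//; exact: ltW.
have tele i : `|mean_poisson n%:R (eta1 + i%:R * delta) - mean_poisson n%:R eta1| <= i%:R * q.
  elim: i => [|i IH]; first by rewrite !mul0r addr0 subrr normr0.
  have -> : eta1 + i.+1%:R * delta = eta1 + i%:R * delta + delta by rewrite -addn1 natrD; ring.
  have -> : i.+1%:R * q = q + i%:R * q by rewrite -addn1 natrD; ring.
  rewrite -[X in `|X|](subrKA (mean_poisson n%:R (eta1 + i%:R * delta))).
  exact: le_trans (ler_normD _ _) (lerD (step i) IH).
have := tele m; rewrite (_ : eta1 + m%:R * delta = eta2); last first.
  by rewrite /delta mulrC divfK ?gt_eqF// /D; ring.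
move=> /le_trans; apply; rewrite /q mulrDr.
have -> : m%:R * (c / m%:R ^+ 2) = c / m%:R by field; rewrite gt_eqF.
have h1 : c / m%:R <= e / 2.
  rewrite ler_pdivrMr//; move: m2; rewrite ltr_pdivrMr// => /ltW; lra.
have h2 : m%:R * (k / (n%:R - 2 * delta)) <= e / 2.
  rewrite mulrA ler_pdivrMr; last by lra.
  have : 2 * m%:R * k / e <= n%:R - 2 * delta by lra.
  by rewrite ler_pdivrMr//; lra.
lra.
Qed.

End poisson_law.

(** * The limits of small and large height *)

Section poisson_law_limit.
Context d (T : measurableType d) (R : realType) (P : probability T R).
Variables (M : {RV P >-> vague_borel R}) (K : R).
Hypotheses (K0 : 0 < K) (stM : stationary M) (intM : intensity M = K%:E).
Notation VB := (vague_borel R).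
Notation leb := (@lebesgue_measure R).
Local Notation Mw w := (M w : wpm R).
Local Notation g := (discrepancy M K).
Variables (a b : R).
Hypothesis b0 : 0 < b.
Hypothesis gint : (\int[leb]_(y in `[1%R, +oo[) (g y * (y ^- 2)%:E) < +oo)%E.
Lemma mean_poisson_dist (U V U' V' : T -> R) :
  measurable_fun [set: T] U -> measurable_fun [set: T] V ->
  measurable_fun [set: T] U' -> measurable_fun [set: T] V' ->
  (forall w, 0 <= V w) -> (forall w, 0 <= V' w) -> forall e : R,
  (mabs P (fun w => (U w - U' w)%R) + mabs P (fun w => (V w - V' w)%R) <= (e * b ^+ 2)%:E)%E ->
  `|rmean P (fun w => poisson a b (U w) (V w)) - rmean P (fun w => poisson a b (U' w) (V' w))| <= e.
Proof.
move=> mU mV mU' mV' V0 V0' e He.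
have b2 : 0 < b ^+ 2 by rewrite exprn_gt0.
have [mp _] := measurable_poisson a b mU mV; have [mp' _] := measurable_poisson a b mU' mV'.
apply: (@rmean_dist _ _ _ P _ _ b^-1) => //.
- by move=> w; have [] := poisson_bound a (U w) b0 (V0 w).
- by move=> w; have [] := poisson_bound a (U' w) b0 (V0' w).
pose DU w := `|U w - U' w|; pose DV w := `|V w - V' w|.
have mDU : measurable_fun [set: T] DU by apply: measurableT_comp => //; exact: measurable_funB.
have mDV : measurable_fun [set: T] DV by apply: measurableT_comp => //; exact: measurable_funB.
apply: (@le_trans _ _ (mabs P (fun w => (b ^+ 2)^-1 * (DU w + DV w)))).
  apply: mabs_le.
  - exact: measurable_funB.
  - by apply: measurable_funM => //; exact: measurable_funD.
  - apply: nearW => w; apply: le_trans _ (ler_norm _); rewrite mulrC.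
    by have [] := poisson_lipschitz a (U w) (U' w) b0 (V0 w) (V0' w).
rewrite mabsZ ?invr_ge0 ?(ltW b2)//; last exact: measurable_funD.
rewrite lee_pdivrMl// -EFinM mulrC; apply: le_trans He.
have norm_id (f : T -> R) : mabs P (fun w => `|f w|) = mabs P f.
  by apply: eq_integral => w _; rewrite normr_id.
by apply: le_trans (mabsD P mDU mDV) _; rewrite !norm_id.
Qed.

(** Near 0 there are finitely many atoms, and an atom at 0 contributes nothing since 0^-1 = 0. *)
Lemma sqrV_integrable (mu : wpm R) : imK_integrable mu -> (\int[mu]_x (x ^- 2)%:E < +oo)%E.
Proof.
move=> tm.
have ms (D : set R) : measurable_fun D (fun x : R => (x ^- 2)%:E).
  by apply/measurable_EFinP; exact: sqrV_measurable.
have s0 (x : R) : (0 <= (x ^- 2)%:E :> \bar R)%E by rewrite lee_fin invr_ge0 sqr_ge0.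
have mI : measurable (`[-1, 1]%classic : set R) by exact: measurable_itv.
have mC : measurable (~` (`[-1, 1]%classic : set R)) by exact: measurableC.
have -> : (\int[mu]_x (x ^- 2)%:E = \int[mu]_(x in `[(-1)%R, 1%R]) (x ^- 2)%:E + \int[mu]_(x in ~` `[(-1)%R, 1%R]) (x ^- 2)%:E)%E.
  rewrite -ge0_integral_setU//.
  - by rewrite setUv.
  - by rewrite disj_set2E setICr.
apply: lte_add_pinfty.
  rewrite -(@EFin_Rintegral _ mu (-1) 1)// ?ltry//.
  by apply: sqrV_measurable.
apply: (@le_lt_trans _ _ (\int[mu]_(x in ~` `[(-1)%R, 1%R]) (2%:E * (imK 1 x)%:E))%E).
  apply: ge0_le_integral => //.
  - by apply: measurable_funTS; apply: measurable_funeM; apply/measurable_EFinP; exact: measurable_imK.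
  - move=> x /=; rewrite in_itv/= -ler_norml => /negP; rewrite -ltNge => x1.
    have x2 : 1 < x ^+ 2 by rewrite -(real_normK (num_real x)) exprn_egt1.
    rewrite -EFinM lee_fin /imK expr1n div1r ler_pdivlMr; last lra.
    by rewrite mulrC ler_pdivrMr; lra.
rewrite ge0_integralZl//.
- apply: lte_mul_pinfty => //; apply: le_lt_trans tm; apply: ge0_subset_integral => //.
  + by apply/measurable_EFinP; exact: measurable_imK.
  + by move=> x _; rewrite lee_fin imK_ge0.
- by apply: measurable_funTS; apply/measurable_EFinP; exact: measurable_imK.
- by move=> x _; rewrite lee_fin imK_ge0.
Qed.

Definition sqrV_mass (mu : wpm R) := fine (\int[mu]_x (x ^- 2)%:E)%E.

Lemma sqrV_mass_ge (mu : wpm R) (D : set R) (n : R) : imK_integrable mu -> measurable D -> D `<=` `[- n, n] ->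
  \int[mu]_(x in D) x ^- 2 <= sqrV_mass mu.
Proof.
move=> tm mD sD; rewrite -lee_fin (@EFin_Rintegral _ mu (- n) n)//; last exact: sqrV_measurable.
rewrite /sqrV_mass fineK; last first.
  rewrite ge0_fin_numE ?sqrV_integrable//; apply: integral_ge0 => x _.
  by rewrite lee_fin invr_ge0 sqr_ge0.
apply: ge0_subset_integral => //.
- by apply/measurable_EFinP; exact: sqrV_measurable.
- by move=> x _; rewrite lee_fin invr_ge0 sqr_ge0.
Qed.

Lemma kernel_mass_le (mu : wpm R) (k : R -> R) (D : set R) (n c : R) : imK_integrable mu -> measurable D ->
  D `<=` `[- n, n] -> 0 <= c -> measurable_fun [set: R] k -> (forall x, D x -> `|k x| <= c * x ^- 2) ->
  `|\int[mu]_(x in D) k x| <= c * sqrV_mass mu.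
Proof.
move=> tm mD sD c0 mk kle.
have ki : mu.-integrable D (EFin \o k) by apply: wpm_integrable mD sD _; exact: measurable_funTS.
have si : mu.-integrable D (EFin \o (fun x => x ^- 2)) by apply: wpm_integrable mD sD _; exact: sqrV_measurable.
apply: le_trans (le_normr_Rintegral mD ki) _.
apply: (@le_trans _ _ (\int[mu]_(x in D) (c * x ^- 2))).
  by apply: le_Rintegral => //; [exact: integrable_norm|exact: integrableZ_EFin].
by rewrite RintegralZl//; apply: ler_wpM2l => //; exact: sqrV_mass_ge sD.
Qed.

(** Both differences of kernels are at most eta / x^2. *)
Lemma window_int_eta0 (mu : wpm R) (n eta : R) : imK_integrable mu -> mu [set 0] = 0%E -> 0 <= n -> 0 < eta ->
  `|window_int mu (reK eta) n 0 - window_int mu (reK 0) n 0| + `|window_int mu (imK eta) n 0 - window_int mu (imK 0) n 0| <=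
  3 * eta * sqrV_mass mu.
Proof.
move=> tm mu0 n0 e0; have e0' := ltW e0.
have mr (eta' : R) := measurable_reflect 0 (measurable_reK eta').
have key (x : R) : `|reK eta (0 - x) - reK 0 (0 - x)| <= eta * x ^- 2.
  rewrite sub0r !reKN -opprD normrN reK0 /reK.
  have [->|x0] := eqVneq x 0; first by rewrite mul0r invr0 subrr normr0 mulr_ge0// invr_ge0 sqr_ge0.
  have x2 : 0 < x ^+ 2 by rewrite exprn_even_gt0.
  have p : 0 < x ^+ 2 + eta ^+ 2 by rewrite addr_gt0// exprn_gt0.
  rewrite (_ : x / (x ^+ 2 + eta ^+ 2) - x^-1 = - (eta ^+ 2 / (x * (x ^+ 2 + eta ^+ 2)))); last first.
    by field; rewrite x0 gt_eqF.
  rewrite normrN normrM normfV [`|x * _|]normrM (gtr0_norm p) (@ger0_norm _ (eta ^+ 2)) ?sqr_ge0//.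
  have ax : 0 < `|x| by rewrite normr_gt0.
  rewrite ler_pdivrMr ?mulr_gt0// mulrAC ler_pdivlMr//.
  have ex : x ^+ 2 = `|x| ^+ 2 by rewrite real_normK ?num_real.
  rewrite ex in p *; have := mulr_ge0 (mulr_ge0 e0' (ltW ax)) (sqr_ge0 (`|x| - eta)).
  by have := mulr_gt0 (mulr_gt0 e0 ax) (mulr_gt0 e0 ax); rewrite !expr2; nra.
have Sge : 0 <= sqrV_mass mu by apply: fine_ge0; apply: integral_ge0 => x _; rewrite lee_fin invr_ge0 sqr_ge0.
have re_le : `|window_int mu (reK eta) n 0 - window_int mu (reK 0) n 0| <= eta * sqrV_mass mu.
  have -> : window_int mu (reK eta) n 0 - window_int mu (reK 0) n 0 = \int[mu]_(x in `[- n, n]) (reK eta (0 - x) - reK 0 (0 - x)).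
    by rewrite RintegralB//; apply: (@wpm_integrable _ _ (- n) n) => //; apply: measurable_funTS; exact: mr.
  apply: (@kernel_mass_le _ _ _ n) => //.
  by apply: measurable_funB.
have im_le b' : `|\int[mu]_(x in ray b' 0 n) imK eta (flip b' x)| <= eta * sqrV_mass mu.
  apply: (@kernel_mass_le _ (fun x => imK eta (flip b' x)) _ n) => //.
  - exact: measurable_ray.
  - exact: ray_sub.
  - exact: measurableT_comp (measurable_imK eta) (measurable_flip b').
  - move=> x /andP[x0 _]; rewrite (_ : imK eta (flip b' x) = imK eta x); last by case: b' x0 => //=; rewrite imKN.
    have x2 : 0 < x ^+ 2.
      by rewrite exprn_even_gt0//=; move: x0; rewrite /flip; case: b' => /=; lra.
    rewrite ger0_norm ?imK_ge0// /imK; apply: ler_wpM2l => //.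
    by rewrite lef_pV2 ?posrE//; [rewrite lerDl sqr_ge0|rewrite addr_gt0// exprn_gt0].
have -> : window_int mu (imK 0) n 0 = 0.
  by rewrite /window_int /Rintegral integral0_eq// => x _; rewrite imK0.
rewrite subr0 window_int_imK// mu0 mul0r addr0.
have h1 := im_le true; have h2 := im_le false.
have := ler_normD (\int[mu]_(x in ray true 0 n) imK eta (flip true x)) (\int[mu]_(x in ray false 0 n) imK eta (flip false x)).
lra.
Qed.

Lemma measurable_sqrV_mass : measurable_fun [set: T] (fun w => sqrV_mass (Mw w)).
Proof.
apply: (measurableT_comp (f := fun mu : VB => fine (\int[(mu : wpm R)]_x (x ^- 2)%:E)%E)); last exact: measurable_M.
apply: measurableT_comp => //; apply: (measurable_mu_integral (f := fun x => (x ^- 2)%:E)).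
- by move=> x; rewrite lee_fin invr_ge0 sqr_ge0.
- by apply/measurable_EFinP; exact: sqrV_measurable.
Qed.

Local Notation mean_poisson := (mean_poisson M a b).

(** The approximation of height 0 is uniform in the window, since it is controlled by the
full integral of 1 / x^2. *)
Lemma mean_poisson_eta0 (e : R) : 0 < e -> exists2 eta, 0 < eta & forall n : nat, `|mean_poisson n%:R eta - mean_poisson n%:R 0| <= e.
Proof.
move=> e0; pose S w := sqrV_mass (Mw w).
have S0 w : 0 <= S w by apply: fine_ge0; apply: integral_ge0 => x _; rewrite lee_fin invr_ge0 sqr_ge0.
have c0 : 0 <= b^-1 + b^-1 by rewrite addr_ge0// invr_ge0 ltW.
have b2 : 0 < b ^+ 2 by rewrite exprn_gt0.
(* the difference of two kernels is bounded, and Lipschitz in the resolvent *)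
pose f (k : nat) w := Num.min (b^-1 + b^-1) (3 * k.+1%:R^-1 * S w / b ^+ 2).
have f0 k w : 0 <= f k w.
  by rewrite le_min c0/= divr_ge0 ?sqr_ge0// mulr_ge0// mulr_ge0// invr_ge0.
have mf k : measurable_fun [set: T] (f k).
  apply: measurable_minr => //; apply: measurable_funM => //; apply: measurable_funM => //.
  exact: measurable_sqrV_mass.
have fc k w : `|f k w| <= b^-1 + b^-1 by rewrite ger0_norm// ge_min lexx.
have : rmean P (f k) @[k --> \oo] --> rmean P (cst 0).
  apply: rmean_cvg fc _ => //; apply: nearW => w.
  apply: (@squeeze_cvgr _ _ _ _ (cst 0) (fun k => (3 * S w / b ^+ 2) * harmonic k)).
  - apply: nearW => k; rewrite f0/= ge_min; apply/orP; right.
    by rewrite le_eqVlt; apply/orP; left; apply/eqP; rewrite /harmonic /=; ring.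
  - exact: cvg_cst.
  - by rewrite /= -[X in _ --> X](mulr0 (3 * S w / b ^+ 2)); apply: cvgMr; exact: cvg_harmonic.
rewrite rmean_cst => /cvgrPdist_le/(_ _ e0)[k _ /(_ k (leqnn k))] /=.
rewrite sub0r normrN => fk; exists k.+1%:R^-1 => // n.
set eta := k.+1%:R^-1 in fk *; have eta0 : 0 < eta by rewrite /eta invr_gt0 ltr0n.
have mp eta' : measurable_fun [set: T] (fun w => resolvent_test poisson a b (Mw w) n%:R 0 eta').
  by have [] := measurable_resolvent_test M a b n%:R 0 eta'.
have bp w eta' : 0 <= eta' -> `|resolvent_test poisson a b (Mw w) n%:R 0 eta'| <= b^-1.
  by move=> h; have [] := poisson_bound a (window_int (Mw w) (reK eta') n%:R 0) b0 (window_int_imK_ge0 (Mw w) n%:R 0 h).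
apply: (@rmean_dist _ _ _ P _ _ b^-1) => //.
- by move=> w; apply: bp; exact: ltW.
- by move=> w; exact: bp.
apply: (@le_trans _ _ (mabs P (f k))).
  apply: mabs_le => //; first exact: measurable_funB.
  apply: filterS2 (ae_imK_integrable K0 stM intM gint) (ae_no_atom K0 stM intM 0) => w tw aw.
  rewrite [leRHS]ger0_norm// le_min; apply/andP; split.
    by apply: le_trans (ler_normB _ _) (lerD _ _); apply: bp => //; exact: ltW.
  have [h _] := poisson_lipschitz a (window_int (Mw w) (reK eta) n%:R 0) (window_int (Mw w) (reK 0) n%:R 0)
     b0 (window_int_imK_ge0 (Mw w) n%:R 0 (ltW eta0)) (window_int_imK_ge0 (Mw w) n%:R 0 (lexx 0)).
  apply: le_trans h _; rewrite ler_pM2r ?invr_gt0//.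
  exact: window_int_eta0.
have fe : (mabs P (f k) = (rmean P (f k))%:E)%E.
  rewrite /rmean /Rintegral fineK; last by apply: integrable_fin_num => //; exact: bounded_integrable (fc k).
  by apply: eq_integral => w _; rewrite ger0_norm.
by rewrite fe lee_fin; apply: le_trans (ler_norm _) fk.
Qed.

(** Common estimate for the real and imaginary kernels: the bounds on k and dk are
the only properties used. *)
Lemma mean_ray_kernel b' (n eta : R) (k dk : R -> R) : 0 < n -> 0 < eta ->
  measurable_fun [set: R] k -> (forall y : R, is_derive y 1 k (dk y)) -> continuous dk ->
  `|k 0| <= eta^-1 -> `|k n| <= n^-1 -> (forall y, `|dk y| <= (y ^+ 2 + eta ^+ 2)^-1) ->
  (mabs P (fun w => (\int[Mw w]_(x in ray b' 0 n) k (flip b' x) - K * parts_cst k dk 0 n)%R) <=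
    g n * (n^-1)%:E + (2 * K / eta)%:E + \int[leb]_(y in `[0%R, +oo[) (g y * ((y ^+ 2 + eta ^+ 2)^-1)%:E))%E.
Proof.
move=> n0 e0 mk dfk ck k0 kn dkle.
have an : (0 : R) <= 0 < n by rewrite lexx n0.
have [_ HI] := mean_by_parts K0 stM intM b' an mk (fun y _ => dfk y) (continuous_in_subspaceT (fun y _ => ck y)).
apply: le_trans HI _; apply: leeD; first apply: leeD.
- by apply: lee_wpmul2l; [exact: discrepancy_ge0|rewrite lee_fin].
- rewrite EFinM; apply: lee_pmul => //; first exact: discrepancy_ge0.
  by apply: le_trans (discrepancy_bound K0 stM intM (lexx 0)) _; rewrite add0r mulr1.
have pos (y : R) : 0 < y ^+ 2 + eta ^+ 2 by rewrite ltr_wpDl ?sqr_ge0// exprn_gt0.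
have mG (D : set R) : measurable D -> D `<=` `[0, +oo[ -> measurable_fun D (fun y => g y * ((y ^+ 2 + eta ^+ 2)^-1)%:E)%E.
  move=> mD sD; apply: emeasurable_funM; first exact: measurable_discrepancy.
  apply/measurable_EFinP; apply: measurable_funTS; apply: continuous_measurable_fun.
  by apply: continuous_sqrDV; rewrite gt_eqF.
have sub : (`[0, n]%classic : set R) `<=` `[0, +oo[.
  by move=> y; rewrite /= !in_itv/= andbT => /andP[].
apply: (@le_trans _ _ (\int[leb]_(y in `[0%R, n]) (g y * ((y ^+ 2 + eta ^+ 2)^-1)%:E))%E).
  apply: ge0_le_integral => //.
  - by move=> y _; rewrite mule_ge0 ?discrepancy_ge0.
  - apply: emeasurable_funM; first exact: measurable_discrepancy.
    apply/measurable_EFinP; apply: measurable_funTS; apply: measurableT_comp => //.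
    exact: continuous_measurable_fun.
  - exact: mG.
  - by move=> y _; apply: lee_wpmul2l; [exact: discrepancy_ge0|rewrite lee_fin].
apply: ge0_subset_integral => //.
- exact: mG.
- by move=> y _; rewrite mule_ge0 ?discrepancy_ge0// lee_fin invr_ge0 ltW.
Qed.

(** Split at a point A0 beyond which the integral of g(y) / y^2 is small; on [0, A0] the
kernel is at most 1 / eta^2. *)
Lemma g_resolvent_small (e : R) : 0 < e -> exists2 H, 0 < H & forall eta, H <= eta ->
  (\int[leb]_(y in `[0%R, +oo[) (g y * ((y ^+ 2 + eta ^+ 2)^-1)%:E) <= e%:E)%E.
Proof.
move=> e0; have e2 : 0 < e / 2 by rewrite divr_gt0.
have [A0 [A01 HA]] := g_tail gint e2.
pose c := 2 * K * (A0 + 1) * A0.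
have A00 : 0 < A0 by lra.
have c0 : 0 < c by rewrite !mulr_gt0//; lra.
exists (1 + 2 * c / e); first by rewrite addr_gt0// divr_gt0// mulr_gt0.
move=> eta Heta.
have ce : 0 < 2 * c / e by rewrite divr_gt0// mulr_gt0.
have eta0 : 1 <= eta by lra.
have pos (y : R) : 0 < y ^+ 2 + eta ^+ 2 by rewrite ltr_wpDl ?sqr_ge0// exprn_gt0//; lra.
have mG (D : set R) : measurable D -> D `<=` `[0, +oo[ -> measurable_fun D (fun y => g y * ((y ^+ 2 + eta ^+ 2)^-1)%:E)%E.
  move=> mD sD; apply: emeasurable_funM; first exact: measurable_discrepancy.
  apply/measurable_EFinP; apply: measurable_funTS; apply: continuous_measurable_fun.
  by apply: continuous_sqrDV; rewrite gt_eqF//; lra.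
have G0 y : (0 <= g y * ((y ^+ 2 + eta ^+ 2)^-1)%:E)%E.
  by rewrite mule_ge0 ?discrepancy_ge0// lee_fin invr_ge0 ltW.
have sub1 : (`[0, A0[%classic : set R) `<=` `[0, +oo[.
  by move=> y; rewrite /= !in_itv/= andbT => /andP[].
have sub2 : (`[A0, +oo[%classic : set R) `<=` `[0, +oo[.
  by move=> y; rewrite /= !in_itv/= !andbT => h; lra.
have -> : `[0%R, +oo[%classic = (`[0%R, A0[%classic `|` `[A0, +oo[%classic)%classic :> set R.
  apply/seteqP; split => y; last by case => [/sub1|/sub2].
  by rewrite /= !in_itv/= !andbT => h; have [h3|h3] := ltP y A0; [left; rewrite h|right].
rewrite ge0_integral_setU//=; first last.
- apply/disj_setPS => y [] /=; rewrite !in_itv/= andbT => /andP[h1 h2] h3; by have := lt_le_trans h2 h3; rewrite ltxx.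
- by apply: mG; [exact: measurableU|move=> y [/sub1|/sub2]].
rewrite (_ : e%:E = (e / 2)%:E + (e / 2)%:E)%E; last by rewrite -EFinD; congr EFin; field.
apply: leeD.
  apply: (@le_trans _ _ (\int[leb]_(y in `[0%R, A0[) ((2 * K * (A0 + 1)) * (eta ^+ 2)^-1)%:E)%E).
    apply: ge0_le_integral => //.
    - exact: mG.
    - move=> y; rewrite /= in_itv/= => /andP[h1 h2]; rewrite EFinM.
      apply: lee_pmul => //; first exact: discrepancy_ge0.
      + by rewrite lee_fin invr_ge0 ltW.
      + apply: le_trans (discrepancy_bound K0 stM intM h1) _.
        by rewrite lee_fin ler_pM2l ?mulr_gt0// lerD2r ltW.
      + by rewrite lee_fin lef_pV2 ?posrE ?exprn_gt0 ?(lt_le_trans ltr01 eta0)// lerDr sqr_ge0.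
  rewrite integral_cst//= lebesgue_measure_itv/= lte_fin A00 oppr0 adde0 -EFinM lee_fin.
  have ee : eta <= eta ^+ 2 by rewrite expr2 ler_peMr//; lra.
  rewrite mulrAC ler_pdivrMr; last by rewrite exprn_gt0//; lra.
  rewrite -/c; have : 2 * c / e <= eta ^+ 2 by lra.
  by rewrite ler_pdivrMr//; lra.
apply: le_trans (HA A0 (lexx _)); apply: ge0_le_integral => //.
- exact: mG.
- apply: measurable_funS (measurable_g_tail M K) => //.
  by move=> y; rewrite /= !in_itv/= !andbT => h; exact: le_trans h.
- move=> y; rewrite /= in_itv/= andbT => h; apply: lee_wpmul2l; first exact: discrepancy_ge0.
  rewrite lee_fin lef_pV2 ?posrE ?exprn_gt0 ?(lt_le_trans A00 h)//.
  by rewrite lerDl sqr_ge0.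
Qed.

(** At large height the real part of the resolvent is small in mean and the imaginary part
is close to 2 K atan(n / eta), hence to pi K. *)
Lemma mean_poisson_eta_infty (eta0 e : R) : 0 < e -> exists2 eta, eta0 < eta & exists N : nat,
  forall n : nat, (N <= n)%N -> `|mean_poisson n%:R eta - poisson a b 0 (pi * K)| <= e.
Proof.
move=> e0; pose q := e * b ^+ 2 / 15.
have b2 : 0 < b ^+ 2 by rewrite exprn_gt0.
have q0 : 0 < q by rewrite divr_gt0// mulr_gt0.
have [H H0 HH] := g_resolvent_small q0.
pose eta := Num.max (eta0 + 1) (Num.max H (2 * K / q)).
have : [/\ eta0 + 1 <= eta, H <= eta & 2 * K / q <= eta] by rewrite /eta !le_max !lexx !orbT.
move=> [eta_0 eta_H eta_q]; clearbody eta.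
have etap : 0 < eta by lra.
exists eta; first by lra.
have [A1 [A11 HA1]] := g_sublinear K0 stM intM gint q0.
have : \forall n \near \oo, `|pi / 2 - atan (n%:R / eta)| < q / (2 * K).
  have q2 : 0 < q / (2 * K) by rewrite divr_gt0// mulr_gt0.
  have /cvgrPdist_lt/(_ _ q2)[B [_ HB]] := @cvgy_atan R.
  have [N HN] := nat_large (B * eta); exists N => // n /= /HN h; apply: HB.
  by rewrite ltr_pdivlMr.
move=> [N1 _ HN1]; have [N2 HN2] := nat_large A1.
exists (maxn N1 N2) => n; rewrite geq_max => /andP[/HN1 /= nat1 /HN2 nA].
have n0 : 0 < n%:R :> R by lra.
have nz : eta != 0 by rewrite gt_eqF.
have etai : eta^-1 >= 0 by rewrite invr_ge0 ltW.
pose Ire b' w := \int[Mw w]_(x in ray b' 0 n%:R) reK eta (flip b' x) - K * parts_cst (reK eta) (dreK eta) 0 n%:R.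
pose Iim b' w := \int[Mw w]_(x in ray b' 0 n%:R) imK eta (flip b' x) - K * parts_cst (imK eta) (dimK eta) 0 n%:R.
have small : (g n%:R * (n%:R^-1)%:E + (2 * K / eta)%:E + \int[leb]_(y in `[0%R, +oo[) (g y * ((y ^+ 2 + eta ^+ 2)^-1)%:E) <= (q + q + q)%:E)%E.
  rewrite !EFinD; apply: leeD; last exact: HH.
  apply: leeD.
    rewrite -(fineK (g_fin K0 stM intM (ltW n0))) -EFinM lee_fin ler_pdivrMr//.
    by apply: HA1; exact: ltW.
  by rewrite lee_fin ler_pdivrMr// [leRHS]mulrC -ler_pdivrMr.
have re_le b' : (mabs P (Ire b') <= (q + q + q)%:E)%E.
  apply: le_trans small; apply: mean_ray_kernel => //.
  - exact: measurable_reK.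
  - by move=> y; exact: is_derive_reK.
  - exact: continuous_dreK.
  - by rewrite /reK mul0r normr0.
  - exact: reK_le.
  - by move=> y; exact: dreK_le.
have im_le b' : (mabs P (Iim b') <= (q + q + q)%:E)%E.
  apply: le_trans small; apply: mean_ray_kernel => //.
  - exact: measurable_imK.
  - by move=> y; exact: is_derive_imK.
  - exact: continuous_dimK.
  - by rewrite /imK expr0n/= add0r expr2 invfM mulVKf// ger0_norm.
  - exact: imK_le.
  - by move=> y; exact: dimK_le.
have mIre b' : measurable_fun [set: T] (Ire b').
  by apply: measurable_funB => //; apply: measurable_ray_int; exact: measurable_reK.
have mIim b' : measurable_fun [set: T] (Iim b').
  by apply: measurable_funB => //; apply: measurable_ray_int; exact: measurable_imK.
have pK0 : 0 <= pi * K by rewrite mulr_ge0 ?pi_ge0// ltW.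
have norm_id (f : T -> R) : mabs P (fun w => `|f w|) = mabs P f.
  by apply: eq_integral => w _; rewrite normr_id.
have mabsD' (f h : T -> R) (x y : R) : measurable_fun [set: T] f -> measurable_fun [set: T] h ->
    (mabs P f <= x%:E)%E -> (mabs P h <= y%:E)%E ->
    (mabs P (fun w => (`|f w| + `|h w|)%R) <= (x + y)%:E)%E.
  move=> mf mh fx hy; have mf' := measurableT_comp (@normr_measurable R setT) mf.
  have mh' := measurableT_comp (@normr_measurable R setT) mh.
  by apply: le_trans (mabsD P mf' mh') _; rewrite !norm_id EFinD; exact: leeD.
rewrite -[X in _ - X](rmean_cst P) /mean_poisson.
apply: (@mean_poisson_dist _ _ (cst 0) (cst (pi * K))) => //.
- by apply: measurable_window_int; exact: measurable_reK.
- by apply: measurable_window_int; exact: measurable_imK.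
- by move=> w; apply: window_int_imK_ge0; exact: ltW.
(* six errors q in the real part, six in the imaginary part, two spare ones and one for the
   arctangent *)
rewrite (_ : e * b ^+ 2 = (q + q + q + (q + q + q)) + ((q + q + q + (q + q + q)) + q + q + q)); last first.
  by rewrite /q; field.
rewrite EFinD; apply: leeD.
  apply: le_trans (mabsD' _ _ _ _ (mIre true) (mIre false) (re_le true) (re_le false)).
  apply: mabs_le.
  - by apply: measurable_funB => //; apply: measurable_window_int; exact: measurable_reK.
  - by apply: measurable_funD; apply: measurableT_comp.
  - apply: nearW => w; rewrite [leRHS]ger0_norm; last exact: addr_ge0.
    rewrite /= subr0 window_int_reK ?(ltW n0)//.
    rewrite [leRHS]addrC; apply: le_trans (ler_normB _ _).
    by rewrite /Ire opprB addrA subrK.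
have two (x : \bar R) : (x <= (q + q + q + (q + q + q) + q)%:E)%E -> (x <= (q + q + q + (q + q + q) + q + q + q)%:E)%E.
  by move=> /le_trans; apply; rewrite lee_fin; lra.
apply: two.
have mS : measurable_fun [set: T] (fun w => `|Iim true w| + `|Iim false w|).
  by apply: measurable_funD; apply: measurableT_comp.
apply: (@le_trans _ _ (mabs P (fun w => (`|Iim true w| + `|Iim false w|) + q))); last first.
  apply: le_trans (mabsD P mS (measurable_cst q)) _; rewrite EFinD; apply: leeD.
    exact: mabsD' (mIim true) (mIim false) (im_le true) (im_le false).
  by rewrite mabs_cst gtr0_norm.
apply: mabs_le.
- by apply: measurable_funB => //; apply: measurable_window_int; exact: measurable_imK.
- exact: measurable_funD.
apply: filterS (ae_no_atom K0 stM intM 0) => w aw.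
rewrite [leRHS]ger0_norm; last by rewrite !addr_ge0// ltW.
rewrite window_int_imK ?(ltW n0)// aw mul0r addr0 /Iim parts_cst_imK//.
set x := \int[_]_(x in _) _; set y := \int[_]_(x in _) _; set at' := atan _ in nat1 *.
have -> : x + y - pi * K = (x - K * at') + (y - K * at') - (2 * K) * (pi / 2 - at') by field.
apply: le_trans (ler_normB _ _) _; apply: lerD; first exact: ler_normD.
have K2 : 0 < 2 * K by rewrite mulr_gt0.
by rewrite normrM (gtr0_norm K2) [leLHS]mulrC -ler_pdivlMr//; exact: ltW.
Qed.

Lemma dist_chain (x y z t u c : R) : `|x - y| <= c -> `|z - y| <= c -> `|t - z| <= c -> `|t - u| <= c ->
  `|x - u| <= 4 * c.
Proof.
rewrite !ler_norml => /andP[a1 a2] /andP[a3 a4] /andP[a5 a6] /andP[a7 a8].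
by apply/andP; split; lra.
Qed.
Lemma poisson_law : rmean P (fun w => poisson a b (F_pv (Mw w) 0) 0) = poisson a b 0 (pi * K).
Proof.
have lim0 : mean_poisson n%:R 0 @[n --> \oo] --> rmean P (fun w => poisson a b (F_pv (Mw w) 0) 0).
  have mF : measurable_fun [set: T] (fun w => poisson a b (F_pv (Mw w) 0) 0).
    by have [] := measurable_poisson a b (measurable_F_pvM M 0) (measurable_cst (0 : R)).
  apply: (@rmean_cvg _ _ _ P _ _ b^-1) => //.
  - by move=> n; have [] := measurable_resolvent_test M a b n%:R 0 0.
  - by move=> n w; have [] := poisson_bound a (window_int (Mw w) (reK 0) n%:R 0) b0 (window_int_imK_ge0 (Mw w) n%:R 0 (lexx 0)).
  apply: filterS (ae_cvg_F_trunc K0 stM intM gint) => w /(_ 0) cw.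
  have {}cw := cvg_at_infty_nat cw.
  have im0 n : window_int (Mw w) (imK 0) n 0 = 0.
    by rewrite /window_int /Rintegral integral0_eq// => x _; rewrite imK0.
  have re0 n : window_int (Mw w) (reK 0) n 0 = F_trunc (Mw w) n 0.
    by apply: eq_Rintegral => x _; rewrite reK0.
  rewrite /resolvent_test; under eq_fun do rewrite im0 re0.
  apply/cvgrPdist_le => e e0; have b2 : 0 < b ^+ 2 by rewrite exprn_gt0.
  have eb : 0 < e * b ^+ 2 by rewrite mulr_gt0.
  move/cvgrPdist_le/(_ _ eb) : cw; apply: filterS => n hn.
  have [h _] := poisson_lipschitz a (F_pv (Mw w) 0) (F_trunc (Mw w) n%:R 0) b0 (lexx 0) (lexx 0).
  by apply: le_trans h _; rewrite subrr normr0 addr0 ler_pdivrMr.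
apply/eqP; rewrite -subr_eq0 -normr_le0; apply/ler_addgt0Pr => e e0; rewrite add0r.
have e4 : 0 < e / 4 by rewrite divr_gt0.
have [eta1 eta10 H1] := mean_poisson_eta0 e4.
have [eta2 eta12 [N2 H2]] := mean_poisson_eta_infty eta1 e4.
have eta : 0 < eta1 < eta2 by rewrite eta10.
have [N3 H3] := mean_poisson_asymptotically_constant K0 stM intM a b0 eta e4.
move/cvgrPdist_le/(_ _ e4) : lim0 => [N4 _ H4].
pose n := maxn N2 (maxn N3 N4).
have h1 := H1 n; have h2 := H2 n (leq_maxl _ _).
have h3 := H3 n (leq_trans (leq_maxl _ _) (leq_maxr _ _)).
have h4 : `|rmean P (fun w => poisson a b (F_pv (Mw w) 0) 0) - mean_poisson n%:R 0| <= e / 4.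
  by apply: H4 => /=; exact: leq_trans (leq_maxr _ _) (leq_maxr _ _).
by have := dist_chain h4 h1 h3 h2; rewrite (_ : 4 * (e / 4) = e)//; field.
Qed.

End poisson_law_limit.

(** * From Poisson kernels to the Cauchy law *)

Section cauchy_density.
Context {R : realType}.
Notation leb := (@lebesgue_measure R).
Import HBNNSimple.

Lemma measurable_cauchy_pdf (D : set R) : measurable_fun D (@cauchy_pdf R).
Proof.
by apply: measurable_funTS; apply: continuous_measurable_fun; exact: continuous_cauchy_pdf.
Qed.

(** Approximation by simple functions. *)
Lemma ge0_integral_cauchy_prob (f : R -> \bar R) : (forall x, 0 <= f x)%E ->
  measurable_fun [set: R] f ->
  (\int[cauchy_prob]_x f x = \int[leb]_x (f x * (cauchy_pdf x)%:E))%E.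
Proof.
move=> f0 mf; pose h := nnsfun_approx measurableT mf.
have p0 (x : R) : (0 <= (cauchy_pdf x)%:E :> \bar R)%E by rewrite lee_fin cauchy_pdf_ge0.
have mp : measurable_fun [set: R] (fun x => (cauchy_pdf x)%:E).
  by apply/measurable_EFinP; exact: measurable_cauchy_pdf.
have hf x : (EFin \o (fun n => h n x)) n @[n --> \oo] --> f x by exact: cvg_nnsfun_approx.
have hm x n m : (n <= m)%N -> h n x <= h m x by move=> nm; exact/lefP/nd_nnsfun_approx.
have key n : (sintegral cauchy_prob (h n) = \int[leb]_x ((h n x)%:E * (cauchy_pdf x)%:E))%E.
  have e0 (y x : R) : (0 <= (y * \1_(h n @^-1` [set y]) x)%:E :> \bar R)%E by exact: nnfun_muleindic_ge0.
  have me (y : R) : measurable_fun [set: R] (fun x => (y * \1_(h n @^-1` [set y]) x)%:E).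
    by apply/measurable_EFinP; exact: measurable_funM.
  transitivity (\int[leb]_x (\sum_(y \in range (h n)) (y * \1_(h n @^-1` [set y]) x)%:E * (cauchy_pdf x)%:E))%E; last first.
    apply: eq_integral => x _; rewrite -ge0_mule_fsuml; last by move=> y; exact: e0.
    by congr (_ * _)%E; rewrite [in RHS]fimfunE -fsumEFin.
  rewrite ge0_integral_fsum//; first last.
  - by move=> y x _; rewrite mule_ge0.
  - by move=> y; apply: emeasurable_funM; [exact: me|exact: mp].
  rewrite sintegralE; apply: eq_fsbigr => y /[!inE] -[x0 _ hy].
  have y0 : 0 <= y by rewrite -hy.
  have mA : measurable (h n @^-1` [set y]) by exact: measurable_funPTI.
  under [RHS]eq_integral do rewrite EFinM -muleA.
  rewrite ge0_integralZl//; first last.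
  - by move=> x _; rewrite mule_ge0// lee_fin.
  - apply: emeasurable_funM => //; apply/measurable_EFinP; exact: measurable_indic.
  congr (_ * _)%E; rewrite [LHS]integral_mkcond; apply: eq_integral => x _.
  rewrite patchE indicE; case: ifP => _; [by rewrite mul1e|by rewrite mul0e].
rewrite (nd_ge0_integral_lim _ f0 hm hf).
rewrite (_ : sintegral cauchy_prob \o _ = (fun n => \int[leb]_x ((h n x)%:E * (cauchy_pdf x)%:E))%E); last by apply/funext.
transitivity (\int[leb]_x limn (fun n => (h n x)%:E * (cauchy_pdf x)%:E))%E.
  apply/esym; apply: (@monotone_convergence _ _ _ leb setT measurableT (fun n x => ((h n x)%:E * (cauchy_pdf x)%:E)%E)).
  - move=> n; apply: emeasurable_funM; last exact: mp.
    have mh : measurable_fun [set: R] (fun x => (h n x)%:E) by apply/measurable_EFinP; exact: measurable_funP.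
    exact: mh.
  - by move=> n x _; rewrite mule_ge0// lee_fin.
  - by move=> x _ n m nm; apply: lee_wpmul2r => //; rewrite lee_fin hm.
apply: eq_integral => x _; apply: cvg_lim => //; apply: cvgeZr => //; exact: hf.
Qed.

Lemma cauchy_scale (p s x : R) : p != 0 -> s != 0 ->
  p^-1 * (s / (s ^+ 2 * x ^+ 2 + s ^+ 2)) * s = (p * (1 + x ^+ 2))^-1.
Proof.
move=> p0 s0; have x0 : 1 + x ^+ 2 != 0 by rewrite gt_eqF// ltr_wpDr ?sqr_ge0.
rewrite (_ : s ^+ 2 * x ^+ 2 + s ^+ 2 = s ^+ 2 * (1 + x ^+ 2)); last by ring.
by field; rewrite p0 s0 x0.
Qed.
Lemma cauchy_affine (G : R -> R) (a u s : R) : 0 < s -> continuous G -> (forall x, 0 <= G x) ->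
  (\int[leb]_x (G x * (pi^-1 * poisson x 0 u s))%:E = \int[cauchy_prob]_x (G (u + s * x))%:E)%E.
Proof.
move=> s0 cG G0; have cp : continuous (fun x => pi^-1 * poisson x 0 u s).
  move=> x; apply: cvgM; first exact: cvg_cst.
  rewrite /poisson; apply: cvgM; first exact: cvg_cst.
  apply: cvgV.
    by rewrite gt_eqF// addr0 ltr_wpDl ?sqr_ge0// exprn_gt0.
  apply: cvgD; last exact: cvg_cst.
  apply: (@continuous_comp _ _ _ (fun y : R => u - y) (fun y : R => y ^+ 2)); last exact: exprn_continuous.
  by apply: cvgB; [exact: cvg_cst|exact: cvg_id].
have p0 (x : R) : 0 <= pi^-1 * poisson x 0 u s.
  by rewrite mulr_ge0 ?invr_ge0 ?pi_ge0// /poisson divr_ge0 ?addr0 ?addr_ge0 ?sqr_ge0// ltW.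
have cA : continuous (fun x : R => u + s * x).
  by move=> x; apply: cvgD; [exact: cvg_cst|apply: cvgM; [exact: cvg_cst|exact: cvg_id]].
pose F x : R := u + s * x.
have dF (x : R) : is_derive x (1 : R) F s.
  rewrite /F; have := is_deriveD (is_derive_cst u x (1 : R)) (is_deriveZ s (is_derive_id x (1 : R))).
  by move=> H; apply: is_derive_eq; rewrite add0r scaler1.
have F' : F^`()%classic = cst s by apply/funext => x; rewrite derive1E derive_val.
have := @increasing_ge0_integration_by_substitutionT R F (fun x => G x * (pi^-1 * poisson x 0 u s)).
rewrite F' => ->.
- rewrite ge0_integral_cauchy_prob.
  + apply: eq_integral => x _; rewrite -EFinM; congr EFin.
    change (G (u + s * x) * (pi^-1 * ((s + 0) / ((u - (u + s * x)) ^+ 2 + (s + 0) ^+ 2))) * s =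
      G (u + s * x) * (pi * (1 + x ^+ 2))^-1).
    rewrite addr0 -mulrA; congr (_ * _).
    rewrite (_ : u - (u + s * x) = - (s * x)); last by ring.
    rewrite sqrrN exprMn.
    by apply: cauchy_scale; rewrite gt_eqF// pi_gt0.
  + by move=> x; rewrite lee_fin.
  + apply/measurable_EFinP; apply: continuous_measurable_fun => x.
    by apply: continuous_comp; [exact: cA|exact: cG].
- by move=> x y xy; rewrite ltrD2l ltr_pM2l.
- exact: cst_continuous.
- exact: is_cvg_cst.
- exact: is_cvg_cst.
- by move=> x; apply: ex_derive.
- apply/cvgrNyPle => A; exists ((A - u) / s); split; first exact: num_real.
  by move=> x; rewrite ltr_pdivlMr// /F mulrC => h; lra.
- apply/cvgryPge => A; exists ((A - u) / s); split; first exact: num_real.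
  by move=> x; rewrite ltr_pdivrMr// /F mulrC => h; lra.
- by move=> x; apply: cvgM; [exact: cG|exact: cp].
- by move=> x; rewrite mulr_ge0.
Qed.

End cauchy_density.

Lemma rmean_norm_le d (T : measurableType d) (R : realType) (P : probability T R) (f : T -> R) c :
  measurable_fun [set: T] f -> (forall w, `|f w| <= c) -> `|rmean P f| <= c.
Proof.
move=> mf fc; have fi := bounded_integrable P mf fc.
apply: le_trans (le_normr_Rintegral measurableT fi) _; rewrite -[leRHS](rmean_cst P).
apply: le_Rintegral => //; [exact: integrable_norm|exact: finite_measure_integrable_cst].
Qed.

Section pv_law.
Context d (T : measurableType d) (R : realType) (P : probability T R).
Variables (M : {RV P >-> vague_borel R}) (K : R).
Hypotheses (K0 : 0 < K) (stM : stationary M) (intM : intensity M = K%:E).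
Notation VB := (vague_borel R).
Notation leb := (@lebesgue_measure R).
Local Notation Mw w := (M w : wpm R).
Local Notation g := (discrepancy M K).
Hypothesis gint : (\int[leb]_(y in `[1%R, +oo[) (g y * (y ^- 2)%:E) < +oo)%E.
Variable G : R -> R.
Hypotheses (cG : continuous G) (G0 : forall x, 0 <= G x) (G2 : forall x, G x <= 2).

Local Notation U m s := (rmean cauchy_prob (fun x => G (m + s * x))).
Local Notation F w := (F_pv (Mw w) 0).

Lemma G_norm x : `|G x| <= 2.
Proof. by rewrite ger0_norm. Qed.

Lemma measurable_affine (m s : R) : measurable_fun [set: R] (fun x => G (m + s * x)).
Proof.
apply: continuous_measurable_fun => x; apply: continuous_comp; last exact: cG.
by apply: cvgD; [exact: cvg_cst|apply: cvgM; [exact: cvg_cst|exact: cvg_id]].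
Qed.

Lemma affine_meanE m s : (U m s)%:E = (\int[cauchy_prob]_x (G (m + s * x))%:E)%E.
Proof.
rewrite /rmean /Rintegral fineK//; apply: integrable_fin_num => //.
by apply: bounded_integrable (measurable_affine m s) _ => x; exact: G_norm.
Qed.

Lemma G_cvg (m s x : R) (sk : nat -> R) : sk n @[n --> \oo] --> s ->
  G (m + sk n * x) @[n --> \oo] --> G (m + s * x).
Proof.
move=> sks; apply: continuous_cvg; first exact: cG.
by apply: cvgD; [exact: cvg_cst|apply: cvgM => //; exact: cvg_cst].
Qed.

Lemma affine_mean_cvg (m s : R) (sk : nat -> R) : sk n @[n --> \oo] --> s -> U m (sk n) @[n --> \oo] --> U m s.
Proof.
move=> sks; apply: (@rmean_cvg _ _ _ cauchy_prob _ _ 2).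
- by move=> n; exact: measurable_affine.
- exact: measurable_affine.
- by move=> n x; exact: G_norm.
- by apply: nearW => x; exact: G_cvg.
Qed.

Lemma affine_mean0 m : U m 0 = G m.
Proof.
rewrite -[RHS](rmean_cst cauchy_prob); apply: eq_Rintegral => x _ /=.
by rewrite mul0r addr0.
Qed.

Lemma measurable_F : measurable_fun [set: T] (fun w => F w).
Proof. exact: measurable_F_pvM. Qed.

(** Integrate [poisson_law] against G(a) da. *)
Lemma smoothing (b : R) : 0 < b ->
  (\int[P]_w (U (F w) b)%:E = (U 0 (pi * K + b))%:E)%E.
Proof.
move=> b0; have pK : 0 < pi * K by rewrite mulr_gt0 ?pi_gt0.
under eq_integral do rewrite affine_meanE -(cauchy_affine 0 _ b0 cG G0).
have mF := measurable_F.
pose f (z : T * R) := (G z.2 * (pi^-1 * poisson z.2 0 (F z.1) b))%:E.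
have mG : measurable_fun [set: R] G by exact: continuous_measurable_fun.
have mf : measurable_fun [set: T * R] f.
  apply/measurable_EFinP; apply: measurable_funM; first exact: measurableT_comp mG measurable_snd.
  apply: measurable_funM => //; apply: measurable_funM => //.
  apply: measurableT_comp measurable_inv _; apply: measurable_funD => //; apply: measurable_funX.
  apply: measurable_funB; first exact: measurableT_comp mF measurable_fst.
  exact: measurable_snd.
have pge (x u : R) : 0 <= poisson x 0 u b by rewrite /poisson divr_ge0 ?addr0 ?addr_ge0 ?sqr_ge0// ltW.
have f0 z : (0 <= f z)%E.
  by rewrite lee_fin mulr_ge0// mulr_ge0// invr_ge0 pi_ge0.
rewrite affine_meanE; have := @fubini_tonelli _ _ _ _ _ P leb f mf f0; rewrite /f /= => ->.
rewrite -(cauchy_affine 0 0 _ cG G0) ?addr_gt0//.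
apply: eq_integral => x _ /=; rewrite /f /=.
have peq u v : poisson x 0 u (v + b) = poisson x b u v by rewrite /poisson addr0.
have peq0 u : poisson x 0 u b = poisson x b u 0 by rewrite /poisson addr0 add0r.
under eq_integral do rewrite mulrA EFinM peq0.
rewrite ge0_integralZl//; first last.
- by rewrite lee_fin mulr_ge0// invr_ge0 pi_ge0.
- by move=> w _; rewrite lee_fin -peq0.
- by apply/measurable_EFinP; have [] := measurable_poisson x b mF (measurable_cst (0 : R)).
rewrite peq [in RHS]mulrA [in RHS]EFinM; congr (_ * _)%E.
rewrite -(poisson_law K0 stM intM x b0 gint) /rmean /Rintegral fineK//.
apply: integrable_fin_num => //; apply: (@bounded_integrable _ _ _ P _ b^-1).
  by have [] := measurable_poisson x b mF (measurable_cst (0 : R)).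
by move=> w; have [] := poisson_bound x (F w) b0 (lexx 0).
Qed.

(** The smoothing parameter b tends to 0 on both sides of [smoothing]. *)
Lemma pv_law : rmean P (fun w => G (F w)) = U 0 (pi * K).
Proof.
pose bk (k : nat) : R := k.+1%:R^-1.
have bk0 k : 0 < bk k by rewrite invr_gt0 ltr0n.
have bkc : bk k @[k --> \oo] --> 0 by exact: cvg_harmonic.
have mG : measurable_fun [set: R] G by exact: continuous_measurable_fun.
have E k : rmean P (fun w => U (F w) (bk k)) = U 0 (pi * K + bk k).
  by apply/eqP; rewrite -eqe -smoothing// /rmean /Rintegral fineK// smoothing.
have mU k : measurable_fun [set: T] (fun w => U (F w) (bk k)).
  have mF2 : measurable_fun [set: T * R] (fun z => (G (F z.1 + bk k * z.2))%:E).
    apply/measurable_EFinP; apply: measurableT_comp mG _; apply: measurable_funD.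
      exact: measurableT_comp measurable_F measurable_fst.
    by apply: measurable_funM => //; exact: measurable_snd.
  apply: measurableT_comp => //.
  by apply: (@measurable_fun_fubini_tonelli_F _ _ _ _ _ cauchy_prob _ mF2) => z; rewrite lee_fin.
have lim1 : rmean P (fun w => U (F w) (bk k)) @[k --> \oo] --> rmean P (fun w => G (F w)).
  apply: (@rmean_cvg _ _ _ P _ _ 2) => //.
  - exact: measurableT_comp mG measurable_F.
  - move=> k w; apply: rmean_norm_le; [exact: measurable_affine|by move=> x; exact: G_norm].
  - by apply: nearW => w; rewrite -[X in _ --> X]affine_mean0; exact: affine_mean_cvg.
have lim2 : U 0 (pi * K + bk k) @[k --> \oo] --> U 0 (pi * K).
  apply: affine_mean_cvg; rewrite -[X in _ --> X]addr0; apply: cvgD => //; exact: cvg_cst.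
have := cvg_unique _ lim1; apply=> //.
by move: lim2; under eq_fun do rewrite -E.
Qed.

End pv_law.

(** * The bounded Lipschitz distance *)

Section bounded_lipschitz_distance.
Context d (T : measurableType d) (R : realType) (P : probability T R).
Variables (M : {RV P >-> vague_borel R}) (K : R).
Hypotheses (K0 : 0 < K) (stM : stationary M) (intM : intensity M = K%:E).
Notation VB := (vague_borel R).
Notation leb := (@lebesgue_measure R).
Local Notation Mw w := (M w : wpm R).
Local Notation g := (discrepancy M K).
Hypothesis gint : (\int[leb]_(y in `[1%R, +oo[) (g y * (y ^- 2)%:E) < +oo)%E.

Lemma rmean_dist_mabs (f h : T -> R) (c : R) : measurable_fun [set: T] f -> measurable_fun [set: T] h ->
  (forall w, `|f w| <= c) -> (forall w, `|h w| <= c) ->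
  (`|rmean P f - rmean P h|%:E <= mabs P (fun w => (f w - h w)%R))%E.
Proof.
move=> mf mh fc hc; have [->|fin] := eqVneq (mabs P (fun w => (f w - h w)%R)) +oo%E; first exact: leey.
have fin' : mabs P (fun w => (f w - h w)%R) \is a fin_num by rewrite ge0_fin_numE ?mabs_ge0// ltey.
rewrite -(fineK fin') lee_fin; apply: (rmean_dist mf mh fc hc).
by rewrite fineK.
Qed.

Lemma BL1_continuous (f : R -> R) : BL1 f -> continuous f.
Proof.
move=> [_ f1] x; apply/cvgrPdist_le => e e0; exists e => //= y xy.
exact: le_trans (f1 _ _) (ltW xy).
Qed.

(** Bounded Lipschitz functions are made nonnegative by adding 1, so that Tonelli's theorem
applies. *)
Lemma cauchy_test (f : R -> R) : BL1 f ->
  rmean cauchy_prob f = rmean P (fun w => f (F_pv (Mw w) 0 / (pi * K))).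
Proof.
move=> fBL; have cf := BL1_continuous fBL; have [f1 _] := fBL.
have pK : 0 < pi * K by rewrite mulr_gt0 ?pi_gt0.
pose G y := f (y / (pi * K)) + 1.
have cG : continuous G.
  move=> y; apply: cvgD; last exact: cvg_cst.
  apply: (@continuous_comp _ _ _ (fun y : R => y / (pi * K)) f); last exact: cf.
  by apply: cvgM; [exact: cvg_id|exact: cvg_cst].
have fb y : -1 <= f y <= 1 by rewrite -ler_norml.
have G0 y : 0 <= G y by rewrite /G; have /andP[] := fb (y / (pi * K)); lra.
have G2 y : G y <= 2 by rewrite /G; have /andP[] := fb (y / (pi * K)); lra.
have := pv_law K0 stM intM gint cG G0 G2.
have mf : measurable_fun [set: R] f by exact: continuous_measurable_fun.
have mF : measurable_fun [set: T] (fun w => f (F_pv (Mw w) 0 / (pi * K))).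
  by apply: measurableT_comp mf _; apply: measurable_funM => //; exact: measurable_F_pvM.
have -> : rmean P (fun w => G (F_pv (Mw w) 0)) = rmean P (fun w => f (F_pv (Mw w) 0 / (pi * K))) + 1.
  rewrite -[X in _ + X](rmean_cst P) /rmean -RintegralD//.
  - exact: (bounded_integrable P mF (fun w => f1 _)).
  - exact: finite_measure_integrable_cst.
have -> : rmean cauchy_prob (fun x => G (0 + pi * K * x)) = rmean cauchy_prob f + 1.
  rewrite -[X in _ + X](rmean_cst cauchy_prob) /rmean -RintegralD//.
  - by apply: eq_Rintegral => x _; rewrite /G add0r mulrAC mulfV ?mul1r ?gt_eqF.
  - exact: (bounded_integrable cauchy_prob mf f1).
  - exact: finite_measure_integrable_cst.
by move=> /addIr ->.
Qed.

Lemma F_sym0 (mu : wpm R) (A : R) : F_sym mu A 0 = F_trunc mu A 0.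
Proof. by rewrite /F_sym sub0r add0r. Qed.

(** By stationarity the truncation may be taken at 0, on the same probability space as the
Cauchy variable F_M(0)/(pi K). *)
Lemma BL1_F_sym_dist (f : R -> R) (s A : R) : 1 <= A -> BL1 f ->
  (`|rmean P (fun w => f (F_sym (Mw w) A s / (pi * K))) - rmean cauchy_prob f|%:E <=
    tail_bound g A * ((pi * K)^-1)%:E)%E.
Proof.
move=> A1 fBL; have [f1 flip1] := fBL.
have pK : 0 < pi * K by rewrite mulr_gt0 ?pi_gt0.
have mf : measurable_fun [set: R] f by apply: continuous_measurable_fun; exact: BL1_continuous.
have mft : measurable_fun [set: VB] (fun mu : VB => f (F_trunc (mu : wpm R) A 0 / (pi * K))).
  by apply: measurableT_comp mf _; apply: measurable_funM => //; exact: measurable_F_trunc.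
have -> : rmean P (fun w => f (F_sym (Mw w) A s / (pi * K))) = rmean P (fun w => f (F_trunc (Mw w) A 0 / (pi * K))).
  rewrite -(@rmean_shift _ _ _ P M stM s 1 _ mft); last by move=> mu; exact: f1.
  apply: eq_Rintegral => w _; rewrite F_symE F_truncE centred_int_shift//; exact: measurable_inv.
rewrite (cauchy_test fBL).
have m1 : measurable_fun [set: T] (fun w => f (F_trunc (Mw w) A 0 / (pi * K))).
  exact: measurableT_comp mft (measurable_M M).
have m2 : measurable_fun [set: T] (fun w => f (F_pv (Mw w) 0 / (pi * K))).
  by apply: measurableT_comp mf _; apply: measurable_funM => //; exact: measurable_F_pvM.
apply: le_trans (rmean_dist_mabs m1 m2 (fun w => f1 _) (fun w => f1 _)) _.
have mD : measurable_fun [set: T] (fun w => F_pv (Mw w) 0 - F_sym (Mw w) A 0).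
  by apply: measurable_funB; [exact: measurable_F_pvM|exact: measurable_F_symM].
apply: (@le_trans _ _ (mabs P (fun w => (pi * K)^-1 * (F_pv (Mw w) 0 - F_sym (Mw w) A 0)))).
  apply: mabs_le.
  - exact: measurable_funB.
  - exact: measurable_funM.
  - apply: nearW => w; apply: le_trans (flip1 _ _) _.
    by rewrite -mulrBl [leRHS]normrM mulrC F_sym0 distrC normrM.
rewrite mabsZ ?invr_ge0 ?(ltW pK)// muleC; apply: lee_wpmul2r; first by rewrite lee_fin invr_ge0 ltW.
exact: mean_F_pv_F_sym.
Qed.

Lemma F_sym_law (s A : R) : 1 <= A -> exists X : {RV P >-> R},
  (forall w, X w = F_sym (Mw w) A s / (pi * K)) /\
  (dBL (distribution P X) cauchy_prob <= tail_bound g A * ((pi * K)^-1)%:E)%E.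
Proof.
move=> A1; pose X0 w := F_sym (Mw w) A s / (pi * K).
have mX : measurable_fun [set: T] X0 by apply: measurable_funM => //; exact: measurable_F_symM.
exists (mfun_Sub (mem_set mX)); split => //.
apply: ub_ereal_sup => _ [f fBL <-].
have mf : measurable_fun [set: R] f by apply: continuous_measurable_fun; exact: BL1_continuous.
rewrite [X in (`|X - _|%:E <= _)%E](_ : _ = rmean P (fun w => f (X0 w))).
  exact: BL1_F_sym_dist.
rewrite /rmean /Rintegral integral_distribution//.
- exact/measurable_EFinP.
- have [f1 _] := fBL; apply: (@bounded_integrable _ _ _ P (fun w => f (X0 w)) 1) => //.
  exact: measurableT_comp mf mX.
Qed.

End bounded_lipschitz_distance.

(** * General, power and logarithmic envelopes *)

Section envelopes_tail.
Context d (T : measurableType d) (R : realType) (P : probability T R).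
Variables (M : {RV P >-> vague_borel R}) (K : R) (h : R -> R).
Hypothesis hP : envelope M K h.
Notation leb := (@lebesgue_measure R).
Local Notation g := (discrepancy M K).

Lemma envelope_tail_le A : 1 <= A ->
  (\int[leb]_(y in `[A, +oo[) (g y * (y ^- 2)%:E) <= \int[leb]_(y in `[A, +oo[) ((h y)%:E * (y ^- 2)%:E))%E.
Proof.
move=> A1; have [mh h0 gh _] := hP.
have sA : (`[A, +oo[%classic : set R) `<=` `[1, +oo[.
  by move=> y; rewrite /= !in_itv/= !andbT => Ay; exact: le_trans Ay.
apply: ge0_le_integral => //.
- move=> y /sA; rewrite /= in_itv/= andbT; exact: g_tail_ge0.
- by apply: measurable_funS (measurable_g_tail M K).
- apply: emeasurable_funM; last by apply/measurable_EFinP; exact: sqrV_measurable.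
  by apply/measurable_EFinP; exact: measurable_funS mh.
- move=> y /sA; rewrite /= in_itv/= andbT => y1.
  have y0 : 0 <= y by exact: le_trans y1.
  apply: lee_wpmul2r; first by rewrite lee_fin invr_ge0 exprn_ge0.
  by have := gh y; rewrite ger0_norm//; apply.
Qed.

Lemma envelope_gint : (\int[leb]_(y in `[1%R, +oo[) (g y * (y ^- 2)%:E) < +oo)%E.
Proof.
have [_ _ _ hint] := hP; apply: le_lt_trans (envelope_tail_le (lexx 1)) _.
by move: hint; congr (_ < _)%E; apply: eq_integral => y _; rewrite EFinM.
Qed.

Lemma tail_bound_le A : 1 <= A -> (tail_bound g A <= tail_bound (EFin \o h) A)%E.
Proof.
move=> A1; have A0 : 0 <= A by exact: le_trans A1.
have [_ _ gh _] := hP; rewrite /tail_bound; apply: leeD.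
  apply: lee_wpmul2r; first by rewrite lee_fin invr_ge0.
  by rewrite lee_pmul2l//; have := gh A; rewrite ger0_norm//; apply.
by rewrite lee_pmul2l//; exact: envelope_tail_le.
Qed.

End envelopes_tail.

Section power_tails.
Context {R : realType}.
Notation leb := (@lebesgue_measure R).

Lemma powRN_cvg0 (q : R) : 0 < q -> (x `^ (- q)) @[x --> +oo] --> (0 : R).
Proof.
move=> q0; apply/cvgrPdist_le => e e0; exists (e^-1 `^ q^-1); split; first exact: num_real.
move=> x xB; have B0 : 0 <= e^-1 `^ q^-1 by exact: powR_ge0.
rewrite sub0r normrN ger0_norm ?powR_ge0// powRN -[leRHS]invrK lef_pV2 ?posrE ?invr_gt0//; last first.
  by rewrite powR_gt0// (le_lt_trans B0).
have -> : e^-1 = (e^-1 `^ q^-1) `^ q by rewrite -powRrM mulVf ?gt_eqF// powRr1// invr_ge0 ltW.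
by apply: ge0_ler_powR; rewrite ?nnegrE// ltW// (le_lt_trans B0).
Qed.

Lemma integral_powR (A q : R) : 0 < A -> 0 < q ->
  (\int[leb]_(x in `[A, +oo[) (x `^ (- 1 - q))%:E = (A `^ (- q) / q)%:E)%E.
Proof.
move=> A0 q0; pose F (x : R) := (- q^-1) * x `^ (- q).
have dF (x : R) : 0 < x -> is_derive x (1 : R) F (x `^ (- 1 - q)).
  move=> x0; have := is_deriveZ (- q^-1) (is_derive1_powR (- q) x0).
  move=> H; apply: is_derive_eq; rewrite /GRing.scale/= mulrA mulrNN mulVf ?gt_eqF// mul1r.
  by rewrite addrC.
rewrite (@ge0_continuous_FTC2y _ _ F _ 0).
- by rewrite -EFinB sub0r /F mulNr opprK mulrC.
- by move=> x _; exact: powR_ge0.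
- apply: derivable_within_continuous => x; rewrite in_itv/= andbT => Ax.
  by apply: derivable_powR; rewrite in_itv/= andbT (lt_le_trans A0).
- by rewrite -[X in _ --> X](mulr0 (- q^-1)); apply: cvgMr; exact: powRN_cvg0.
- by move=> x Ax; have [] := dF x (lt_trans A0 Ax).
- apply: cvg_at_right_filter; have [dA _] := dF A A0.
  by apply: differentiable_continuous; exact/derivable1_diffP.
- move=> x; rewrite in_itv/= andbT => Ax; have := dF x (lt_trans A0 Ax) => H.
  by rewrite derive1E derive_val.
Qed.

(** The right-hand side is D times the integral of (x / A)^(1 - q) / x^2 over [A, +oo[. *)
Lemma powR_tail (h : R -> R) (A D q : R) : 0 < A -> 0 < q -> 0 <= D ->
  measurable_fun (`[A, +oo[%classic : set R) h -> (forall x, A <= x -> 0 <= h x <= D * (x / A) `^ (1 - q)) ->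
  (\int[leb]_(x in `[A, +oo[) ((h x)%:E * (x ^- 2)%:E) <= (D / (q * A))%:E)%E.
Proof.
move=> A0 q0 D0 mh hle.
have AV : A `^ (- 1) = A^-1 by rewrite powR_inv1// ltW.
pose c := D * A `^ (- (1 - q)).
have c0 : 0 <= c by rewrite mulr_ge0// powR_ge0.
have mp : measurable_fun (`[A, +oo[%classic : set R) (fun x : R => (x `^ (- 1 - q))%:E).
  by apply/measurable_EFinP; apply: measurable_funTS; exact: measurable_powR.
apply: (@le_trans _ _ (\int[leb]_(x in `[A, +oo[) (c%:E * (x `^ (- 1 - q))%:E))%E).
  apply: ge0_le_integral => //.
  - move=> x; rewrite /= in_itv/= andbT => Ax; have /andP[h0 _] := hle x Ax.
    by rewrite mule_ge0// lee_fin// invr_ge0 exprn_ge0// (le_trans (ltW A0)).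
  - by apply: emeasurable_funM; [exact/measurable_EFinP|apply/measurable_EFinP; exact: sqrV_measurable].
  - exact: emeasurable_funM.
  - move=> x; rewrite /= in_itv/= andbT => Ax; have /andP[_ hx] := hle x Ax.
    have x0 : 0 < x by exact: lt_le_trans Ax.
    have x2 : x ^- 2 = x `^ (- 2%:R) by rewrite powRN powR_mulrn// ltW.
    rewrite -!EFinM lee_fin (_ : c * x `^ (- 1 - q) = D * (x / A) `^ (1 - q) * x ^- 2); last first.
      rewrite powRM ?invr_ge0 ?(ltW x0) ?(ltW A0)// -AV -powRrM mulN1r /c x2.
      rewrite (_ : - 1 - q = (1 - q) + (- 2%:R)); last by ring.
      by rewrite powRD; [ring|rewrite (gt_eqF x0) implybT].
    by apply: ler_wpM2r => //; rewrite invr_ge0 exprn_ge0// ltW.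
rewrite ge0_integralZl//; last by move=> x _; rewrite lee_fin powR_ge0.
rewrite integral_powR// -EFinM lee_fin /c.
rewrite [leLHS](_ : _ = D * (A `^ (- (1 - q)) * A `^ (- q)) / q); last by ring.
rewrite -powRD; last by rewrite (gt_eqF A0) implybT.
rewrite (_ : - (1 - q) + - q = - 1); last by ring.
by rewrite AV invfM mulrA mulrAC.
Qed.

Lemma tail_bound_powR (h : R -> R) (A D q : R) : 0 < A -> 0 < q -> 0 <= D ->
  measurable_fun (`[A, +oo[%classic : set R) h -> (forall x, A <= x -> 0 <= h x <= D * (x / A) `^ (1 - q)) ->
  (`|tail_bound (EFin \o h) A| <= (2 * D * (1 + q^-1) / A)%:E)%E.
Proof.
move=> A0 q0 D0 mh hle.
have /andP[h0 hA] := hle A (lexx _); move: hA; rewrite mulfV ?gt_eqF// powR1 mulr1 => hA.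
have I0 : (0 <= \int[leb]_(x in `[A, +oo[) ((h x)%:E * (x ^- 2)%:E))%E.
  apply: integral_ge0 => x; rewrite /= in_itv/= andbT => Ax; have /andP[hx _] := hle x Ax.
  by rewrite mule_ge0// lee_fin// invr_ge0 exprn_ge0// (le_trans (ltW A0)).
rewrite gee0_abs; last first.
  by rewrite /tail_bound adde_ge0// !mule_ge0// lee_fin// invr_ge0 ltW.
rewrite (_ : 2 * D * (1 + q^-1) / A = 2 * D * A^-1 + 2 * (D / (q * A))); last first.
  by field; rewrite !gt_eqF.
rewrite EFinD /tail_bound; apply: leeD.
  by rewrite -!EFinM lee_fin ler_wpM2r ?invr_ge0 ?(ltW A0)// ler_pM2l.
by rewrite EFinM lee_pmul2l//; exact: powR_tail.
Qed.

End power_tails.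

Section power_envelope.
Context d (T : measurableType d) (R : realType) (P : probability T R).
Variables (M : {RV P >-> vague_borel R}) (K : R).
Notation leb := (@lebesgue_measure R).

Lemma powR_envelope (h : R -> R) (D q : R) : 0 < q -> 0 <= D ->
  measurable_fun (`[1%R, +oo[%classic : set R) h -> (forall x, 1 <= x -> 0 <= h x <= D * x `^ (1 - q)) ->
  (forall x : R, 1 <= `|x| -> (discrepancy M K x <= (h `|x|)%:E)%E) -> envelope M K h.
Proof.
move=> q0 D0 mh hle gh; split => //; first by move=> r /hle/andP[].
have hle' x : 1 <= x -> 0 <= h x <= D * (x / 1) `^ (1 - q) by rewrite divr1; exact: hle.
apply: le_lt_trans (ltry (D / (q * 1))); apply: le_trans (powR_tail ltr01 q0 D0 mh hle').
rewrite le_eqVlt; apply/orP; left; apply/eqP; apply: eq_integral => x _; by rewrite EFinM.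
Qed.

End power_envelope.

Section logarithmic_majorant.
Context {R : realType}.

Lemma ln2A_ge (A : R) : 1 <= A -> 2^-1 <= ln (2 + A).
Proof.
move=> A1; have h : -1 < - (1 + A) / (2 + A) by rewrite ltr_pdivlMr; lra.
have := le_ln1Dx h; rewrite (_ : 1 + - (1 + A) / (2 + A) = (2 + A)^-1); last by field; rewrite gt_eqF//; lra.
rewrite lnV ?posrE; last lra.
have : 2^-1 <= (1 + A) / (2 + A) by rewrite ler_pdivlMr; lra.
by rewrite mulNr; lra.
Qed.

(** From ln(1 + t) <= t, and from ln(2 + A) >= 1/2, which absorbs the additive term. *)
Lemma ln_growth (A x : R) : 1 <= A -> A <= x -> ln (2 + x) <= 2 * ln (2 + A) * (x / A).
Proof.
move=> A1 Ax; have L := ln2A_ge A1; set l := ln (2 + A) in L *.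
have t1 : 1 <= x / A by rewrite ler_pdivlMr; lra.
have e : 2 + x = (2 + A) * (1 + (x - A) / (2 + A)) by field; rewrite gt_eqF//; lra.
have y0 : 0 <= (x - A) / (2 + A) by rewrite divr_ge0; lra.
have le1 : (x - A) / (2 + A) <= x / A - 1.
  rewrite (_ : x / A - 1 = (x - A) / A); last by field; rewrite gt_eqF//; lra.
  by apply: ler_wpM2l; [lra|rewrite lef_pV2 ?posrE; lra].
rewrite e lnM ?posrE; [|lra..].
have := @le_ln1Dx R ((x - A) / (2 + A)) ltac:(lra).
have : (x / A - 1) <= 2 * l * (x / A - 1) by rewrite ler_peMl; lra.
rewrite -/l; lra.
Qed.

(** The case q = 1/2 of the hypothesis of [tail_bound_powR]. *)
Lemma sqrt_ln_growth (C A x : R) : 0 <= C -> 1 <= A -> A <= x ->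
  0 <= C * Num.sqrt (ln (2 + x)) <= 2 * C * Num.sqrt (ln (2 + A)) * (x / A) `^ (1 - 2^-1).
Proof.
move=> C0 A1 Ax; rewrite mulr_ge0//=.
have t0 : 0 <= x / A by rewrite divr_ge0; lra.
rewrite (_ : 1 - 2^-1 = 2^-1 :> R); last by field.
rewrite powR12_sqrt// -[2 * C]mulrC -!mulrA; apply: ler_wpM2l => //.
have L := ln2A_ge A1.
(* only the outer factor 2 becomes a square root *)
have e2 : 2 = Num.sqrt 4 :> R.
  by rewrite (_ : 4 = 2 ^+ 2) ?sqrtr_sqr ?ger0_norm//; ring.
rewrite [X in _ <= X * _]e2 -sqrtrM; last lra.
rewrite -sqrtrM//; apply: ler_wsqrtr; have := ln_growth A1 Ax.
have : 0 <= ln (2 + A) * (x / A) by rewrite mulr_ge0//; lra.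
lra.
Qed.

Lemma measurable_sqrt_ln (C A : R) : 1 <= A ->
  measurable_fun (`[A, +oo[%classic : set R) (fun x : R => C * Num.sqrt (ln (2 + x))).
Proof.
move=> A1; apply: measurable_funM => //.
apply: (eq_measurable_fun (fun x : R => ln (2 + x) `^ 2^-1)).
  move=> x; rewrite inE/= in_itv/= andbT => Ax.
  have x1 : 1 <= x by exact: le_trans Ax.
  by rewrite powR12_sqrt//; have := ln2A_ge x1; lra.
apply: measurable_funTS; apply: measurableT_comp (measurable_powR _) _.
apply: (measurableT_comp (@measurable_ln R)); exact: measurable_funD.
Qed.

End logarithmic_majorant.

Lemma powR_growth (R : realType) (C alpha A x : R) : 0 <= C -> 0 <= alpha -> 1 <= A -> A <= x ->
  0 <= C * (1 + x `^ alpha) <= 2 * C * A `^ alpha * (x / A) `^ alpha.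
Proof.
move=> C0 a0 A1 Ax; have x1 : 1 <= x by exact: le_trans Ax.
have A0 : 0 < A by exact: lt_le_trans A1.
rewrite mulr_ge0 ?addr_ge0 ?powR_ge0//=.
rewrite -mulrA -powRM ?(ltW A0)//; last by rewrite divr_ge0 ?(ltW A0)// (le_trans ler01).
rewrite mulrCA mulfV ?gt_eqF// mulr1 -mulrA mulrCA; apply: ler_wpM2l => //.
have e1 : 1 `^ alpha = 1 :> R by rewrite powR1.
have : 1 <= x `^ alpha by rewrite -[leLHS]e1; apply: ge0_ler_powR; rewrite ?nnegrE//; exact: le_trans x1.
lra.
Qed.

Lemma measurable_powR_envelope (R : realType) (C alpha : R) (D : set R) :
  measurable_fun D (fun x : R => C * (1 + x `^ alpha)).
Proof.
by apply: measurable_funTS; apply: measurable_funM => //; apply: measurable_funD.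
Qed.
Theorem theorem4p1 (R : realType) :
  (* the two bounds, for a general envelope h and for g = discrepancy P M K *)
  (forall (d : measure_display) (T : measurableType d) (P : probability T R)
      (M : {RV P >-> vague_borel R}) (K : R) (h : R -> R),
    0 < K -> stationary M -> intensity M = K%:E -> envelope M K h ->
    [/\ (* F_M(s) is well defined *)
        [/\ {ae P, forall w, forall s : R, ~ supp (M w : wpm R) s ->
              cvg (F_trunc (M w : wpm R) A s @[A --> +oo])},
            forall s : R, {ae P, forall w, ~ supp (M w : wpm R) s}
          & forall s : R,
              measurable_fun [set: T] (fun w => F_pv (M w : wpm R) s)],
        forall s A : R, 1 <= A ->
          ('E_P[fun w => `|F_pv (M w : wpm R) s - F_sym (M w : wpm R) A s|%R]
             <= tail_bound (EFin \o h) A)%E,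
        forall s A : R, 1 <= A ->
          exists X : {RV P >-> R},
            (forall w, X w = F_sym (M w : wpm R) A s / (pi * K)) /\
            (dBL (distribution P X) cauchy_prob
               <= tail_bound (EFin \o h) A * ((pi * K)^-1)%:E)%E
      & [/\ forall s A : R, 1 <= A ->
              ('E_P[fun w => `|F_pv (M w : wpm R) s - F_sym (M w : wpm R) A s|%R]
                 <= tail_bound (discrepancy M K) A)%E,
            forall s A : R, 1 <= A ->
              exists X : {RV P >-> R},
                (forall w, X w = F_sym (M w : wpm R) A s / (pi * K)) /\
                (dBL (distribution P X) cauchy_prob
                   <= tail_bound (discrepancy M K) A * ((pi * K)^-1)%:E)%E
          & tail_bound (discrepancy M K) A @[A --> +oo] --> 0%E]]) /\
  (* power-law discrepancy: C (1 + x^alpha) is an envelope and has T_h = O *)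
  (forall C alpha : R, 0 <= alpha < 1 ->
    let h := fun x : R => C * (1 + x `^ alpha) in
    exists B : R,
      forall (d : measure_display) (T : measurableType d) (P : probability T R)
        (M : {RV P >-> vague_borel R}) (K : R),
      0 < K -> stationary M -> intensity M = K%:E ->
      (forall x : R, (discrepancy M K x <= (h `|x|)%:E)%E) ->
      envelope M K h /\
      forall A : R, 1 <= A ->
        (`|tail_bound (EFin \o h) A| <= (B * A `^ (alpha - 1))%:E)%E) /\
  (* the logarithmic choice of h *)
  (forall C : R, 0 <= C ->
    let h := fun x : R => C * Num.sqrt (ln (2 + x)) in
    (exists B : R, forall A : R, 1 <= A ->
      (`|tail_bound (EFin \o h) A| <= (B * (Num.sqrt (ln (2 + A)) / A))%:E)%E) /\
    forall (d : measure_display) (T : measurableType d) (P : probability T R)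
      (M : {RV P >-> vague_borel R}) (K : R),
    0 < K -> stationary M -> intensity M = K%:E ->
    (forall x : R, 1 <= `|x| -> (discrepancy M K x <= (h `|x|)%:E)%E) ->
    envelope M K h).
Proof.
split; [|split].
- move=> d T P M K h K0 stM intM hP; have gint := envelope_gint hP.
  have mono A : 1 <= A -> (tail_bound (discrepancy M K) A <= tail_bound (EFin \o h) A)%E by exact: tail_bound_le.
  have bound s A : 1 <= A ->
      ('E_P[fun w => `|F_pv (M w : wpm R) s - F_sym (M w : wpm R) A s|%R] <= tail_bound (discrepancy M K) A)%E.
    by move=> A1; rewrite unlock; exact: mean_F_pv_F_sym.
  have law s A : 1 <= A -> exists X : {RV P >-> R},
      (forall w, X w = F_sym (M w : wpm R) A s / (pi * K)) /\
      (dBL (distribution P X) cauchy_prob <= tail_bound (discrepancy M K) A * ((pi * K)^-1)%:E)%E.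
    exact: F_sym_law.
  have pK : (0 <= ((pi * K)^-1)%:E :> \bar R)%E by rewrite lee_fin invr_ge0 mulr_ge0 ?pi_ge0// ltW.
  split.
  + split.
    * by apply: filterS (ae_cvg_F_trunc K0 stM intM gint) => w cw s _; exact: cw.
    * by move=> s; exact: ae_notin_supp K0 stM intM s.
    * by move=> s; exact: measurable_F_pvM.
  + by move=> s A A1; exact: le_trans (bound s A A1) (mono A A1).
  + move=> s A A1; have [X [XE Xd]] := law s A A1; exists X; split => //.
    by apply: le_trans Xd _; apply: lee_wpmul2r => //; exact: mono.
  + by split => //; exact: tail_bound_cvg0 K0 stM intM gint.
- move=> C alpha /andP[a0 a1] h; exists (4 * C * (1 + (1 - alpha)^-1)).
  move=> d T P M K K0 stM intM gh.
  have C0 : 0 <= C.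
    have := le_trans (discrepancy_ge0 M K 0) (gh 0); rewrite lee_fin /h.
    by rewrite pmulr_lge0// ltr_pwDl// powR_ge0.
  have q0 : 0 < 1 - alpha by rewrite subr_gt0.
  have qE : 1 - (1 - alpha) = alpha by ring.
  split.
    apply: (powR_envelope (D := 2 * C) q0); [exact: mulr_ge0|exact: measurable_powR_envelope| |by move=> x _; exact: gh].
    move=> x x1; rewrite qE; have := powR_growth C0 a0 (lexx 1) x1.
    by rewrite powR1 mulr1 divr1.
  move=> A A1; have A0 : 0 < A by exact: lt_le_trans A1.
  have hle x : A <= x -> 0 <= h x <= 2 * C * A `^ alpha * (x / A) `^ (1 - (1 - alpha)).
    by rewrite qE; exact: powR_growth.
  have D0 : 0 <= 2 * C * A `^ alpha by rewrite !mulr_ge0// powR_ge0.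
  apply: le_trans (tail_bound_powR A0 q0 D0 _ hle) _; first exact: measurable_powR_envelope.
  rewrite lee_fin powRB ?(gt_eqF A0) ?implybT// powRr1 ?(ltW A0)//.
  by rewrite le_eqVlt; apply/orP; left; apply/eqP; ring.
- move=> C C0 h; split.
    exists (12 * C) => A A1; have A0 : 0 < A by exact: lt_le_trans A1.
    have q0 : 0 < 2^-1 :> R by [].
    have D0 : 0 <= 2 * C * Num.sqrt (ln (2 + A)) by rewrite !mulr_ge0.
    apply: le_trans (tail_bound_powR A0 q0 D0 (measurable_sqrt_ln C A1) (fun x => sqrt_ln_growth C0 A1 (x := x))) _.
    rewrite lee_fin invrK le_eqVlt; apply/orP; left; apply/eqP; ring.
  move=> d T P M K K0 stM intM gh.
  apply: (powR_envelope (D := 2 * C * Num.sqrt (ln (2 + 1))) (q := 2^-1)) => //.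
  + by rewrite !mulr_ge0.
  + exact: measurable_sqrt_ln.
  + by move=> x x1; have := sqrt_ln_growth C0 (lexx 1) x1; rewrite divr1.
Qed.
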